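(* Assume $\mathbb E[\xi^2+\xi^{-1}+\nu^3]<\infty$. Then $$\lim_{n\to\infty} n\,\mathbb E[C_n]=\frac1{c_1}.$$ If in addition $p_1\,m<1$, then $$\lim_{n\to\infty}\frac{\mathbb E[R_n]}{n}=c_1\,\mathbb E\Big[\frac1W\Big].$$
   Context: Let $\mathbf p=(p_k)_{k\ge0}$ be a probability distribution on the nonnegative integers with $p_0=0$ and finite mean $m=\sum_k kp_k>1$. Let $\mathbb T$ be a Galton–Watson tree with offspring distribution $\mathbf p$, rooted at $\varnothing$, and let $\nu$ denote the number of children of the root (so $\nu\sim\mathbf p$). For a vertex $x$, $|x|$ is its depth and $\overleftarrow{x}$ its parent. Let $\mathbb T_n=\{x\in\mathbb T:|x|=n\}$. The depth of the edge $e=\{\overleftarrow x,x\}$ is $d(e)=|x|$. Let $\xi$ be a strictly positive random variable; conditionally on $\mathbb T$, let $\{\xi(e)\}$ be i.i.d. copies of $\xi$, and assign to each edge $e$ the resistance $r(e)=m^{d(e)}\xi(e)$. $C_n$ is the effective conductance between $\varnothing$ and $\mathbb T_n$, and $R_n=1/C_n$ the effective resistance. $W=\lim_{n\to\infty}m^{-n}\#\mathbb T_n$ (a.s. limit). Constants: $a_1=m^{-2}\mathbb E[\nu(\nu-1)]$, $b_1=\mathbb E[\xi]$, $c_1=\dfrac{a_1b_1}{1-m^{-1}}$. *)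

(* Defs.v *)
From HB Require Import structures.
From mathcomp Require Import all_boot all_order all_algebra.
From mathcomp Require Import all_classical all_reals all_analysis.
Set Implicit Arguments. Unset Strict Implicit. Unset Printing Implicit Defensive.
Import Order.TTheory GRing.Theory Num.Theory numFieldNormedType.Exports.
Local Open Scope classical_set_scope.
Local Open Scope ring_scope.

(* Vertices of the Ulam-Harris tree: labels u = [:: i1; ...; ik] (root first).
   The root is [::]; the children of x are rcons x i, and |x| = size x.
   Given offspring numbers Nw : seq nat -> nat, u is a vertex of the tree
   iff each index is smaller than the number of children of its parent. *)
Definition in_tree (Nw : seq nat -> nat) (u : seq nat) : Prop :=
  forall j, (j < size u)%N -> (nth 0%N u j < Nw (take j u))%N.

Fixpoint gen_size (Nw : seq nat -> nat) (x : seq nat) (k : nat) : nat :=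
  match k with
  | 0 => 1
  | k'.+1 => \sum_(i < Nw x) gen_size Nw (rcons x i) k'
  end.

(* Dirichlet energy  sum_e c(e) (f(e+) - f(e-))^2  over the edges of the
   subtree rooted at x down to k generations below x; cw y is the
   conductance of the edge {parent y, y}. *)
Fixpoint energy {R : realType} (Nw : seq nat -> nat) (cw : seq nat -> R)
    (f : seq nat -> R) (x : seq nat) (k : nat) : R :=
  match k with
  | 0 => 0
  | k'.+1 => \sum_(i < Nw x)
      (cw (rcons x i) * (f x - f (rcons x i)) ^+ 2
       + energy Nw cw f (rcons x i) k')
  end.

(* Effective conductance between the root and level n of the tree
   (Dirichlet principle): infimum of the energy over all potentials equal
   to 1 at the root and 0 on the vertices of depth n. *)
Definition eff_conductance {R : realType} (Nw : seq nat -> nat)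
    (cw : seq nat -> R) (n : nat) : R :=
  inf [set E | exists f : seq nat -> R,
        [/\ f [::] = 1,
            (forall y, in_tree Nw y -> size y = n -> f y = 0) &
            E = energy Nw cw f [::] n]].

(* Conductance of the edge {parent x, x} with resistance m^|x| * xi(x). *)
Definition edge_cond {R : realType} (m : R) (xiw : seq nat -> R) (x : seq nat) : R :=
  (m ^+ size x * xiw x)^-1.

Definition Cn {T : Type} {R : realType} (m : R) (N : seq nat -> T -> nat)
    (xi : seq nat -> T -> R) (n : nat) (w : T) : R :=
  eff_conductance (fun u => N u w) (edge_cond m (fun u => xi u w)) n.

Definition Rn {T : Type} {R : realType} (m : R) (N : seq nat -> T -> nat)
    (xi : seq nat -> T -> R) (n : nat) (w : T) : R :=
  (Cn m N xi n w)^-1.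

Definition Wlim {T : Type} {R : realType} (m : R) (N : seq nat -> T -> nat)
    (w : T) : R :=
  limn (fun n => m ^- n * (gen_size (fun u => N u w) [::] n)%:R).

Definition mutually_independent {d : measure_display} {T : measurableType d}
    {R : realType} (P : probability T R) {I : eqType} (X : I -> T -> R) : Prop :=
  forall (s : seq I) (B : I -> set R),
    uniq s -> (forall i, measurable (B i)) ->
    P (\big[setI/setT]_(i <- s) (X i @^-1` B i))
    = (\prod_(i <- s) P (X i @^-1` B i))%E.

Definition gw_family {T : Type} {R : realType} (N : seq nat -> T -> nat)
    (xi : seq nat -> T -> R) (i : seq nat + seq nat) : T -> R :=
  match i with
  | inl u => fun w => (N u w)%:R
  | inr u => xi u
  end.

(* Main.v *)
(** Write C_n for the conductance up to generation n, x_n, s_n, u_n for its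
    first three moments, b = E[xi], b_2 = E[xi^2] and a = a_1.

    The child subtrees of the root are independent and each of them, with the
    edge leading to it, contributes Y = C / (1 + xi C), so that
    C_{n+1} = m^-1 sum_{i < nu} Y_n^(i) in law. Everything comes from these
    recursions. For the conductance, the moments of C are squeezed between
    those of Y and satisfy x - b s <= x' <= x - k x^2,
    s' = m^-1 E[Y^2] + a x'^2 and E[Y^2] <= (s / x) x'. They give x -> 0,
    then x' / x -> 1, then s / x^2 and u / x^3 bounded, and finally
    s / x^2 -> a / (1 - m^-1); as b s - b_2 u <= x - x' <= b s, the increments
    1 / x' - 1 / x tend to c_1 and 1 / (n x_n) -> c_1 by Cesaro.

    For the resistance, the squared L^2 distance between C_n / x_n and the
    martingale W_n contracts by a factor m^-1 at each generation, up to an error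
    tending to 0, hence C_n / x_n -> W in L^1 and x_n E[min(1 / C_n, K / x_n)]
    -> E[min(1 / W, K)]. Uniform integrability of x_n / C_n is where p_1 m < 1
    enters: if nu = 1 the resistance is multiplied by m, which contracts the
    tail by the factor p_1 m, and if nu >= 2 then R_{n+1} is at most m times the
    smaller of two independent resistances, whose tail is negligible. *)

Require Import Defs.
From HB Require Import structures.
From mathcomp Require Import all_boot all_order all_algebra.
From mathcomp Require Import all_classical all_reals all_analysis.
From mathcomp Require Import measurable_realfun.
From mathcomp Require Import ring lra.
Import Order.TTheory GRing.Theory Num.Theory numFieldNormedType.Exports.
Set Implicit Arguments. Unset Strict Implicit. Unset Printing Implicit Defensive.
Local Open Scope classical_set_scope.
Local Open Scope ring_scope.

(** * Configurations on the Ulam-Harris tree *)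

(** The edge entering a vertex is attached to that vertex, so the weight at the root is the
    resistance of an edge above the tree. It is independent of the conductance of the tree, and this
    is what turns pointwise bounds on [Y = C / (1 + xi C)] into products of moments. Each part of
    the moment assumption has its place: E[1 / xi] makes the first conductance integrable, and each
    of the next generations gains one moment; E[nu^3] gives the recursion of u; E[xi^2] controls the
    second-order term of x - x'. The third moment is there because s - E[Y^2] is at most 2 b u,
    which must be negligible against x^2. For the resistance, convergence of C_n / x_n to W in L^1
    says nothing about large values of x_n / C_n. The truncated recursion closes because
    E[1 / W; nu = 1] = p_1 m E[1 / W], so that E[1 / W] is exactly the fixed point of z -> p_1 m z +
    (1 - p_1 m) E[1 / W]. On configurations the offspring number and the weight are made positive
    everywhere; the given probability space is compared with them only at the end. *)

Notation vertex_data := (seq nat + seq nat)%type.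

Definition cylinder {T : Type} {R : realType} (X : vertex_data -> T -> R)
    (J : set vertex_data) : set (set T) :=
  [set A | exists (s : seq vertex_data) (B : vertex_data -> set R),
    [/\ (forall i, i \in s -> J i), (forall i, measurable (B i)) &
        A = [set w | forall i, i \in s -> B i (X i w)]]].

Section cylinder.
Context {T : Type} {R : realType} (X : vertex_data -> T -> R).

Lemma cylinderS (J K : set vertex_data) :
  J `<=` K -> cylinder X J `<=` cylinder X K.
Proof. by move=> JK _ [s [B [sJ mB ->]]]; exists s, B; split=> // i /sJ /JK. Qed.

Lemma cylinderT J : cylinder X J setT.
Proof.
exists [::], (fun=> setT); split=> //.
by apply/seteqP; split=> x //= _ i; rewrite in_nil.
Qed.

Lemma cylinderI J : setI_closed (cylinder X J).
Proof.
move=> _ _ [s [B [sJ mB ->]]] [t [C [tJ mC ->]]].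
exists (s ++ t), (fun i => (if i \in s then B i else setT) `&`
                           (if i \in t then C i else setT)); split.
- by move=> i; rewrite mem_cat => /orP[/sJ|/tJ].
- by move=> i; apply: measurableI; case: ifP.
- apply/seteqP; split=> w /=.
    by move=> [wB wC] i _; split; case: ifP => // h; [exact: wB|exact: wC].
  move=> h; split=> i hi.
    by have [+ _] := h i ltac:(by rewrite mem_cat hi); rewrite hi.
  by have [_ +] := h i ltac:(by rewrite mem_cat hi orbT); rewrite hi.
Qed.

Lemma cylinder_preimage (J : set vertex_data) i B :
  J i -> measurable B -> cylinder X J (X i @^-1` B).
Proof.
move=> Ji mB; exists [:: i], (fun=> B); split=> //.
  by move=> j; rewrite inE => /eqP ->.
apply/seteqP; split=> w /=; first by move=> h j; rewrite inE => /eqP ->.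
by apply; rewrite inE.
Qed.

End cylinder.

Section configurations.
Context (R : realType).

Definition config := ((seq nat -> nat) * (seq nat -> R))%type.

HB.instance Definition _ := Pointed.on config.

Definition coord : vertex_data -> config -> R :=
  gw_family (fun u om => om.1 u) (fun u om => om.2 u).

(** All these spaces have the same points and differ only in their sigma-algebra: dependence on the
    coordinates in [J] alone is measurability on [configs J], and restriction maps are the
    identity. *)
Definition configs (J : set vertex_data) : measurableType _ :=
  g_sigma_algebraType (cylinder coord J).

Lemma measurable_configs d (T : measurableType d) J (f : T -> configs J) :
  (forall i, J i -> measurable_fun setT (coord i \o f)) ->
  measurable_fun setT f.
Proof.
move=> mf; apply: (@measurability _ _ T (configs J) setT f (cylinder coord J)) => //.
move=> _ [_ [s [B [sJ mB ->]]] <-]; rewrite setTI /=.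
rewrite (_ : _ @^-1` _ = \bigcap_(i in [set` s]) ((coord i \o f) @^-1` B i))//.
apply: fin_bigcap_measurable => // i /= /sJ Ji.
by rewrite -[X in measurable X]setTI; exact: mf.
Qed.

Lemma measurable_coord (J : set vertex_data) i : J i ->
  measurable_fun setT (coord i : configs J -> R).
Proof.
move=> Ji _ B mB; rewrite setTI; apply: sub_sigma_algebra.
exact: cylinder_preimage.
Qed.

Lemma measurable_configs_id (J K : set vertex_data) : J `<=` K ->
  measurable_fun setT (id : configs K -> configs J).
Proof.
by move=> JK; apply: measurable_configs => i Ji; apply: measurable_coord; apply: JK.
Qed.

Lemma measurable_configsS d (T : measurableType d) J K (f : config -> T) :
  J `<=` K -> measurable_fun setT (f : configs J -> T) ->
  measurable_fun setT (f : configs K -> T).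
Proof. by move=> JK mf; exact: (measurableT_comp mf (measurable_configs_id JK)). Qed.

Lemma measurable_natr d (T : measurableType d) (f : T -> nat) :
  measurable_fun setT (fun x => (f x)%:R : R) -> measurable_fun setT f.
Proof.
move=> mf _ B _; rewrite setTI.
have -> : f @^-1` B = \bigcup_(k in B) ((fun x => (f x)%:R : R) @^-1` [set k%:R]).
  apply/seteqP; split=> x /=; first by exists (f x).
  by move=> [k Bk /= /eqP]; rewrite eqr_nat => /eqP ->.
apply: bigcup_measurable => k _; rewrite -[X in measurable X]setTI; exact: mf.
Qed.

Lemma measurable_offspring (J : set vertex_data) u : J (inl u) ->
  measurable_fun setT (fun om : configs J => om.1 u).
Proof. by move=> Ju; apply: measurable_natr; exact: (measurable_coord Ju). Qed.

Lemma measurable_weight (J : set vertex_data) u : J (inr u) ->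
  measurable_fun setT (fun om : configs J => om.2 u).
Proof. by move=> Ju; exact: (measurable_coord Ju). Qed.

(** The configuration seen from [x]. Its weight at [[::]] is that of the edge entering [x], so a
    subtree travels together with the edge leading to it. *)
Definition shift (x : seq nat) (om : config) : config :=
  (fun u => om.1 (x ++ u), fun u => om.2 (x ++ u)).

Definition label (i : vertex_data) : seq nat :=
  match i with inl u => u | inr u => u end.

Definition move_label (x : seq nat) (i : vertex_data) : vertex_data :=
  match i with inl u => inl (x ++ u) | inr u => inr (x ++ u) end.

Lemma move_label_inj x : injective (move_label x).
Proof.
by move=> [u|u] [v|v]//= [] /eqP; rewrite eqseq_cat// eqxx => /eqP ->.
Qed.

Lemma coord_shift x i om : coord i (shift x om) = coord (move_label x i) om.
Proof. by case: i. Qed.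

Lemma measurable_shift (J K : set vertex_data) x :
  (forall i, J i -> K (move_label x i)) ->
  measurable_fun setT (shift x : configs K -> configs J).
Proof.
move=> JK; apply: measurable_configs => i Ji.
rewrite (_ : _ \o _ = coord (move_label x i)); first exact: (measurable_coord (JK _ Ji)).
by apply/funext => om /=; rewrite coord_shift.
Qed.

(** Obtained by cutting along the countably many values of [n]; it serves the sums over a random
    number of children. *)
Lemma measurable_fun_nat d (T : measurableType d) d' (T' : measurableType d')
    (n : T -> nat) (g : nat -> T -> T') :
  measurable_fun setT n -> (forall k, measurable_fun setT (g k)) ->
  measurable_fun setT (fun x => g (n x) x).
Proof.
move=> mn mg _ B mB; rewrite setTI.
have -> : (fun x => g (n x) x) @^-1` B =
    \bigcup_k ((n @^-1` [set k]) `&` (g k @^-1` B)).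
  apply/seteqP; split=> x /=; first by exists (n x).
  by move=> [k _ [/= -> ]].
apply: bigcup_measurable => k _; apply: measurableI.
  by rewrite -[X in measurable X]setTI; exact: mn.
by rewrite -[X in measurable X]setTI; exact: mg.
Qed.

Lemma measurable_configs_section d (T : measurableType d) (I J : set vertex_data)
    (G : config -> config -> T) om1 :
  measurable_fun setT (fun z : configs I * configs J => G z.1 z.2) ->
  measurable_fun setT (G om1 : configs J -> T).
Proof.
move=> mG.
have mp : measurable_fun setT
    (pair om1 : configs J -> (configs I * configs J)%type).
  exact: pair1_measurable.
have := measurableT_comp mG mp.
exact.
Qed.

End configurations.

(** * Independence over disjoint sets of coordinates *)

Section decoupling.
Context {R : realType}.
Variable mu : probability (configs R setT) R.
Hypothesis mu_indep : forall (J K : set vertex_data) (A B : set (config R)),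
  J `&` K = set0 -> cylinder (@coord R) J A -> cylinder (@coord R) K B ->
  mu (A `&` B) = (mu A * mu B)%E.

Let sub_cyl J : <<s cylinder (@coord R) J >> `<=` (measurable : set (set (configs R setT))).
Proof.
apply: sub_smallest2r; first exact: smallest_sigma_algebra.
by apply: cylinderS => i _.
Qed.

(** Uniqueness of finite measures on a pi-system, applied once for each argument. *)
Lemma indep_sigma (J K : set vertex_data) (A B : set (config R)) :
  J `&` K = set0 -> <<s cylinder (@coord R) J >> A ->
  <<s cylinder (@coord R) K >> B -> mu (A `&` B) = (mu A * mu B)%E.
Proof.
move=> JK sA sB.
(* With [B'] fixed, both sides are finite measures in [A'] that agree on cylinders. *)
have H1 (J' : set vertex_data) (B' : set (config R)) :
    measurable (B' : set (configs R setT)) ->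
    (forall A', cylinder (@coord R) J' A' -> mu (A' `&` B') = (mu A' * mu B')%E) ->
    forall A', <<s cylinder (@coord R) J' >> A' -> mu (A' `&` B') = (mu A' * mu B')%E.
  move=> mB' H A' sA'.
  have b_ge0 : (0 <= fine (mu B')) by rewrite fine_ge0.
  have bE : mu B' = (fine (mu B'))%:E by rewrite fineK// fin_num_measure.
  pose b := NngNum b_ge0.
  pose m1 := mrestr mu mB'.
  pose m2 := mscale b mu.
  have m2E E : m2 E = (mu E * mu B')%E by rewrite /m2 /mscale /= bE muleC.
  rewrite -m2E -[LHS]/(m1 A').
  apply: (@g_sigma_algebra_measure_unique _ R (configs R setT)
    (cylinder (@coord R) J') _ (fun=> setT)) => //.
  - by move=> C cC; apply: (@sub_cyl J'); exact: sub_sigma_algebra.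
  - by move=> i; exact: cylinderT.
  - by rewrite bigcup_const.
  - exact: cylinderI.
  - by move=> C cC; rewrite -[RHS]/(m2 C) m2E -H.
  - move=> _; rewrite /m1 /mrestr (le_lt_trans (probability_le1 _ _)) ?ltry//.
    by apply: measurableI.
apply: (H1 J B (@sub_cyl K _ sB)) => // A' cA'; rewrite setIC muleC.
apply: (H1 K A') => //; first by apply: (@sub_cyl J); exact: sub_sigma_algebra.
by move=> B' cB'; rewrite setIC muleC; exact: (mu_indep JK).
Qed.

(** For disjoint coordinate sets the map [om |-> (om, om)] sends [mu] to a product measure, and
    Tonelli applies. This takes the place of conditional expectations: the first argument is frozen
    while the second is integrated. *)
Lemma decoupling (J K : set vertex_data) (G : config R -> config R -> \bar R) :
  J `&` K = set0 ->
  measurable_fun setT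
    (fun z : configs R J * configs R K => G z.1 z.2) ->
  (forall x y, 0 <= G x y)%E ->
  (\int[mu]_om G om om = \int[mu]_om1 \int[mu]_om2 G om1 om2)%E.
Proof.
move=> JK mG G0.
have mJ : measurable_fun setT (id : configs R setT -> configs R J).
  exact: measurable_configs_id.
have mK : measurable_fun setT (id : configs R setT -> configs R K).
  exact: measurable_configs_id.
have mJK : measurable_fun setT
    ((fun om => (om, om)) : configs R setT -> (configs R J * configs R K)%type).
  exact: measurable_fun_pair.
pose fJ : {mfun configs R setT >-> configs R J} :=
  HB.pack (id : configs R setT -> configs R J) (isMeasurableFun.Build _ _ _ _ _ mJ).
pose fK : {mfun configs R setT >-> configs R K} :=
  HB.pack (id : configs R setT -> configs R K) (isMeasurableFun.Build _ _ _ _ _ mK).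
pose fJK : {mfun configs R setT >-> (configs R J * configs R K)%type} :=
  HB.pack ((fun om => (om, om)) : configs R setT -> (configs R J * configs R K)%type)
    (isMeasurableFun.Build _ _ _ _ _ mJK).
rewrite -(@ge0_integral_distribution _ _ _ _ _ mu fJK (fun z => G z.1 z.2))//=.
rewrite -(@eq_measure_integral _ _ _ setT (distribution mu fJK)
   (distribution mu fJ \x distribution mu fK)%E); last first.
  move=> A mA _; apply: (product_measure_unique (m' := distribution mu fJK)) => // B C mB mC.
  rewrite /distribution /pushforward /=.
  by rewrite -(indep_sigma JK mB mC).
rewrite fubini_tonelli1//.
rewrite ge0_integral_distribution//=; last 2 first.
- exact: measurable_fun_fubini_tonelli_F.
- by move=> y; apply: integral_ge0.
apply: eq_integral => om1 _ /=; rewrite /fubini_F.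
have mG1 : measurable_fun setT (G om1 : configs R K -> \bar R).
  exact: measurable_configs_section mG.
by rewrite (@ge0_integral_distribution _ _ _ _ _ mu fK (G om1)).
Qed.

End decoupling.

(** * Expectation *)

Section expectation.
Context {d : measure_display} {T : measurableType d} {R : realType}.
Variable P : probability T R.
Implicit Types F G : T -> R.

Definition ig F : Prop := P.-integrable setT (EFin \o F).

Definition Ex F : R := \int[P]_x F x.

Lemma ig_measurable F : ig F -> measurable_fun setT F.
Proof. by move=> /measurable_int /measurable_EFinP. Qed.

Lemma EFin_Ex F : ig F -> (\int[P]_x (F x)%:E)%E = (Ex F)%:E.
Proof. by move=> iF; rewrite /Ex /Rintegral fineK//; exact: integrable_fin_num. Qed.

Lemma ig_dom F G : measurable_fun setT F -> ig G ->
  (forall x, `|F x| <= G x) -> ig F.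
Proof.
move=> mF iG FG; apply: (le_integrable _ _ _ iG) => //.
  exact/measurable_EFinP.
by move=> x _ /=; rewrite lee_fin (le_trans (FG x))// ler_norm.
Qed.

Lemma ig_le F G : measurable_fun setT F -> ig G ->
  (forall x, 0 <= F x <= G x) -> ig F.
Proof.
by move=> mF iG FG; apply: ig_dom iG _ => // x; have /andP[F0] := FG x; rewrite ger0_norm.
Qed.

Lemma ig_cst c : ig (fun=> c).
Proof. exact: finite_measure_integrable_cst. Qed.

Lemma igD F G : ig F -> ig G -> ig (fun x => F x + G x).
Proof. by move=> iF iG; exact: (integrableD _ iF iG). Qed.

Lemma igB F G : ig F -> ig G -> ig (fun x => F x - G x).
Proof. by move=> iF iG; exact: (integrableB _ iF iG). Qed.

Lemma igZ c F : ig F -> ig (fun x => c * F x).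
Proof. by move=> iF; exact: (integrableZl _ c iF). Qed.

Lemma ig_norm F : ig F -> ig (fun x => `|F x|).
Proof. exact: integrable_norm. Qed.

Lemma ExD F G : ig F -> ig G -> Ex (fun x => F x + G x) = Ex F + Ex G.
Proof. by move=> iF iG; rewrite /Ex RintegralD. Qed.

Lemma ExB F G : ig F -> ig G -> Ex (fun x => F x - G x) = Ex F - Ex G.
Proof. by move=> iF iG; rewrite /Ex RintegralB. Qed.

Lemma ExZ c F : ig F -> Ex (fun x => c * F x) = c * Ex F.
Proof. by move=> iF; rewrite /Ex RintegralZl. Qed.

Lemma Ex_cst c : Ex (fun=> c) = c.
Proof.
rewrite /Ex Rintegral_cst// -[RHS]mulr1; congr (_ * _).
exact: (congr1 fine (probability_setT P)).
Qed.

Lemma Ex_ext F G : F =1 G -> Ex F = Ex G.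
Proof. by move=> /funext ->. Qed.

Lemma Ex_le F G : ig F -> ig G -> (forall x, F x <= G x) -> Ex F <= Ex G.
Proof. by move=> iF iG FG; apply: le_Rintegral. Qed.

Lemma Ex_ge0 F : (forall x, 0 <= F x) -> 0 <= Ex F.
Proof. by move=> F0; apply: Rintegral_ge0. Qed.

Lemma Ex_norm F : ig F -> `|Ex F| <= Ex (fun x => `|F x|).
Proof. by move=> iF; exact: le_normr_Rintegral. Qed.

Lemma ig_fin F : measurable_fun setT F -> (forall x, 0 <= F x) ->
  (\int[P]_x (F x)%:E < +oo)%E -> ig F.
Proof.
move=> mF F0 Foo; apply/integrableP; split; first exact/measurable_EFinP.
by under eq_integral => x _ do rewrite /= ger0_norm//.
Qed.

(** Integrability and value come together from the extended integral; this is why the moment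
    formulas below return pairs. *)
Lemma Ex_EFin F c : measurable_fun setT F -> (forall x, 0 <= F x) ->
  (\int[P]_x (F x)%:E)%E = c%:E -> ig F /\ Ex F = c.
Proof.
move=> mF F0 Fc; have iF : ig F by apply: ig_fin => //; rewrite Fc ltry.
by split=> //; apply: EFin_inj; rewrite -EFin_Ex.
Qed.

(** A nonnegative function of mean zero vanishes almost everywhere; here the exceptional set would
    be the whole space, of mass one. *)
Lemma Ex_gt0 F : ig F -> (forall x, 0 < F x) -> 0 < Ex F.
Proof.
move=> iF F0; rewrite lt_neqAle Ex_ge0 ?andbT; last by move=> x; exact/ltW.
apply/eqP => F00.
have mF := ig_measurable iF.
have : (\int[P]_x `|(F x)%:E| = 0)%E.
  under eq_integral => x _ do rewrite /= ger0_norm ?ltW//.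
  by rewrite EFin_Ex// -F00.
move=> /(ae_eq_integral_abs P measurableT) -/(_ ltac:(exact/measurable_EFinP)).
move=> [N [mN N0 Nsub]].
have NT : N = setT.
  apply/seteqP; split=> // x _; apply: Nsub => /= /(_ I) [] /eqP.
  by rewrite gt_eqF.
have P1 : P N = 1%E by rewrite NT; exact: probability_setT.
have : 1%E = 0%E :> \bar R by rewrite -P1; exact: N0.
by move=> [] /eqP; rewrite oner_eq0.
Qed.

Lemma ae_imply (A B : T -> Prop) : {ae P, forall x, A x} ->
  (forall x, A x -> B x) -> {ae P, forall x, B x}.
Proof. by move=> aeA AB; apply: filterS aeA. Qed.

End expectation.

Section product_expectation.
Context {R : realType}.
Variable mu : probability (configs R setT) R.
Hypothesis mu_indep : forall (J K : set vertex_data) (A B : set (config R)),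
  J `&` K = set0 -> cylinder (@coord R) J A -> cylinder (@coord R) K B ->
  mu (A `&` B) = (mu A * mu B)%E.
Hypothesis mu_shift : forall x (A : set (config R)),
  cylinder (@coord R) setT A -> mu (shift x @^-1` A) = mu A.
Implicit Types F G : config R -> R.
Local Notation ig := (ig mu).
Local Notation Ex := (Ex mu).

(** A subtree has the law of the whole tree: the hypothesis on cylinders extends to all events by
    uniqueness on a pi-system. *)
Lemma ge0_Ex_shift x F : measurable_fun setT (F : configs R setT -> R) ->
  (forall om, 0 <= F om) -> ig F -> ig (F \o shift x) /\ Ex (F \o shift x) = Ex F.
Proof.
move=> mF F0 iF.
have ms : measurable_fun setT (shift x : configs R setT -> configs R setT).
  exact: measurable_shift.
apply: Ex_EFin; first exact: measurableT_comp ms.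
  by move=> om /=.
rewrite -EFin_Ex//.
pose f : {mfun configs R setT >-> configs R setT} :=
  HB.pack (shift x : configs R setT -> configs R setT)
    (isMeasurableFun.Build _ _ _ _ _ ms).
have mEF : measurable_fun setT (EFin \o F : configs R setT -> \bar R).
  exact/measurable_EFinP.
have EF0 om : (0 <= (EFin \o F) om)%E by rewrite lee_fin.
rewrite -(@ge0_integral_distribution _ _ _ _ _ mu f _ mEF EF0).
apply: eq_measure_integral => A mA _.
apply: (@g_sigma_algebra_measure_unique _ R (configs R setT)
    (cylinder (@coord R) setT) _ (fun=> setT)) => //.
- by move=> C cC; exact: sub_sigma_algebra.
- by move=> i; exact: cylinderT.
- by rewrite bigcup_const.
- exact: cylinderI.
- by move=> C cC; exact: mu_shift.
- by move=> _; rewrite (le_lt_trans (probability_le1 _ _)) ?ltry.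
Qed.

Lemma ge0_Ex_prod (J K : set vertex_data) F G : J `&` K = set0 ->
  measurable_fun setT (F : configs R J -> R) ->
  measurable_fun setT (G : configs R K -> R) ->
  (forall om, 0 <= F om) -> (forall om, 0 <= G om) -> ig F -> ig G ->
  ig (fun om => F om * G om) /\ Ex (fun om => F om * G om) = Ex F * Ex G.
Proof.
move=> JK mF mG F0 G0 iF iG; apply: Ex_EFin.
- by apply: measurable_funM; [exact: measurable_configsS mF|exact: measurable_configsS mG].
- by move=> om; apply: mulr_ge0.
rewrite (decoupling mu_indep (G := fun x y => (F x * G y)%:E) JK); last 2 first.
- apply/measurable_EFinP; apply: measurable_funM.
    exact: measurableT_comp mF measurable_fst.
  exact: measurableT_comp mG measurable_snd.
- by move=> x y; rewrite lee_fin mulr_ge0.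
under eq_integral => x _.
  under eq_integral => y _ do rewrite EFinM.
  rewrite ge0_integralZl_EFin//; first last.
  - by apply/measurable_EFinP; exact: ig_measurable iG.
  - by move=> y _; rewrite lee_fin.
  rewrite EFin_Ex// -EFinM mulrC.
over.
by rewrite EFin_Ex ?ExZ 1?mulrC//; exact: igZ.
Qed.

(** Conditioning on an index independent of the family: each member may be replaced by its mean
    before the index is averaged. *)
Lemma ge0_Ex_random_index (J K : set vertex_data) (n : config R -> nat)
    (G : nat -> config R -> R) (g : nat -> R) : J `&` K = set0 ->
  measurable_fun setT (n : configs R J -> nat) ->
  (forall k, measurable_fun setT (G k : configs R K -> R)) ->
  (forall k om, 0 <= G k om) -> (forall k, ig (G k) /\ Ex (G k) = g k) ->
  ig (g \o n) ->
  ig (fun om => G (n om) om) /\ Ex (fun om => G (n om) om) = Ex (g \o n).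
Proof.
move=> JK mn mG G0 Gg ign; apply: Ex_EFin.
- apply: measurable_fun_nat; first exact: measurable_configsS mn.
  by move=> k; exact: measurable_configsS (mG k).
- by move=> om.
rewrite (decoupling mu_indep (G := fun x y => (G (n x) y)%:E) JK); last 2 first.
- apply/measurable_EFinP.
  apply: (@measurable_fun_nat _ (configs R J * configs R K)%type _ _ (n \o fst)
            (fun k z => G k z.2)) => [|k].
    exact: measurableT_comp mn measurable_fst.
  exact: measurableT_comp (mG k) measurable_snd.
- by move=> x y; rewrite lee_fin.
under eq_integral => x _.
  have [iG GE] := Gg (n x); rewrite EFin_Ex// GE.
over.
by rewrite -EFin_Ex.
Qed.

End product_expectation.

(** * Sums over the children of the root *)

Section child_sums.
Context {R : realType}.
Variable mu : probability (configs R setT) R.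
Hypothesis mu_indep : forall (J K : set vertex_data) (A B : set (config R)),
  J `&` K = set0 -> cylinder (@coord R) J A -> cylinder (@coord R) K B ->
  mu (A `&` B) = (mu A * mu B)%E.
Hypothesis mu_shift : forall x (A : set (config R)),
  cylinder (@coord R) setT A -> mu (shift x @^-1` A) = mu A.
Implicit Types F G Y V : config R -> R.
Local Notation ig := (ig mu).
Local Notation Ex := (Ex mu).

(** The number of terms is an argument instead of being read from [om], so that for fixed [k] the
    sum sees only coordinates below the root and is independent of the offspring number. *)
Definition child_sum F (k : nat) (om : config R) : R :=
  \sum_(i < k) F (shift [:: val i] om).

Lemma child_sumS F k om :
  child_sum F k.+1 om = child_sum F k om + F (shift [:: k] om).
Proof. by rewrite /child_sum big_ord_recr. Qed.

Lemma child_sum_ge0 F k om : (forall om, 0 <= F om) -> 0 <= child_sum F k om.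
Proof. by move=> F0; apply: sumr_ge0. Qed.

(** Disjoint from the coordinates of child [k] itself: a partial sum is independent of the next
    term, which drives the inductions on [k]. *)
Definition below_child (k : nat) : set vertex_data :=
  [set i | if label i is a :: _ then (a < k)%N else false].

Definition at_child (k : nat) : set vertex_data :=
  [set i | if label i is a :: _ then a == k else false].

Definition below_root : set vertex_data := [set i | label i != [::]].

Lemma below_at_child k : below_child k `&` at_child k = set0.
Proof.
rewrite -subset0 /below_child /at_child => i [] /=.
by case: (label i) => // a u /[swap] /eqP ->; rewrite ltnn.
Qed.

Lemma measurable_child F k : measurable_fun setT (F : configs R setT -> R) ->
  measurable_fun setT (F \o shift [:: k] : configs R (at_child k) -> R).
Proof.
move=> mF; apply: (measurableT_comp mF).
apply: (measurable_shift (J := setT)) => i _.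
by case: i => u; rewrite /at_child /= eqxx.
Qed.

Lemma measurable_child_sum F k : measurable_fun setT (F : configs R setT -> R) ->
  measurable_fun setT (child_sum F k : configs R (below_child k) -> R).
Proof.
move=> mF; apply: measurable_sum => i.
apply: (measurable_configsS (J := at_child i)); last exact: measurable_child.
by move=> j; rewrite /at_child /below_child /=; case: (label j) => // a _ /eqP ->.
Qed.

Lemma measurable_child_sum_root F k : measurable_fun setT (F : configs R setT -> R) ->
  measurable_fun setT (child_sum F k : configs R below_root -> R).
Proof.
move=> mF; apply: (measurable_configsS (J := below_child k)) => [i|].
  by rewrite /below_root /below_child /=; case: (label i).
exact: measurable_child_sum.
Qed.

Lemma ge0_Ex_child_sum F k : measurable_fun setT (F : configs R setT -> R) ->
  (forall om, 0 <= F om) -> ig F ->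
  ig (child_sum F k) /\ Ex (child_sum F k) = k%:R * Ex F.
Proof.
move=> mF F0 iF; elim: k => [|k [iS ES]].
  rewrite (_ : child_sum F 0 = fun=> 0); last first.
    by apply/funext => om; rewrite /child_sum big_ord0.
  by split; [exact: ig_cst|rewrite Ex_cst mul0r].
have [iFk EFk] := ge0_Ex_shift mu_shift [:: k] mF F0 iF.
rewrite (_ : child_sum F k.+1 = fun om => child_sum F k om + (F \o shift [:: k]) om).
  by split; [exact: igD|rewrite ExD// ES EFk -natr1 mulrDl mul1r].
by apply/funext => om; rewrite child_sumS.
Qed.

(** Expanding the product gives [k] diagonal pairs of indices and [k (k - 1)] pairs of distinct
    ones, whose factors are independent; the induction adds one child at a time. *)
Lemma ge0_Ex_child_sumM Y V k :
  measurable_fun setT (Y : configs R setT -> R) ->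
  measurable_fun setT (V : configs R setT -> R) ->
  (forall om, 0 <= Y om) -> (forall om, 0 <= V om) ->
  ig Y -> ig V -> ig (fun om => Y om * V om) ->
  ig (fun om => child_sum Y k om * child_sum V k om) /\
  Ex (fun om => child_sum Y k om * child_sum V k om) =
    k%:R * Ex (fun om => Y om * V om) + k%:R * (k%:R - 1) * (Ex Y * Ex V).
Proof.
move=> mY mV Y0 V0 iY iV iYV; elim: k => [|k [iS ES]].
  rewrite (_ : (fun om => _) = fun=> 0); last first.
    by apply/funext => om; rewrite /child_sum big_ord0 mul0r.
  by split; [exact: ig_cst|rewrite Ex_cst !mul0r addr0].
have [iYk EYk] := ge0_Ex_shift mu_shift [:: k] mY Y0 iY.
have [iVk EVk] := ge0_Ex_shift mu_shift [:: k] mV V0 iV.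
have [iYVk EYVk] := ge0_Ex_shift mu_shift [:: k]
  (measurable_funM mY mV) (fun om => mulr_ge0 (Y0 om) (V0 om)) iYV.
have [iSY ESY] := ge0_Ex_child_sum k mY Y0 iY.
have [iSV ESV] := ge0_Ex_child_sum k mV V0 iV.
have [i1 E1] := ge0_Ex_prod mu_indep (@below_at_child k)
  (@measurable_child_sum _ k mY) (@measurable_child _ k mV)
  (fun om => child_sum_ge0 k om Y0) (fun om => V0 _) iSY iVk.
have [i2 E2] := ge0_Ex_prod mu_indep (@below_at_child k)
  (@measurable_child_sum _ k mV) (@measurable_child _ k mY)
  (fun om => child_sum_ge0 k om V0) (fun om => Y0 _) iSV iYk.
rewrite (_ : (fun om => _) = fun om =>
    ((child_sum Y k om * child_sum V k om + child_sum Y k om * (V \o shift [:: k]) om)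
     + child_sum V k om * (Y \o shift [:: k]) om)
    + ((fun om => Y om * V om) \o shift [:: k]) om); last first.
  by apply/funext => om /=; rewrite !child_sumS; ring.
split; first by do 3 (apply: igD => //).
rewrite ExD//; last by do 2 (apply: igD => //).
rewrite ExD//; last by apply: igD.
by rewrite ExD// E1 E2 EYVk ES ESY ESV EYk EVk -natr1; ring.
Qed.

(** Among the triples of indices, [3 k (k - 1)] have exactly two equal entries and
    [k (k - 1) (k - 2)] have pairwise distinct ones. *)
Lemma ge0_Ex_child_sum3 Y k :
  measurable_fun setT (Y : configs R setT -> R) -> (forall om, 0 <= Y om) ->
  ig Y -> ig (fun om => Y om ^+ 2) -> ig (fun om => Y om ^+ 3) ->
  ig (fun om => child_sum Y k om ^+ 3) /\
  Ex (fun om => child_sum Y k om ^+ 3) =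
    k%:R * Ex (fun om => Y om ^+ 3)
    + 3 * (k%:R * (k%:R - 1)) * (Ex (fun om => Y om ^+ 2) * Ex Y)
    + k%:R * (k%:R - 1) * (k%:R - 2) * Ex Y ^+ 3.
Proof.
move=> mY Y0 iY iY2 iY3; elim: k => [|k [iS ES]].
  rewrite (_ : (fun om => child_sum _ _ _ ^+ 3) = fun=> 0); last first.
    by apply/funext => om; rewrite /child_sum big_ord0 expr0n.
  by split; [exact: ig_cst|rewrite Ex_cst !(mul0r, mulr0, addr0)].
have Y20 om : 0 <= Y om ^+ 2 by rewrite exprn_ge0.
have Y30 om : 0 <= Y om ^+ 3 by rewrite exprn_ge0.
have [iYk EYk] := ge0_Ex_shift mu_shift [:: k] mY Y0 iY.
have mY2 := measurable_funX 2 mY.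
have [iY2k EY2k] := ge0_Ex_shift mu_shift [:: k] mY2 Y20 iY2.
have [iY3k EY3k] := ge0_Ex_shift mu_shift [:: k] (measurable_funX 3 mY) Y30 iY3.
have [iSY ESY] := ge0_Ex_child_sum k mY Y0 iY.
have [iSY2 ESY2] := ge0_Ex_child_sumM k mY mY Y0 Y0 iY iY iY2.
have [i1 E1] := ge0_Ex_prod mu_indep (@below_at_child k)
  (@measurable_child_sum _ k mY) (@measurable_child _ k mY2)
  (fun om => child_sum_ge0 k om Y0) (fun om => Y20 _) iSY iY2k.
have [i2 E2] := ge0_Ex_prod mu_indep (@below_at_child k)
  (measurable_funX 2 (@measurable_child_sum _ k mY)) (@measurable_child _ k mY)
  (fun om => exprn_ge0 2 (child_sum_ge0 k om Y0)) (fun om => Y0 _) iSY2 iYk.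
rewrite (_ : (fun om => child_sum _ _ _ ^+ 3) = fun om =>
    ((child_sum Y k om ^+ 3
      + 3 * (child_sum Y k om ^+ 2 * (Y \o shift [:: k]) om))
     + 3 * (child_sum Y k om * ((fun om => Y om ^+ 2) \o shift [:: k]) om))
    + ((fun om => Y om ^+ 3) \o shift [:: k]) om); last first.
  by apply/funext => om /=; rewrite !child_sumS; ring.
have i1' := igZ 3 i1; have i2' := igZ 3 i2.
split; first by do 3 (apply: igD => //).
rewrite ExD//; last by do 2 (apply: igD => //).
rewrite ExD//; last by apply: igD.
rewrite ExD// !ExZ//.
by rewrite E1 E2 EY2k EY3k ES ESY ESY2 EYk -natr1; ring.
Qed.

(* The floor at 1 makes every configuration survive; it is almost surely the
   number of children of the root, since p_0 = 0. *)
Definition offspring (om : config R) : nat := maxn 1 (om.1 [::]).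

Lemma offspring_gt0 om : (0 < offspring om)%N.
Proof. by rewrite /offspring leq_max. Qed.

Lemma measurable_offspring_root (J : set vertex_data) : J (inl [::]) ->
  measurable_fun setT (offspring : configs R J -> nat).
Proof.
move=> J0; apply: measurable_fun_maxn; first exact: measurable_cst.
exact: measurable_offspring.
Qed.

Lemma root_below_root : [set inl [::]] `&` below_root = set0.
Proof. by apply/seteqP; split=> // i [/= ->]; rewrite /below_root /=. Qed.

Hypothesis ig_offspring3 : ig (fun om => (offspring om)%:R ^+ 3).

Lemma ig_offspring_le (f : nat -> R) :
  (forall k, (0 < k)%N -> 0 <= f k <= k%:R ^+ 3) -> ig (fun om => f (offspring om)).
Proof.
move=> f3; apply: ig_le ig_offspring3 _ => [|om]; last exact/f3/offspring_gt0.
by apply: (@measurableT_comp _ _ _ _ _ _ f _ _ _ (measurable_offspring_root _)).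
Qed.

Lemma ig_offspring : ig (fun om => (offspring om)%:R).
Proof.
apply: (ig_offspring_le (f := fun k => k%:R)) => k k0; rewrite ler0n/=.
by rewrite -[leLHS]expr1 ler_weXn2l// ler1n.
Qed.

Lemma ig_offspring2 : ig (fun om => (offspring om)%:R * ((offspring om)%:R - 1)).
Proof.
apply: (ig_offspring_le (f := fun k => k%:R * (k%:R - 1))) => k k0.
have : 1 <= k%:R :> R by rewrite ler1n.
by move=> h; apply/andP; split; nra.
Qed.

Lemma ig_offspring3' : ig (fun om =>
  (offspring om)%:R * ((offspring om)%:R - 1) * ((offspring om)%:R - 2)).
Proof.
apply: (ig_offspring_le (f := fun k => k%:R * (k%:R - 1) * (k%:R - 2))) => -[//|k] _.
rewrite -natr1; have : 0 <= k%:R :> R by [].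
case: k => [|k] h; first by rewrite !(mul0r, add0r, subrr, mulr0)/=; lra.
have h1 : 1 <= k.+1%:R :> R by rewrite ler1n.
by apply/andP; split; nra.
Qed.

(** Wald's identity, by freezing the number of children. *)
Lemma Ex_branch Y : measurable_fun setT (Y : configs R setT -> R) ->
  (forall om, 0 <= Y om) -> ig Y ->
  ig (fun om => child_sum Y (offspring om) om) /\
  Ex (fun om => child_sum Y (offspring om) om) =
    Ex (fun om => (offspring om)%:R) * Ex Y.
Proof.
move=> mY Y0 iY.
rewrite mulrC -ExZ; last exact: ig_offspring.
apply: (ge0_Ex_random_index mu_indep root_below_root
  (n := offspring) (G := child_sum Y) (g := fun k => Ex Y * k%:R)).
- exact: measurable_offspring_root.
- by move=> k; exact: measurable_child_sum_root.
- by move=> k om; exact: child_sum_ge0.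
- by move=> k; rewrite mulrC; exact: ge0_Ex_child_sum.
- by apply: igZ; exact: ig_offspring.
Qed.

Lemma Ex_branchM Y V :
  measurable_fun setT (Y : configs R setT -> R) ->
  measurable_fun setT (V : configs R setT -> R) ->
  (forall om, 0 <= Y om) -> (forall om, 0 <= V om) ->
  ig Y -> ig V -> ig (fun om => Y om * V om) ->
  ig (fun om => child_sum Y (offspring om) om * child_sum V (offspring om) om) /\
  Ex (fun om => child_sum Y (offspring om) om * child_sum V (offspring om) om) =
    Ex (fun om => (offspring om)%:R) * Ex (fun om => Y om * V om)
    + Ex (fun om => (offspring om)%:R * ((offspring om)%:R - 1)) * (Ex Y * Ex V).
Proof.
move=> mY mV Y0 V0 iY iV iYV.
have i1 := ig_offspring; have i2 := ig_offspring2.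
pose g (k : nat) := Ex (fun om => Y om * V om) * k%:R
                    + Ex Y * Ex V * (k%:R * (k%:R - 1)).
have [|||||igg Eg] := ge0_Ex_random_index mu_indep root_below_root
  (n := offspring) (G := fun k om => child_sum Y k om * child_sum V k om) (g := g).
- exact: measurable_offspring_root.
- by move=> k; apply: measurable_funM; exact: measurable_child_sum_root.
- by move=> k om; apply: mulr_ge0; exact: child_sum_ge0.
- move=> k; rewrite /g mulrC (mulrC (Ex Y * Ex V)); exact: ge0_Ex_child_sumM.
- by apply: igD; exact: igZ.
split=> //; rewrite Eg /g /= ExD; [|exact: igZ..].
by rewrite !ExZ//; ring.
Qed.

Lemma Ex_branch3 Y :
  measurable_fun setT (Y : configs R setT -> R) -> (forall om, 0 <= Y om) ->
  ig Y -> ig (fun om => Y om ^+ 2) -> ig (fun om => Y om ^+ 3) ->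
  ig (fun om => child_sum Y (offspring om) om ^+ 3) /\
  Ex (fun om => child_sum Y (offspring om) om ^+ 3) =
    Ex (fun om => (offspring om)%:R) * Ex (fun om => Y om ^+ 3)
    + 3 * Ex (fun om => (offspring om)%:R * ((offspring om)%:R - 1))
        * (Ex (fun om => Y om ^+ 2) * Ex Y)
    + Ex (fun om => (offspring om)%:R * ((offspring om)%:R - 1)
                    * ((offspring om)%:R - 2)) * Ex Y ^+ 3.
Proof.
move=> mY Y0 iY iY2 iY3.
have i1 := ig_offspring; have i2 := ig_offspring2; have i3 := ig_offspring3'.
pose y1 := Ex Y; pose y2 := Ex (fun om => Y om ^+ 2); pose y3 := Ex (fun om => Y om ^+ 3).
pose g (k : nat) := (y3 * k%:R + 3 * (y2 * y1) * (k%:R * (k%:R - 1)))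
   + y1 ^+ 3 * (k%:R * (k%:R - 1) * (k%:R - 2)).
have [|||||igg Eg] := ge0_Ex_random_index mu_indep root_below_root
  (n := offspring) (G := fun k om => child_sum Y k om ^+ 3) (g := g).
- exact: measurable_offspring_root.
- by move=> k; apply: measurable_funX; exact: measurable_child_sum_root.
- by move=> k om; apply: exprn_ge0; exact: child_sum_ge0.
- move=> k; have [iS ->] := ge0_Ex_child_sum3 k mY Y0 iY iY2 iY3; split=> //.
  by rewrite /g -/y1 -/y2 -/y3; ring.
- by apply: igD; [apply: igD|]; exact: igZ.
split=> //; rewrite Eg /g /= /y1 /y2 /y3.
rewrite ExD; [|by apply: igD; exact: igZ|exact: igZ].
rewrite ExD; [|exact: igZ..].
by rewrite !ExZ//; ring.
Qed.

End child_sums.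

(** * The conductance recursion *)

(* For positive functions inversion is [fun x => expR (- ln x)]. *)
Lemma measurable_inv_gt0 d (T : measurableType d) (R : realType) (F : T -> R) :
  measurable_fun setT F -> (forall x, 0 < F x) ->
  measurable_fun setT (fun x => (F x)^-1).
Proof.
move=> mF F0.
rewrite (_ : (fun x => _) = fun x => expR (- ln (F x))); last first.
  by apply/funext => x; rewrite expRN lnK ?posrE.
apply: measurableT_comp; first exact: measurable_expR.
apply: measurable_funN; apply: measurableT_comp => //; exact: measurable_ln.
Qed.

(** The inverse of [0] is [0], so the zero set is treated apart; the inner conditional supplies a
    function that is positive everywhere. *)
Lemma measurable_inv_ge0 d (T : measurableType d) (R : realType) (F : T -> R) :
  measurable_fun setT F -> (forall x, 0 <= F x) ->
  measurable_fun setT (fun x => (F x)^-1).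
Proof.
move=> mF F0.
have mb : measurable_fun setT (fun x => 0 < F x) by exact: measurable_fun_ltr.
rewrite (_ : (fun x => _) = fun x =>
    if 0 < F x then (if 0 < F x then F x else 1)^-1 else 0).
  apply: measurable_fun_ifT => //; apply: measurable_inv_gt0.
    exact: measurable_fun_ifT.
  by move=> x; case: ifP.
apply/funext => x; have [//|h] := ltP 0 (F x).
have -> : F x = 0 by apply/eqP; rewrite eq_le h F0.
by rewrite invr0.
Qed.

Section conductance.
Context {R : realType}.
Variable m : R.
Hypothesis m_gt0 : 0 < m.

(* Made positive everywhere; it agrees with [om.2 [::]] almost surely. *)
Definition weight (om : config R) : R := if 0 < om.2 [::] then om.2 [::] else 1.

Lemma weight_gt0 om : 0 < weight om.
Proof. by rewrite /weight; case: ifP. Qed.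

Lemma measurable_weight_root (J : set vertex_data) : J (inr [::]) ->
  measurable_fun setT (weight : configs R J -> R).
Proof.
move=> J0; have mw := measurable_weight J0.
apply: measurable_fun_ifT; [|exact: mw|exact: measurable_cst].
by apply: measurable_fun_ltr; [exact: measurable_cst|exact: mw].
Qed.

(* [con n] is the conductance C_{n+1}. The child with incoming resistance [xi]
   contributes [yv n]; the case [n = 0] is that of a leaf connected to the
   sink, that is, of infinite conductance. *)
Fixpoint con (n : nat) (om : config R) : R :=
  m^-1 * child_sum (fun om' => match n with
    | 0 => (weight om')^-1
    | n'.+1 => con n' om' / (1 + weight om' * con n' om')
    end) (offspring om) om.

(** The same expression as the summand inside [con], where structural recursion prevents naming it
    beforehand. *)
Definition yv (n : nat) (om : config R) : R :=
  match n with
  | 0 => (weight om)^-1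
  | n'.+1 => con n' om / (1 + weight om * con n' om)
  end.

Lemma conE n om : con n om = m^-1 * child_sum (yv n) (offspring om) om.
Proof. by case: n. Qed.

(** The martingale m^-n #T_n, put in the same root-to-children form as [con] so that the two can be
    compared generation by generation. *)
Fixpoint gw (n : nat) (om : config R) : R :=
  match n with
  | 0 => 1
  | n'.+1 => m^-1 * child_sum (gw n') (offspring om) om
  end.

Lemma child_sum_gt0 (F : config R -> R) om : (forall om, 0 < F om) ->
  0 < child_sum F (offspring om) om.
Proof.
move=> F0; have := offspring_gt0 om.
case: (offspring om) => // k _; rewrite /child_sum big_ord_recl.
by apply: ltr_pwDl => //; apply: sumr_ge0 => i _; exact/ltW.
Qed.

Lemma con_gt0 n om : 0 < con n om.
Proof.
elim: n om => [|n IHn] om; rewrite conE mulr_gt0 ?invr_gt0//; apply: child_sum_gt0.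
  by move=> om'; rewrite /yv invr_gt0 weight_gt0.
by move=> om'; rewrite divr_gt0 ?addr_gt0 ?mulr_gt0 ?weight_gt0.
Qed.

Lemma yv_gt0 n om : 0 < yv n om.
Proof.
case: n => [|n]; first by rewrite /yv invr_gt0 weight_gt0.
by rewrite divr_gt0 ?addr_gt0 ?mulr_gt0 ?con_gt0 ?weight_gt0.
Qed.

Lemma gw_gt0 n om : 0 < gw n om.
Proof.
elim: n om => //= n IHn om.
by rewrite mulr_gt0 ?invr_gt0//; exact: child_sum_gt0.
Qed.

Lemma con_ge0 n om : 0 <= con n om. Proof. exact/ltW/con_gt0. Qed.
Lemma yv_ge0 n om : 0 <= yv n om. Proof. exact/ltW/yv_gt0. Qed.
Lemma gw_ge0 n om : 0 <= gw n om. Proof. exact/ltW/gw_gt0. Qed.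

(** [con] reads only these coordinates, hence is independent of [weight]. *)
Definition not_root_weight : set vertex_data := [set i | i <> inr [::]].

Lemma below_rootW : below_root `<=` not_root_weight.
Proof. by move=> i /= /[swap] ->; rewrite /below_root. Qed.

Lemma measurable_random_child_sum (F : config R -> R) :
  measurable_fun setT (F : configs R setT -> R) ->
  measurable_fun setT
    (fun om : configs R not_root_weight => child_sum F (offspring om) om).
Proof.
move=> mF; apply: (@measurable_fun_nat _ (configs R not_root_weight) _ _
  offspring (child_sum F)) => [|k].
  exact: measurable_offspring_root.
by apply: (measurable_configsS below_rootW); exact: measurable_child_sum_root.
Qed.

Lemma measurable_yv_of n (J : set vertex_data) : J (inr [::]) ->
  (forall k, (k < n)%N -> measurable_fun setT (con k : configs R J -> R)) ->
  measurable_fun setT (yv n : configs R J -> R).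
Proof.
move=> J0; have mw := measurable_weight_root J0.
case: n => [_|n mc]; first by apply: measurable_inv_gt0 => // om; exact: weight_gt0.
have {}mc := mc n (ltnSn n).
apply: measurable_funM => //; apply: measurable_inv_gt0.
  by apply: measurable_funD => //; exact: measurable_funM.
by move=> om; rewrite addr_gt0// mulr_gt0 ?weight_gt0 ?con_gt0.
Qed.

Lemma measurable_con n :
  measurable_fun setT (con n : configs R not_root_weight -> R).
Proof.
elim/ltn_ind: n => n IHn.
rewrite (_ : con n = fun om => m^-1 * child_sum (yv n) (offspring om) om); last first.
  by apply/funext => om; rewrite conE.
apply: measurable_funM => //; apply: measurable_random_child_sum.
apply: measurable_yv_of => // k kn.
by apply: (measurable_configsS _ (IHn k kn)).
Qed.

Lemma measurable_conT n : measurable_fun setT (con n : configs R setT -> R).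
Proof. by apply: (measurable_configsS _ (measurable_con n)). Qed.

Lemma measurable_yv n : measurable_fun setT (yv n : configs R setT -> R).
Proof. by apply: measurable_yv_of => // k _; exact: measurable_conT. Qed.

Lemma measurable_gw n : measurable_fun setT (gw n : configs R setT -> R).
Proof.
elim: n => //= n IHn.
apply: (@measurable_configsS _ _ _ not_root_weight) => //.
by apply: measurable_funM => //; exact: measurable_random_child_sum.
Qed.

Lemma yvS_le_con n om : yv n.+1 om <= con n om.
Proof.
rewrite ler_pdivrMr ?addr_gt0 ?mulr_gt0 ?weight_gt0 ?con_gt0//.
by rewrite ler_peMr ?con_ge0// lerDl mulr_ge0// ltW// ?weight_gt0 ?con_gt0.
Qed.

(** Resistances in series add up. *)
Lemma invr_yvS n om : (yv n.+1 om)^-1 = weight om + (con n om)^-1.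
Proof.
have c0 := con_gt0 n om; have w0 := weight_gt0 om.
rewrite /yv; field; rewrite !gt_eqF//= addr_gt0//; exact: mulr_gt0.
Qed.

End conductance.

Arguments con {R} m n om : simpl never.
Arguments yv {R} m n om : simpl never.

(** * Real sequences *)

Section sequences_limits.
Context {R : realType}.
Implicit Types (a b d e x y z : nat -> R) (l M : R).

Lemma cvg_congr x y l l' : x @ \oo --> l -> x =1 y -> l = l' -> y @ \oo --> l'.
Proof. by move=> + /funext <- <-. Qed.

Lemma cvg0_le a b : (\forall n \near \oo, `|a n| <= b n) -> b @ \oo --> 0 ->
  a @ \oo --> 0.
Proof.
move=> ab b0; apply/cvgr0Pnorm_lt => e e0.
apply: filterS2 ab (cvgr0_norm_lt _ b0 _ e0) => n abn bn.
by rewrite (le_lt_trans abn)// (le_lt_trans _ bn)// ler_norm.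
Qed.

Lemma cvg0_bounded a b M : (\forall n \near \oo, `|a n| <= M) -> b @ \oo --> 0 ->
  (fun n => a n * b n) @ \oo --> 0.
Proof.
move=> aM b0; apply: (@cvg0_le _ (fun n => M * `|b n|)).
  by apply: filterS aM => n aM; rewrite normrM ler_wpM2r.
rewrite -(mulr0 M); apply: cvgM; first exact: cvg_cst.
by rewrite -(@normr0 _ R); apply: cvg_norm.
Qed.

Lemma cvg_natV : (fun n => n%:R^-1 : R) @ \oo --> (0 : R).
Proof. by rewrite -cvg_shiftS; exact: cvg_harmonic. Qed.

(** [K] is the fixed point of d -> th d + K (1 - th), and each step shrinks the distance to it by
    [th]. *)
Lemma contraction_le_from th d e K N : 0 <= th < 1 ->
  (forall n, (N <= n)%N -> d n.+1 <= th * d n + e n) ->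
  (forall n, (N <= n)%N -> e n <= K * (1 - th)) ->
  forall k, d (N + k)%N <= th ^+ k * `|d N - K| + K.
Proof.
move=> /andP[th0 th1] dd eK; elim=> [|k IHk].
  by rewrite addn0 expr0 mul1r -lerBlDr ler_norm.
rewrite addnS (le_trans (dd _ (leq_addr _ _)))//.
have h := eK _ (leq_addr k N); rewrite exprS.
have := ler_wpM2l th0 IHk; lra.
Qed.

Lemma contraction_cvg0 th d e : 0 <= th < 1 -> (forall n, 0 <= d n) ->
  (\forall n \near \oo, d n.+1 <= th * d n + e n) -> e @ \oo --> 0 -> d @ \oo --> 0.
Proof.
move=> th01 d0 [N _ dd] e0; have /andP[th0 th1] := th01.
apply/cvgr0Pnorm_le => eps eps0.
(* This bound on the error puts the fixed point at [eps / 2]; the other half covers the geometric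
   transient. *)
have h : 0 < eps / 2 * (1 - th) by rewrite mulr_gt0 ?divr_gt0// subr_gt0.
have [N' _ eN] := cvgr0_norm_le _ e0 _ h.
pose N1 := maxn N N'.
have H := @contraction_le_from th d e (eps / 2) N1 th01.
have {}H k : d (N1 + k)%N <= th ^+ k * `|d N1 - eps / 2| + eps / 2.
  apply: H => n hn.
    by apply: dd => /=; rewrite (leq_trans _ hn)// leq_maxl.
  rewrite (le_trans (ler_norm _))//; apply: eN => /=.
  by rewrite (leq_trans _ hn)// leq_maxr.
have cg : (fun k => `|d N1 - eps / 2| * th ^+ k) @ \oo --> 0.
  by apply: cvg_geometric; rewrite ger0_norm.
have eps2 : 0 < eps / 2 by rewrite divr_gt0.
have [N2 _ HN2] := cvgr0_norm_le _ cg _ eps2.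
exists (N1 + N2)%N => // n /= hn; rewrite ger0_norm//.
have hn1 : (N1 <= n)%N by rewrite (leq_trans _ hn)// leq_addr.
rewrite -(subnKC hn1) (le_trans (H _))// [leRHS]splitr lerD2r.
rewrite mulrC (le_trans (ler_norm _))//; apply: HN2 => /=.
by rewrite leq_subRL.
Qed.

Lemma contraction_bounded th d K : 0 <= th < 1 ->
  (\forall n \near \oo, d n.+1 <= th * d n + K) ->
  exists M, \forall n \near \oo, d n <= M.
Proof.
move=> th01 [N _ dd]; have /andP[th0 th1] := th01.
have th1' : 1 - th != 0 by rewrite gt_eqF// subr_gt0.
have H := @contraction_le_from th d (fun=> K) (K / (1 - th)) N th01 _ _.
exists (`|d N - K / (1 - th)| + K / (1 - th)); exists N => // n /= Nn.
rewrite -(subnKC Nn) (le_trans (H _ _ _))//.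
  by move=> k _; rewrite divfK.
by rewrite lerD2r ler_piMl// exprn_ile1// ltW.
Qed.

Lemma contraction_limsup th d e K eps : 0 <= th < 1 -> 0 < eps ->
  (\forall n \near \oo, d n.+1 <= th * d n + e n) ->
  (\forall n \near \oo, e n <= K * (1 - th)) ->
  \forall n \near \oo, d n <= K + eps.
Proof.
move=> th01 eps0 [N _ dd] [N' _ eK]; have /andP[th0 th1] := th01.
pose N1 := maxn N N'.
have H k : d (N1 + k)%N <= th ^+ k * `|d N1 - K| + K.
  apply: (@contraction_le_from th d e) => // n hn.
    by apply: dd => /=; rewrite (leq_trans _ hn)// leq_maxl.
  by apply: eK => /=; rewrite (leq_trans _ hn)// leq_maxr.
have cg : (fun k => `|d N1 - K| * th ^+ k) @ \oo --> 0.
  by apply: cvg_geometric; rewrite ger0_norm.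
have [N2 _ HN2] := cvgr0_norm_le _ cg _ eps0.
exists (N1 + N2)%N => // n /= hn.
have hn1 : (N1 <= n)%N by rewrite (leq_trans _ hn)// leq_addr.
rewrite -(subnKC hn1) (le_trans (H _))// addrC lerD2l.
by rewrite mulrC (le_trans (ler_norm _))//; apply: HN2 => /=; rewrite leq_subRL.
Qed.

Lemma affine_recursion_cvg th y z l : 0 <= th < 1 ->
  (forall n, y n.+1 = th * y n + z n) -> z @ \oo --> l ->
  y @ \oo --> l / (1 - th).
Proof.
move=> th01 yz zl; have /andP[th0 th1] := th01.
have th1' : 1 - th != 0 by rewrite gt_eqF// subr_gt0.
apply/subr_cvg0; apply/norm_cvg0P.
apply: (@contraction_cvg0 th _ (fun n => `|z n - l|)) => //.
  apply: nearW => n.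
  have -> : y n.+1 - l / (1 - th) = th * (y n - l / (1 - th)) + (z n - l).
    by rewrite yz; field.
  by rewrite (le_trans (ler_normD _ _))// normrM ger0_norm.
by apply/norm_cvg0P/subr_cvg0.
Qed.

End sequences_limits.

(** * Asymptotics of the moment recursion *)

Section cubic_recursion.
Context {R : realType}.
Variables (x s u y : nat -> R) (m a b b' k k2 k3 : R).
Hypotheses (m_gt1 : 1 < m) (a_gt0 : 0 < a) (b_gt0 : 0 < b) (b'_ge0 : 0 <= b')
  (k_gt0 : 0 < k) (k2_ge0 : 0 <= k2) (k3_ge0 : 0 <= k3).
Hypotheses (x_gt0 : forall n, 0 < x n) (s_ge0 : forall n, 0 <= s n)
  (u_ge0 : forall n, 0 <= u n).
Hypothesis xS_ge : forall n, x n - b * s n <= x n.+1.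
Hypothesis xS_le : forall n, x n.+1 <= x n - k * x n ^+ 2.
Hypothesis sS : forall n, s n.+1 = m^-1 * y n + a * x n.+1 ^+ 2.
Hypothesis y_le : forall n, y n <= s n / x n * x n.+1.
Hypothesis y_le_s : forall n, y n <= s n.
Hypothesis y_ge : forall n, s n - 2 * b * u n <= y n.
Hypothesis uS : forall n,
  u n.+1 <= m ^- 2 * u n + k2 * (s n * x n.+1) + k3 * x n.+1 ^+ 3.
Hypothesis xB_ge : forall n, b * s n - b' * u n <= x n - x n.+1.

Let mV01 : 0 <= m^-1 < 1.
Proof.
by rewrite invr_ge0 (le_trans _ (ltW m_gt1))//= invf_lt1// (lt_trans _ m_gt1).
Qed.

Let rat n := x n.+1 / x n.
(** If the conductance behaves like [x n] times a fixed variable, then [s] and [u] have orders x^2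
    and x^3; [q] and [v] are the scale-free moments. *)
Let q n := s n / x n ^+ 2.
Let v n := u n / x n ^+ 3.

Let xne0 n : x n != 0. Proof. by rewrite gt_eqF. Qed.
Let rat_gt0 n : 0 < rat n. Proof. by rewrite divr_gt0. Qed.

(** One step raises the inverse by at least [k], since (1 / x + k) (x - k x^2) = 1 - k^2 x^2. *)
Lemma rec_inv_ge n : (x 0)^-1 + k * n%:R <= (x n)^-1.
Proof.
elim: n => [|n IHn]; first by rewrite mulr0 addr0.
rewrite -natr1 mulrDr mulr1 addrA.
have : (x n)^-1 + k <= (x n.+1)^-1.
  have h := xS_le n; have x0 := x_gt0 n; have x1 := x_gt0 n.+1.
  rewrite -[leRHS]div1r ler_pdivlMr//.
  have -> : ((x n)^-1 + k) * x n.+1 = ((1 + k * x n) * x n.+1) / x n by field.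
  rewrite ler_pdivrMr// mul1r.
  have := ler_wpM2l (ltW (ltr_wpDr (ltW (mulr_gt0 k_gt0 x0)) ltr01)) h.
  have : 0 <= k ^+ 2 * x n ^+ 3 by rewrite mulr_ge0 ?exprn_ge0// ltW.
  nra.
lra.
Qed.

Lemma rec_cvg0 : x @ \oo --> 0.
Proof.
apply: (@cvg0_le _ _ (fun n => k^-1 * n%:R^-1)); last first.
  rewrite -(mulr0 k^-1); apply: cvgM; first exact: cvg_cst.
  exact: cvg_natV.
near=> n; have n0 : (0 < n)%N by near: n; exists 1%N.
rewrite ger0_norm; last exact: ltW.
rewrite -invfM -[leLHS]invrK lef_pV2 ?posrE ?invr_gt0//; last first.
  by rewrite mulr_gt0// ltr0n.
by rewrite (le_trans _ (rec_inv_ge n))// lerDr invr_ge0 ltW.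
Unshelve. all: by end_near. Qed.

Lemma recS_cvg0 : (fun n => x n.+1) @ \oo --> 0.
Proof. by rewrite cvg_shiftS; exact: rec_cvg0. Qed.

Lemma rec_le n : x n.+1 <= x n.
Proof.
rewrite (le_trans (xS_le n))// gerBl mulr_ge0// ?exprn_ge0// ltW//.
Qed.

(** [s n / x n] is the mean of the conductance under the law biased by it. The bound [y_le] yields
    exactly the factor [m^-1], whereas y <= s would leave a factor x / x' that is not yet
    controlled. *)
Lemma rec_biased_cvg0 : (fun n => s n / x n) @ \oo --> 0.
Proof.
apply: (@contraction_cvg0 _ m^-1 _ (fun n => a * x n.+1)) => //.
- by move=> n; rewrite divr_ge0// ltW.
- apply: nearW => n; rewrite sS ler_pdivrMr// mulrDl; apply: lerD.
    by rewrite -mulrA ler_wpM2l//; case/andP: mV01.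
  by rewrite -mulrA -expr2.
rewrite -(mulr0 a); apply: cvgM; [exact: cvg_cst|exact: recS_cvg0].
Qed.

Lemma rec_ratio_cvg1 : rat @ \oo --> (1 : R).
Proof.
have h : (fun n => 1 - b * (s n / x n)) @ \oo --> (1 : R).
  rewrite -[X in _ --> X]subr0 -(mulr0 b); apply: cvgB; first exact: cvg_cst.
  by apply: cvgM; [exact: cvg_cst|exact: rec_biased_cvg0].
apply: squeeze_cvgr h (cvg_cst (1 : R)); apply: nearW => n; apply/andP; split.
  rewrite ler_pdivlMr// (le_trans _ (xS_ge n))// mulrBl mul1r.
  by rewrite -mulrA divfK.
by rewrite ler_pdivrMr// mul1r rec_le.
Qed.

Lemma rec_ratioV_cvg1 : (fun n => (rat n)^-1) @ \oo --> (1 : R).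
Proof. by rewrite -[X in _ --> X]invr1; apply: cvgV; [|exact: rec_ratio_cvg1]. Qed.

Lemma rec_ratioVX_cvg1 j : (fun n => (rat n)^-1 ^+ j) @ \oo --> (1 : R).
Proof.
elim: j => [|j IHj]; first by apply: (cvg_congr (cvg_cst (1 : R))).
apply: (cvg_congr (cvgM rec_ratioV_cvg1 IHj)) => [n|]; last by rewrite mul1r.
by rewrite exprS.
Qed.

Let near_ratioV j : \forall n \near \oo, (rat n)^-1 ^+ j <= 2.
Proof.
have lt12 : 1 < 2 :> R by lra.
by apply: filterS (cvgr_lt _ (rec_ratioVX_cvg1 j) _ lt12) => n /ltW.
Qed.

(** Normalising by [x n.+1] instead of [x n] costs a power of a ratio that tends to one, so the
    contraction factor eventually stays below the midpoint of [th] and [1]. *)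
Let contracting th j : 0 <= th < 1 ->
  \forall n \near \oo, th * (rat n)^-1 ^+ j <= (1 + th) / 2.
Proof.
move=> /andP[th0 th1].
have ht : (fun n => th * (rat n)^-1 ^+ j) @ \oo --> th.
  rewrite -[X in _ --> X]mulr1; apply: cvgM; first exact: cvg_cst.
  exact: rec_ratioVX_cvg1.
have lt1 : th < (1 + th) / 2 by lra.
by apply: filterS (cvgr_lt _ ht _ lt1) => n /ltW.
Qed.

Let q_ge0 n : 0 <= q n. Proof. by rewrite divr_ge0// exprn_ge0// ltW. Qed.
Let v_ge0 n : 0 <= v n. Proof. by rewrite divr_ge0// exprn_ge0// ltW. Qed.

Let half01 (th : R) : 0 <= th < 1 -> 0 <= (1 + th) / 2 < 1.
Proof. by move=> /andP[? ?]; apply/andP; split; lra. Qed.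

(** Dividing the recursion of [s] by x'^2 gives q' <= m^-1 (x / x') q + a. *)
Lemma rec_q_bounded : exists M, \forall n \near \oo, q n <= M.
Proof.
apply: (@contraction_bounded _ ((1 + m^-1) / 2) _ a); first exact: half01.
have := contracting 1 mV01; apply: filterS => n hn.
have -> : q n.+1 = m^-1 * (y n / x n.+1 ^+ 2) + a.
  by rewrite /q sS; field; rewrite xne0 gt_eqF// (lt_trans _ m_gt1).
rewrite lerD2r (le_trans _ (ler_wpM2r (q_ge0 n) hn))// -mulrA ler_wpM2l//.
  by case/andP: mV01.
rewrite ler_pdivrMr ?exprn_gt0// (le_trans (y_le n))//.
by rewrite le_eqVlt; apply/orP; left; apply/eqP; rewrite /q /rat; field; rewrite !xne0.
Qed.

Let mV2 : 0 <= m ^- 2 < 1.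
Proof.
case/andP: mV01 => h0 h1; rewrite -exprVn exprn_ge0//= exprn_ilt1//.
Qed.

(** Dividing the recursion of [u] by x'^3 leaves the factor m^-2 (x / x')^3 in front of [v] and
    terms bounded through [q]. *)
Lemma rec_v_bounded : exists M, \forall n \near \oo, v n <= M.
Proof.
have [Mq hq] := rec_q_bounded.
apply: (@contraction_bounded _ ((1 + m ^- 2) / 2) _ (k2 * (2 * `|Mq|) + k3)).
  exact: half01.
have h3 := contracting 3 mV2; have h2 := near_ratioV 2.
near=> n.
have -> : (1 + m ^- 2) / 2 * v n + (k2 * (2 * `|Mq|) + k3) =
  ((1 + m ^- 2) / 2 * v n + k2 * (2 * `|Mq|)) + k3 by rewrite addrA.
rewrite ler_pdivrMr ?exprn_gt0// (le_trans (uS n))//.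
rewrite [leRHS]mulrDl [X in _ <= X + _]mulrDl.
rewrite lerD2r; apply: lerD.
  have -> : m ^- 2 * u n = m ^- 2 * (rat n)^-1 ^+ 3 * v n * x n.+1 ^+ 3.
    by rewrite /v /rat; field; rewrite !xne0 gt_eqF// (lt_trans _ m_gt1).
  rewrite ler_pM2r ?exprn_gt0// ler_wpM2r//; near: n; exact: h3.
have -> : k2 * (s n * x n.+1) = k2 * ((rat n)^-1 ^+ 2 * q n) * x n.+1 ^+ 3.
  by rewrite /q /rat; field; rewrite !xne0.
rewrite ler_pM2r ?exprn_gt0// ler_wpM2l// ler_pM//.
- by rewrite exprn_ge0// invr_ge0 ltW.
- by near: n; exact: h2.
- by rewrite (le_trans _ (ler_norm _))//; near: n; exact: hq.
Unshelve. all: by end_near. Qed.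

Let v_norm_bounded : exists M, \forall n \near \oo, `|v n| <= M.
Proof.
by have [M h] := rec_v_bounded; exists M; apply: filterS h => n; rewrite ger0_norm.
Qed.

Let q_norm_bounded : exists M, \forall n \near \oo, `|q n| <= M.
Proof.
by have [M h] := rec_q_bounded; exists M; apply: filterS h => n; rewrite ger0_norm.
Qed.

Lemma rec_vx_cvg0 : (fun n => v n * x n) @ \oo --> 0.
Proof. by have [M h] := v_norm_bounded; exact: cvg0_bounded h rec_cvg0. Qed.

Let y_ratio n : y n / x n.+1 ^+ 2 - q n =
  q n * ((rat n)^-1 ^+ 2 - 1) - (s n - y n) / x n ^+ 2 * (rat n)^-1 ^+ 2.
Proof. by rewrite /q /rat; field; rewrite !xne0. Qed.

(** The loss [s n - y n] is at most a multiple of [u n], of order x^3, hence negligible against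
    x^2. *)
Lemma rec_y_cvg0 : (fun n => y n / x n.+1 ^+ 2 - q n) @ \oo --> 0.
Proof.
have h1 : (fun n => q n * ((rat n)^-1 ^+ 2 - 1)) @ \oo --> 0.
  have [M h] := q_norm_bounded; apply: cvg0_bounded h _.
  by apply/subr_cvg0; exact: rec_ratioVX_cvg1.
suff h2 : (fun n => (s n - y n) / x n ^+ 2) @ \oo --> 0.
  apply: (cvg_congr (cvgB h1 (cvgM h2 (rec_ratioVX_cvg1 2)))) => [n|].
    by rewrite y_ratio.
  by rewrite mul0r subr0.
apply: (@cvg0_le _ _ (fun n => 2 * b * (v n * x n))).
  apply: nearW => n; rewrite ger0_norm; last first.
    by rewrite divr_ge0 ?exprn_ge0 ?subr_ge0// ltW.
  rewrite ler_pdivrMr ?exprn_gt0//.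
  have -> : 2 * b * (v n * x n) * x n ^+ 2 = 2 * b * u n.
    by rewrite /v; field.
  by have := y_ge n; lra.
rewrite -(mulr0 (2 * b)); apply: cvgM; [exact: cvg_cst|exact: rec_vx_cvg0].
Qed.

(** By now q' = m^-1 q + a + o(1), and the affine map has fixed point a / (1 - m^-1). *)
Lemma rec_q_cvg : q @ \oo --> a / (1 - m^-1).
Proof.
apply: (@affine_recursion_cvg _ m^-1 _ (fun n => m^-1 * (y n / x n.+1 ^+ 2 - q n) + a)).
- exact: mV01.
- move=> n; rewrite /q sS; field; rewrite !xne0 gt_eqF// (lt_trans _ m_gt1)//.
- apply: (cvg_congr (cvgD (cvgM (cvg_cst m^-1) rec_y_cvg0) (cvg_cst a))) => //.
  by rewrite mulr0 add0r.
Qed.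

(** The increment is (x - x') / (x x'), and x - x' equals b s up to b' u, which is of smaller order
    than x x'. *)
Lemma rec_invB_cvg : (fun n => (x n.+1)^-1 - (x n)^-1) @ \oo --> a * b / (1 - m^-1).
Proof.
have qb : (fun n => b * q n * (rat n)^-1) @ \oo --> a * b / (1 - m^-1).
  apply: (cvg_congr (cvgM (cvgM (cvg_cst b) rec_q_cvg) rec_ratioV_cvg1)) => //.
  by rewrite mulr1 mulrCA mulrA.
have ql : (fun n => b * q n * (rat n)^-1 - b' * (v n * x n) * (rat n)^-1)
    @ \oo --> a * b / (1 - m^-1).
  apply: (cvg_congr (cvgB qb
    (cvgM (cvgM (cvg_cst b') rec_vx_cvg0) rec_ratioV_cvg1))) => //.
  by rewrite mulr0 mul0r subr0.
have invE n : (x n.+1)^-1 - (x n)^-1 = (x n - x n.+1) / (x n * x n.+1).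
  by field; rewrite !xne0.
apply: squeeze_cvgr ql qb; apply: nearW => n; rewrite invE.
have xx : 0 < x n * x n.+1 by rewrite mulr_gt0.
apply/andP; split.
  rewrite ler_pdivlMr//.
  have -> : (b * q n * (rat n)^-1 - b' * (v n * x n) * (rat n)^-1) * (x n * x n.+1) =
    b * s n - b' * u n by rewrite /q /v /rat; field; rewrite !xne0.
  exact: xB_ge.
rewrite ler_pdivrMr//.
have -> : b * q n * (rat n)^-1 * (x n * x n.+1) = b * s n.
  by rewrite /q /rat; field; rewrite !xne0.
by have := xS_ge n; lra.
Qed.

Lemma rec_cvg : (fun n => n%:R * x n) @ \oo --> (a * b / (1 - m^-1))^-1.
Proof.
have c0 : a * b / (1 - m^-1) != 0.
  by rewrite gt_eqF// divr_gt0 ?mulr_gt0// subr_gt0; case/andP: mV01.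
have h := cesaro rec_invB_cvg.
have {}h : (fun n => n.+1%:R^-1 * (x n.+1)^-1) @ \oo --> a * b / (1 - m^-1).
  (* The telescoping sum leaves [(x 0)^-1] at its lower end; it is added back with weight 1 / (n +
     1), which vanishes. *)
  apply: (cvg_congr (cvgD h (cvgM cvg_harmonic (cvg_cst (x 0)^-1)))) => [n|].
    rewrite /arithmetic_mean /= seriesEnat /=.
    have tel : \sum_(0 <= i < n.+1) ((x i.+1)^-1 - (x i)^-1) = (x n.+1)^-1 - (x 0)^-1.
      exact: (@telescope_sumr _ 0 n.+1 (fun i => (x i)^-1)).
    rewrite -[LHS]/(n.+1%:R^-1 * (\sum_(0 <= i < n.+1) ((x i.+1)^-1 - (x i)^-1))
      + n.+1%:R^-1 * (x 0)^-1).
    by rewrite tel mulrBr subrK.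
  by rewrite mul0r addr0.
rewrite -cvg_shiftS; apply: (cvg_congr (cvgV c0 h)) => // n.
by rewrite /= invfM !invrK.
Qed.

End cubic_recursion.

(** * Limits of random variables *)

Section limits_of_random_variables.
Context {d : measure_display} {T : measurableType d} {R : realType}.
Variable P : probability T R.
Implicit Types f : nat -> T -> R.
Local Notation ig := (ig P).
Local Notation Ex := (Ex P).

(** The Cauchy criterion with countable quantifiers only, from which measurability of the
    convergence set can be read off. *)
Lemma cvgn_cauchyP (u : nat -> R) : cvgn u <->
  forall k : nat, exists N, forall i, (N <= i)%N -> forall j, (N <= j)%N ->
    `|u i - u j| < k.+1%:R^-1.
Proof.
split=> [cu k|H].
  have k2 : 0 < (k.+1%:R^-1 : R) / 2 by rewrite divr_gt0.
  have [N _ HN] : \forall n \near \oo, `|limn u - u n| < k.+1%:R^-1 / 2.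
    by have /cvgrPdist_lt := cu; exact.
  exists N => i Ni j Nj; have hi := HN i Ni; have hj := HN j Nj.
  rewrite (le_lt_trans (ler_distD (limn u) _ _))// [ltRHS]splitr.
  by apply: ltrD => //; rewrite distrC.
apply/cauchy_cvgP/cauchy_exP => e e0.
have [k ke] : exists k : nat, k.+1%:R^-1 < e :> R.
  have [N _ HN] := cvgr0_norm_lt _ (@cvg_harmonic R) _ e0.
  exists N; have := HN N (leqnn N); rewrite /harmonic /= ger0_norm//.
have [N HN] := H k; exists (u N); exists N => // n /= Nn.
by rewrite -ball_normE /=; exact: lt_trans (HN _ (leqnn N) _ Nn) ke.
Qed.

Lemma measurable_cvgn_set f : (forall n, measurable_fun setT (f n)) ->
  measurable [set x | cvgn (f ^~ x)].
Proof.
move=> mf.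
rewrite (_ : [set x | _] = \bigcap_k \bigcup_N \bigcap_(i in [set i | (N <= i)%N])
    \bigcap_(j in [set j | (N <= j)%N]) [set x | `|f i x - f j x| < k.+1%:R^-1]).
  apply: bigcap_measurable => // k _; apply: bigcup_measurable => N _.
  apply: bigcap_measurable; first by exists N => /=.
  move=> i _; apply: bigcap_measurable; first by exists N => /=.
  move=> j _; rewrite -[X in measurable X]setTI.
  have mb : measurable_fun setT (fun x => `|f i x - f j x| < k.+1%:R^-1).
    apply: measurable_fun_ltr => //; apply: measurableT_comp => //.
    exact: measurable_funB.
  exact: (mb measurableT [set true]).
apply/seteqP; split=> x /=.
  by move=> /cvgn_cauchyP h k _; have [N HN] := h k; exists N.
by move=> h; apply/cvgn_cauchyP => k; have [N _ HN] := h k I; exists N.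
Qed.

(* Off the convergence set, [limn] takes the junk value [point = 0]. *)
Lemma measurable_limn f : (forall n, measurable_fun setT (f n)) ->
  measurable_fun setT (fun x => limn (f ^~ x)).
Proof.
move=> mf; pose A := [set x | cvgn (f ^~ x)].
have mA : measurable A by exact: measurable_cvgn_set.
apply: (@measurable_fun_cvg _ _ _ setT (fun n x => if x \in A then f n x else 0)).
  move=> n; apply: measurable_fun_ifT => //.
  apply: (measurable_fun_bool true) => //=; rewrite setTI.
  rewrite (_ : _ @^-1` _ = A)//; apply/seteqP; split=> x /=; first by move=> /set_mem.
  by move=> /mem_set.
move=> x _; case: (boolP (x \in A)) => [/set_mem//|xA].
rewrite dvgP; first exact: cvg_cst.
by move=> cx; move/negP: xA; apply; exact: mem_set.
Qed.

(** The sum [S] of the absolute increments has finite mean, hence is finite almost surely and forces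
    convergence; |f 0| + S dominates the whole sequence and yields convergence in mean. *)
Lemma cvg_of_geometric_increments f K th : 0 <= th < 1 ->
  (forall n, measurable_fun setT (f n)) -> ig (f 0) ->
  (forall n, ig (fun x => f n.+1 x - f n x)) ->
  (forall n, Ex (fun x => `|f n.+1 x - f n x|) <= K * th ^+ n) ->
  [/\ {ae P, forall x, f ^~ x @ \oo --> limn (f ^~ x)},
      ig (fun x => limn (f ^~ x)) &
      (fun n => Ex (fun x => `|f n x - limn (f ^~ x)|)) @ \oo --> (0 : R)].
Proof.
move=> /andP[th0 th1] mf if0 iD ED.
have K0 : 0 <= K.
  by have := ED 0; rewrite expr0 mulr1; apply: le_trans; exact: Ex_ge0.
have mD n : measurable_fun setT (fun x => `|f n.+1 x - f n x|%:E).
  by apply/measurable_EFinP; apply: measurableT_comp => //; exact: measurable_funB.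
pose S x : \bar R := (\sum_(n <oo) `|f n.+1 x - f n x|%:E)%E.
have S0 x : (0 <= S x)%E by apply: nneseries_ge0 => n _ _; rewrite lee_fin.
have mS : measurable_fun setT S.
  exact: ge0_emeasurable_sum.
have intS : (\int[P]_x S x <= (K / (1 - th))%:E)%E.
  rewrite integral_nneseries//.
  under eq_eseriesr => n _ do rewrite (EFin_Ex (ig_norm (iD n))).
  apply: lime_le.
    by apply: is_cvg_nneseries => n _ _; rewrite lee_fin Ex_ge0.
  apply: nearW => n.
  apply: (@le_trans _ _ (\sum_(0 <= k < n) (geometric K th k)%:E)%E).
    by apply: lee_sum => i _; rewrite lee_fin /geometric /=.
  rewrite sumEFin lee_fin.
  have := geometric_seriesE K (negbT (lt_eqF th1)).
  move=> /(congr1 (@^~ n)); rewrite seriesEnat /= => ->.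
  rewrite ler_wpM2r ?invr_ge0 ?subr_ge0 ?(ltW th1)//.
  by rewrite ler_piMr// gerBl exprn_ge0.
have iS : P.-integrable setT S.
  apply/integrableP; split=> //; under eq_integral => x _ do rewrite gee0_abs//.
  exact: le_lt_trans intS (ltry _).
have aeS : {ae P, forall x, S x \is a fin_num}.
  have := integrable_ae measurableT iS; apply: filterS => x; exact.
have cvgS x : S x \is a fin_num -> cvgn (f ^~ x).
  move=> Sx.
  have : cvgn [normed series (fun n => f n.+1 x - f n x)].
    apply: nondecreasing_is_cvgn.
      move=> i j ij; rewrite /= !seriesEnat /=.
      by rewrite [leRHS](big_cat_nat (n := i))//= lerDl sumr_ge0.
    exists (fine (S x)) => _ [n _ <-]; rewrite /= seriesEnat /=.
    rewrite -lee_fin fineK// -sumEFin.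
    by apply: nneseries_lim_ge => k _; rewrite lee_fin.
  move=> /normed_cvg; rewrite /series /=.
  move=> /cvg_ex[l hl]; apply/cvg_ex; exists (l + f 0 x).
  rewrite (_ : f ^~ x = fun n => \sum_(0 <= k < n) (f k.+1 x - f k x) + f 0 x).
    by apply: cvgD => //; exact: cvg_cst.
  by apply/funext => n; rewrite (@telescope_sumr _ 0 n (f ^~ x))// subrK.
have fle x n : (`|f n x|%:E <= `|f 0 x|%:E + S x)%E.
  have : (`|f n x|%:E <= `|f 0 x|%:E + \sum_(0 <= k < n) `|f k.+1 x - f k x|%:E)%E.
    rewrite sumEFin -EFinD lee_fin.
    have -> : f n x = f 0 x + \sum_(0 <= k < n) (f k.+1 x - f k x).
      by rewrite (@telescope_sumr _ 0 n (f ^~ x))// subrKC.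
    by rewrite (le_trans (ler_normD _ _))// lerD2l ler_norm_sum.
  move=> /le_trans; apply; apply: leeD2l.
  by apply: nneseries_lim_ge => k _; rewrite lee_fin.
have aef : {ae P, forall x, f ^~ x @ \oo --> limn (f ^~ x)}.
  by apply: filterS aeS => x /cvgS.
have mlim := measurable_limn mf.
have [|||||iL L0 _] := @dominated_convergence _ _ _ P setT measurableT
  (fun n x => (f n x)%:E) (fun x => (limn (f ^~ x))%:E) (fun x => (`|f 0 x|%:E + S x)%E).
- by move=> n; exact/measurable_EFinP.
- exact/measurable_EFinP.
- by apply: filterS aef => x fx _; apply: cvg_EFin => //; exact: nearW.
- by apply: integrableD => //; exact: ig_norm.
- by apply: aeW => x n _ /=; exact: fle.
split=> //.
have ifn n : ig (f n).
  elim: n => // n IHn.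
  rewrite (_ : f n.+1 = fun x => (f n.+1 x - f n x) + f n x); first exact: igD.
  by apply/funext => x; rewrite subrK.
have iE n : ig (fun x => `|f n x - limn (f ^~ x)|) by apply: ig_norm; exact: igB.
have {}L0 : (fun n => (Ex (fun x => `|f n x - limn (f ^~ x)|))%:E) @ \oo --> 0%E.
  apply: cvg_trans L0; apply: near_eq_cvg; apply: nearW => n /=.
  by rewrite -EFin_Ex.
by move/fine_cvgP: L0 => [].
Qed.

End limits_of_random_variables.

(** * Truncated substitutes for the exponential and the inverse *)

Section truncations.
Context {R : realType}.
Implicit Types a b c k l : R.

(** A piecewise linear substitute for exp(- l c): on nonnegative arguments it is bounded, Lipschitz
    and satisfies [phi_add_le], which is what a Laplace transform would be used for. *)
Definition phi l c : R := Num.max 0 (1 - l * c).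

(** For positive arguments this is min(1 / c, 1 / k). Unlike the inverse it is bounded and
    Lipschitz, so it passes to limits in mean. *)
Definition psi k c : R := (Num.max c k)^-1.

Lemma phi_ge0 l c : 0 <= phi l c. Proof. by rewrite /phi le_max lexx. Qed.

Lemma phi_le1 l c : 0 <= l -> 0 <= c -> phi l c <= 1.
Proof. by move=> l0 c0; rewrite /phi ge_max ler01 gerBl mulr_ge0. Qed.

Lemma phi_norm_le1 l c : 0 <= l -> 0 <= c -> `|phi l c| <= 1.
Proof. by move=> l0 c0; rewrite ger0_norm ?phi_ge0// phi_le1. Qed.

Lemma phi_lip l a b : 0 <= l -> `|phi l a - phi l b| <= l * `|a - b|.
Proof.
move=> l0; have h1 := ler_wpM2l l0 (ler_norm (a - b)).
have := ler_wpM2l l0 (ler_norm (b - a)); rewrite distrC => h2.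
have h3 : 0 <= l * `|a - b| by rewrite mulr_ge0.
rewrite /phi ler_norml.
by case: (leP 0 (1 - l * a)) => ha; case: (leP 0 (1 - l * b)) => hb;
  apply/andP; split; nra.
Qed.

Lemma phi_anti l a b : 0 <= l -> a <= b -> phi l b <= phi l a.
Proof.
move=> l0 ab; rewrite /phi ge_max le_max lexx/= le_max; apply/orP; right.
by rewrite lerB// ler_wpM2l.
Qed.

Lemma phi_antil l l' c : 0 <= c -> l <= l' -> phi l' c <= phi l c.
Proof.
move=> c0 ll; rewrite /phi ge_max le_max lexx/= le_max; apply/orP; right.
by rewrite lerB// ler_wpM2r.
Qed.

Lemma phi_add_le l a b : 0 <= l -> 0 <= a -> 0 <= b ->
  phi l (a + b) <= phi l a * phi l b.
Proof.
move=> l0 a0 b0; have la : 0 <= l * a by rewrite mulr_ge0.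
have lb : 0 <= l * b by rewrite mulr_ge0.
rewrite {1}/phi ge_max mulr_ge0 ?phi_ge0//= mulrDr /phi.
by case: (leP 0 (1 - l * a)) => ha; case: (leP 0 (1 - l * b)) => hb; nra.
Qed.

Lemma phi_mulr l x c : phi l (x * c) = phi (l * x) c.
Proof. by rewrite /phi mulrA. Qed.

(** The right side is (1 - l c / 2)^2, hence nonnegative as well; it brings in second moments. *)
Lemma phi_le_sqr l c : phi l c <= 1 - l * c + (l * c) ^+ 2 / 4.
Proof.
rewrite /phi ge_max; apply/andP; split; last by rewrite lerDl divr_ge0// sqr_ge0.
have -> : 1 - l * c + (l * c) ^+ 2 / 4 = (1 - l * c / 2) ^+ 2 by field.
exact: sqr_ge0.
Qed.

Lemma psi_gt0 k c : 0 < k -> 0 < psi k c.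
Proof. by move=> k0; rewrite /psi invr_gt0 lt_max k0 orbT. Qed.

Lemma psi_ge0 k c : 0 < k -> 0 <= psi k c. Proof. by move=> /psi_gt0/ltW. Qed.

Lemma psi_le k c : 0 < k -> psi k c <= k^-1.
Proof.
by move=> k0; rewrite /psi lef_pV2 ?posrE ?lt_max ?k0 ?orbT// le_max lexx orbT.
Qed.

Lemma psi_norm_le k c : 0 < k -> `|psi k c| <= k^-1.
Proof. by move=> k0; rewrite ger0_norm ?psi_ge0// psi_le. Qed.

Lemma psi_le_inv k c : 0 < k -> 0 < c -> psi k c <= c^-1.
Proof.
by move=> k0 c0; rewrite /psi lef_pV2 ?posrE ?lt_max ?k0 ?orbT// le_max lexx.
Qed.

Lemma psi_anti k k' c : 0 < k -> k <= k' -> psi k' c <= psi k c.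
Proof.
move=> k0 kk; have k'0 := lt_le_trans k0 kk.
rewrite /psi lef_pV2 ?posrE ?lt_max ?k0 ?k'0 ?orbT//.
by rewrite ge_max !le_max lexx kk orbT.
Qed.

Lemma psi_mulr k x c : 0 < x -> psi (x * k) (x * c) = x^-1 * psi k c.
Proof. by move=> x0; rewrite /psi -maxr_pMr ?(ltW x0)// invfM. Qed.

Lemma psi_lip k a b : 0 < k -> `|psi k a - psi k b| <= k ^- 2 * `|a - b|.
Proof.
move=> k0; rewrite /psi; set A := Num.max a k; set B := Num.max b k.
have kA : k <= A by rewrite le_max lexx orbT.
have kB : k <= B by rewrite le_max lexx orbT.
have A0 := lt_le_trans k0 kA; have B0 := lt_le_trans k0 kB.
have AB : `|A - B| <= `|a - b|.
  have h1 := ler_norm (a - b); have := ler_norm (b - a); rewrite distrC => h2.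
  have h3 := normr_ge0 (a - b).
  rewrite /A /B ler_norml.
  by case: (leP a k) => ha; case: (leP b k) => hb; apply/andP; split; lra.
have -> : A^-1 - B^-1 = (A * B)^-1 * (B - A) by field; rewrite !gt_eqF.
rewrite normrM distrC ler_pM// ger0_norm ?invr_ge0 ?mulr_ge0 ?(ltW A0) ?(ltW B0)//.
by rewrite lef_pV2 ?posrE ?mulr_gt0// expr2 ler_pM// ltW.
Qed.

Lemma measurable_phi d (T : measurableType d) l (F : T -> R) :
  measurable_fun setT F -> measurable_fun setT (phi l \o F).
Proof.
move=> mF; apply: measurable_maxr => //; apply: measurable_funB => //.
exact: measurable_funM.
Qed.

Lemma measurable_psi d (T : measurableType d) k (F : T -> R) : 0 < k ->
  measurable_fun setT F -> measurable_fun setT (psi k \o F).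
Proof.
move=> k0 mF; apply: (measurable_inv_gt0 (F := fun x => Num.max (F x) k)).
  exact: measurable_maxr.
by move=> x; rewrite lt_max k0 orbT.
Qed.

End truncations.

Section lipschitz_limit.
Context {d : measure_display} {T : measurableType d} {R : realType}.
Variable P : probability T R.
Local Notation ig := (ig P).
Local Notation Ex := (Ex P).

(** From the pointwise inequality |F| <= e / 2 + F^2 / (2 e). *)
Lemma Ex_norm_cvg0_of_sqr (F : nat -> T -> R) : (forall n, measurable_fun setT (F n)) ->
  (forall n, ig (F n)) -> (forall n, ig (fun x => F n x ^+ 2)) ->
  (fun n => Ex (fun x => F n x ^+ 2)) @ \oo --> (0 : R) ->
  (fun n => Ex (fun x => `|F n x|)) @ \oo --> (0 : R).
Proof.
move=> mF iF iF2 F0; apply/cvgr0Pnorm_le => e e0.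
have e2 : 0 < e ^+ 2 by rewrite exprn_gt0.
apply: filterS (cvgr0_norm_le _ F0 _ e2) => n.
rewrite ger0_norm; last by apply: Ex_ge0 => x; exact: sqr_ge0.
move=> hn; rewrite ger0_norm; last by apply: Ex_ge0.
have i2 := igZ (2 * e)^-1 (iF2 n).
have : Ex (fun x => `|F n x|) <= Ex (fun x => e / 2 + (2 * e)^-1 * F n x ^+ 2).
  apply: Ex_le; [exact: ig_norm|by apply: igD => //; exact: ig_cst|move=> x].
  rewrite -(real_normK (num_real (F n x))) -subr_ge0.
  have -> : e / 2 + (2 * e)^-1 * `|F n x| ^+ 2 - `|F n x| = (e - `|F n x|) ^+ 2 / (2 * e).
    by field; rewrite gt_eqF.
  by rewrite divr_ge0 ?sqr_ge0// mulr_ge0// ltW.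
move=> /le_trans; apply; rewrite ExD//; last exact: ig_cst.
rewrite Ex_cst ExZ//.
have h := ler_wpM2l (ltW (_ : 0 < (2 * e)^-1)) hn.
have {h} : (2 * e)^-1 * Ex (fun x => F n x ^+ 2) <= (2 * e)^-1 * e ^+ 2.
  by apply: h; rewrite invr_gt0 mulr_gt0.
have -> : (2 * e)^-1 * e ^+ 2 = e / 2 by field; rewrite gt_eqF.
lra.
Qed.

(** [I] is meant to be the indicator of an event on the number of children, or the constant one. *)
Lemma Ex_lipschitz_cvg (I : T -> R) (Z : nat -> T -> R) (Y : T -> R) (f : R -> R) (L M : R) :
  measurable_fun setT I -> (forall x, 0 <= I x <= 1) ->
  (forall n, ig (fun x => Z n x - Y x)) ->
  (forall n, measurable_fun setT (f \o Z n)) -> measurable_fun setT (f \o Y) ->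
  (forall n x, `|f (Z n x)| <= M) -> (forall x, `|f (Y x)| <= M) ->
  (forall a b, `|f a - f b| <= L * `|a - b|) ->
  (fun n => Ex (fun x => `|Z n x - Y x|)) @ \oo --> (0 : R) ->
  (fun n => Ex (fun x => I x * f (Z n x))) @ \oo --> Ex (fun x => I x * f (Y x)).
Proof.
move=> mI I01 iZ mfZ mfY fZ fY fL Z0.
have iIf (F : T -> R) : measurable_fun setT (f \o F) -> (forall x, `|f (F x)| <= M) ->
    ig (fun x => I x * f (F x)).
  move=> mfF fF; apply: ig_dom (ig_cst P M) _ => [|x]; first exact: measurable_funM.
  have /andP[I0 I1] := I01 x; rewrite normrM (ger0_norm I0) (le_trans _ (fF x))//.
  by rewrite ler_piMl.
have i1 n := iIf _ (mfZ n) (fZ n); have i2 := iIf _ mfY fY.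
apply/subr_cvg0; apply: (@cvg0_le _ _ (fun n => L * Ex (fun x => `|Z n x - Y x|))).
  apply: nearW => n; rewrite -ExB// -ExZ; last exact: ig_norm.
  have iB := igB (i1 n) i2.
  rewrite (le_trans (Ex_norm iB))//; apply: Ex_le.
  - exact: ig_norm.
  - by apply: igZ; exact: ig_norm.
  move=> x; rewrite -mulrBr normrM; have /andP[I0 I1] := I01 x.
  by rewrite (ger0_norm I0) (le_trans _ (fL _ _))// ler_piMl.
by apply: (cvg_congr (cvgM (cvg_cst L) Z0)) => //; rewrite mulr0.
Qed.

End lipschitz_limit.

(** * Moments of the conductance *)

Ltac nonneg :=
  repeat first [done | exact: sqr_ge0 | solve [apply: ltW; assumption]
               | apply: addr_ge0 | apply: divr_ge0 | apply: exprn_ge0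
               | apply: mulr_ge0].

Section moments.
Context {R : realType}.
Variable mu : probability (configs R setT) R.
Hypothesis mu_indep : forall (J K : set vertex_data) (A B : set (config R)),
  J `&` K = set0 -> cylinder (@coord R) J A -> cylinder (@coord R) K B ->
  mu (A `&` B) = (mu A * mu B)%E.
Hypothesis mu_shift : forall x (A : set (config R)),
  cylinder (@coord R) setT A -> mu (shift x @^-1` A) = mu A.
Local Notation ig := (ig mu).
Local Notation Ex := (Ex mu).
Variable m : R.
Hypothesis m_gt1 : 1 < m.
Hypothesis Ex_offspring : Ex (fun om => (offspring om)%:R) = m.
Hypothesis ig_offspring3 : ig (fun om => (offspring om)%:R ^+ 3).
Hypothesis ig_weight2 : ig (fun om => weight om ^+ 2).
Hypothesis ig_weightV : ig (fun om => (weight om)^-1).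
Local Notation con := (con m).
Local Notation yv := (yv m).

Let m_gt0 : 0 < m. Proof. exact: lt_trans m_gt1. Qed.
Let mV_gt0 : 0 < m^-1. Proof. by rewrite invr_gt0. Qed.

Definition fact2 : R := Ex (fun om => (offspring om)%:R * ((offspring om)%:R - 1)).
Definition fact3 : R := Ex (fun om =>
  (offspring om)%:R * ((offspring om)%:R - 1) * ((offspring om)%:R - 2)).

(** k (k - 1) >= 2 (k - 1) for every integer k, and the right side has mean 2 (m - 1). *)
Lemma fact2_gt0 : 0 < fact2.
Proof.
have h : Ex (fun om => 2 * ((offspring om)%:R - 1)) <= fact2.
  apply: Ex_le.
  - by apply: igZ; apply: igB; [exact: ig_offspring|exact: ig_cst].
  - exact: ig_offspring2.
  - move=> om; case: (offspring om) => [|[|k]]; first by rewrite mul0r; lra.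
      by rewrite subrr !mulr0.
    by rewrite ler_wpM2r// ?subr_ge0 ?ler1n// (ler_nat _ 2).
apply: lt_le_trans h; rewrite ExZ; last first.
  by apply: igB; [exact: ig_offspring|exact: ig_cst].
rewrite ExB ?Ex_cst ?Ex_offspring; [|exact: ig_offspring|exact: ig_cst].
by rewrite mulr_gt0// subr_gt0.
Qed.

Lemma fact3_ge0 : 0 <= fact3.
Proof.
apply: Ex_ge0 => om; case: (offspring om) => [|[|k]]; first by rewrite !mul0r.
  by rewrite subrr mulr0 mul0r.
have h1 : 0 <= k.+2%:R - 1 :> R by rewrite subr_ge0 ler1n.
have h2 : 0 <= k.+2%:R - 2 :> R by rewrite subr_ge0 (ler_nat _ 2).
by rewrite !mulr_ge0.
Qed.

Lemma measurable_weightT : measurable_fun setT (weight : configs R setT -> R).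
Proof. exact: measurable_weight_root. Qed.

Lemma ig_weight : ig (@weight R).
Proof.
apply: ig_le (igD (ig_cst mu 1) ig_weight2) _ => [|om]; first exact: measurable_weightT.
by have := weight_gt0 om; have := sqr_ge0 (weight om - 1); nra.
Qed.

Lemma Ex_weightM (F G : config R -> R) :
  measurable_fun setT (F : configs R [set inr [::]] -> R) ->
  measurable_fun setT (G : configs R not_root_weight -> R) ->
  (forall om, 0 <= F om) -> (forall om, 0 <= G om) -> ig F -> ig G ->
  ig (fun om => F om * G om) /\ Ex (fun om => F om * G om) = Ex F * Ex G.
Proof.
apply: (ge0_Ex_prod mu_indep).
by rewrite -subset0 => i [/= ->]; exact.
Qed.

Lemma measurable_weight1 :
  measurable_fun setT (weight : configs R [set inr [::]] -> R).
Proof. exact: measurable_weight_root. Qed.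

Definition cond1 n := Ex (con n).
Definition cond2 n := Ex (fun om => con n om ^+ 2).
Definition cond3 n := Ex (fun om => con n om ^+ 3).

(** Resistances grow per generation by exactly the mean offspring number: the factor [m^-1] cancels
    E[nu], and the mean passes unchanged from child to parent. *)
Lemma Ex_con_yv n : ig (yv n) -> ig (con n) /\ cond1 n = Ex (yv n).
Proof.
move=> iy.
have [iS ES] := Ex_branch mu_indep mu_shift ig_offspring3 (measurable_yv m_gt0 n)
  (yv_ge0 m_gt0 n) iy.
rewrite /cond1 (_ : con n = fun om => m^-1 * child_sum (yv n) (offspring om) om).
  split; first exact: igZ.
  by rewrite ExZ// ES Ex_offspring mulKf// gt_eqF.
by apply/funext => om; exact: conE.
Qed.

Lemma ig_yv n : ig (yv n).
Proof.
elim: n => // n IHn; have [ic _] := Ex_con_yv IHn.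
apply: ig_le ic _ => [|om]; first exact: measurable_yv.
by rewrite yv_ge0//= yvS_le_con.
Qed.

Lemma ig_con n : ig (con n).
Proof. by have [] := Ex_con_yv (ig_yv n). Qed.

Lemma cond1E n : cond1 n = Ex (yv n).
Proof. by have [] := Ex_con_yv (ig_yv n). Qed.

Lemma cond1_gt0 n : 0 < cond1 n.
Proof. by apply: Ex_gt0; [exact: ig_con|exact: con_gt0]. Qed.

Lemma Ex_con_yv2 n : ig (fun om => yv n om ^+ 2) ->
  ig (fun om => con n om ^+ 2) /\
  cond2 n = m^-1 * Ex (fun om => yv n om ^+ 2) + m ^- 2 * fact2 * cond1 n ^+ 2.
Proof.
move=> iy2; have mY := measurable_yv m_gt0 n; have Y0 := yv_ge0 m_gt0 n.
have iy := ig_yv n.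
have [iS ES] := Ex_branchM mu_indep mu_shift ig_offspring3 mY mY Y0 Y0 iy iy iy2.
rewrite /cond2 (_ : (fun om => con n om ^+ 2) = fun om => m ^- 2 *
    (child_sum (yv n) (offspring om) om * child_sum (yv n) (offspring om) om)).
  split; first exact: igZ.
  rewrite ExZ// ES Ex_offspring cond1E -/fact2; field.
  by rewrite gt_eqF.
by apply/funext => om; rewrite conE exprMn exprVn.
Qed.

Lemma Ex_con_yv3 n : ig (fun om => yv n om ^+ 2) -> ig (fun om => yv n om ^+ 3) ->
  ig (fun om => con n om ^+ 3) /\
  cond3 n = m ^- 2 * Ex (fun om => yv n om ^+ 3)
    + 3 * m ^- 3 * fact2 * Ex (fun om => yv n om ^+ 2) * cond1 n
    + m ^- 3 * fact3 * cond1 n ^+ 3.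
Proof.
move=> iy2 iy3; have mY := measurable_yv m_gt0 n; have Y0 := yv_ge0 m_gt0 n.
have iy := ig_yv n.
have [iS ES] := Ex_branch3 mu_indep mu_shift ig_offspring3 mY Y0 iy iy2 iy3.
rewrite /cond3 (_ : (fun om => con n om ^+ 3) = fun om => m ^- 3 *
    (child_sum (yv n) (offspring om) om ^+ 3)).
  split; first exact: igZ.
  rewrite ExZ// ES Ex_offspring cond1E -/fact2 -/fact3; field.
  by rewrite gt_eqF.
by apply/funext => om; rewrite conE exprMn exprVn.
Qed.

Lemma measurable_weightV1 :
  measurable_fun setT (fun om : configs R [set inr [::]] => (weight om)^-1).
Proof. by apply: measurable_inv_gt0; [exact: measurable_weight1|exact: weight_gt0]. Qed.

Lemma weightV_ge0 (om : config R) : 0 <= (weight om)^-1.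
Proof. by rewrite invr_ge0 ltW// weight_gt0. Qed.

Lemma yvS_le_weightV n om : yv n.+1 om <= (weight om)^-1.
Proof.
have w0 := weight_gt0 om; have c0 := con_gt0 m_gt0 n om.
rewrite ler_pdivrMr ?addr_gt0 ?mulr_gt0// mulrDr mulr1 mulKf ?gt_eqF//.
by rewrite lerDr invr_ge0 ltW.
Qed.

(* Two resistances in series: [(xi + r)^-2 <= xi^-1 * r^-1], so that one more
   moment becomes finite at each generation. *)
Lemma ig_yv2 n : ig (fun om => yv n.+1 om ^+ 2).
Proof.
have [i _] := Ex_weightM measurable_weightV1 (measurable_con m_gt0 n)
  weightV_ge0 (con_ge0 m_gt0 n) ig_weightV (ig_con n).
apply: ig_le i _ => [|om]; first by apply: measurable_funX; exact: measurable_yv.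
rewrite exprn_ge0 ?yv_ge0//= expr2 ler_pM ?yv_ge0//.
  exact: yvS_le_weightV.
exact: yvS_le_con.
Qed.

Lemma ig_con2 n : ig (fun om => con n.+1 om ^+ 2).
Proof. by have [] := Ex_con_yv2 (ig_yv2 n). Qed.

Lemma measurable_con2 n :
  measurable_fun setT (fun om : configs R not_root_weight => con n om ^+ 2).
Proof. by apply: measurable_funX; exact: measurable_con. Qed.

Lemma measurable_con3 n :
  measurable_fun setT (fun om : configs R not_root_weight => con n om ^+ 3).
Proof. by apply: measurable_funX; exact: measurable_con. Qed.

Lemma con2_ge0 n om : 0 <= con n om ^+ 2.
Proof. exact/exprn_ge0/con_ge0. Qed.

Lemma con3_ge0 n om : 0 <= con n om ^+ 3.
Proof. exact/exprn_ge0/con_ge0. Qed.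

(** The same gain as for squares: Y^3 is dominated by xi^-1 C^2. *)
Lemma ig_yv3 n : ig (fun om => yv n.+2 om ^+ 3).
Proof.
have [i _] := Ex_weightM measurable_weightV1 (measurable_con2 n.+1)
  weightV_ge0 (con2_ge0 n.+1) ig_weightV (ig_con2 n).
apply: ig_le i _ => [|om]; first by apply: measurable_funX; exact: measurable_yv.
rewrite exprn_ge0 ?yv_ge0//= exprS ler_pM ?exprn_ge0 ?yv_ge0//.
  exact: yvS_le_weightV.
by rewrite lerXn2r ?nnegrE ?yv_ge0 ?con_ge0// yvS_le_con.
Qed.

Lemma ig_con3 n : ig (fun om => con n.+2 om ^+ 3).
Proof. by have [] := Ex_con_yv3 (ig_yv2 n.+1) (ig_yv3 n). Qed.

(** Pointwise, c / (1 + w c) - (c - w c^2) = w^2 c^3 / (1 + w c) >= 0, and independence factors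
    E[w c^2]. *)
Lemma cond1S_ge n : cond1 n.+1 - Ex (@weight R) * cond2 n.+1 <= cond1 n.+2.
Proof.
have [i E] := Ex_weightM measurable_weight1 (measurable_con2 n.+1)
  (fun om => ltW (weight_gt0 om)) (con2_ge0 n.+1) ig_weight (ig_con2 n).
rewrite (cond1E n.+2) -E -ExB//; last exact: ig_con.
apply: Ex_le; [by apply: igB => //; exact: ig_con|exact: ig_yv|].
move=> om; have w0 := weight_gt0 om; have c0 := con_gt0 m_gt0 n.+1 om.
rewrite -[yv _ _]/(con n.+1 om / (1 + weight om * con n.+1 om)).
have h : 0 < 1 + weight om * con n.+1 om by nra.
rewrite ler_pdivlMr//.
set c := con _ _ in c0 h *; set w := weight om in w0 h *.
suff : 0 <= w ^+ 2 * c ^+ 3 by nra.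
by rewrite mulr_ge0 ?exprn_ge0// ltW.
Qed.

(* The tangent at [t] to the concave function [c |-> c / (1 + w c)]. *)
Lemma cond1S_le n : cond1 n.+1 <=
  cond1 n - Ex (fun om => weight om / (1 + weight om * cond1 n)) * cond1 n ^+ 2.
Proof.
set t := cond1 n; have t0 : 0 < t := cond1_gt0 n.
have wt om : 1 <= 1 + weight om * t by rewrite lerDl mulr_ge0// ltW// weight_gt0.
have wt0 om : 0 < 1 + weight om * t by apply: lt_le_trans (wt om).
have mw := measurable_weight1.
have mwt : measurable_fun setT (fun om : configs R [set inr [::]] => (1 + weight om * t)^-1).
  by apply: measurable_inv_gt0 => //; apply: measurable_funD => //; exact: measurable_funM.
have mh : measurable_fun setT (fun om : configs R [set inr [::]] => (1 + weight om * t) ^- 2).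
  rewrite (_ : (fun _ => _) = fun om => ((1 + weight om * t)^-1) ^+ 2); last first.
    by apply/funext => om; rewrite exprVn.
  exact: measurable_funX.
have h0 om : 0 <= (1 + weight om * t) ^- 2 by rewrite invr_ge0 exprn_ge0// ltW.
have ih : ig (fun om => (1 + weight om * t) ^- 2).
  apply: ig_le (ig_cst mu 1) _ => [|om]; first exact: (measurable_configsS _ mh).
  by rewrite h0/= invf_le1 ?exprn_gt0// exprn_ege1.
have [i E] := Ex_weightM mh (measurable_con m_gt0 n) h0 (con_ge0 m_gt0 n) ih (ig_con n).
have iq : ig (fun om => weight om / (1 + weight om * t)).
  apply: ig_le ig_weight _ => [|om].
    by apply: (measurable_configsS _ (measurable_funM mw mwt)).
  rewrite divr_ge0 ?(ltW (wt0 _)) ?(ltW (weight_gt0 _))//= ler_pdivrMr// ler_peMr// ltW//.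
  exact: weight_gt0.
have i1 := igZ t ih; have i2 := igZ (t ^+ 2) iq.
rewrite cond1E.
(* The conductance has mean [t] and is independent of the weight, so the linear part of the tangent
   integrates to zero. *)
have -> : t - Ex (fun om => weight om / (1 + weight om * t)) * t ^+ 2 =
    Ex (fun om => (t - t ^+ 2 * (weight om / (1 + weight om * t)))
      + ((1 + weight om * t) ^- 2 * con n om - t * (1 + weight om * t) ^- 2)).
  rewrite ExD; [|by apply: igB => //; exact: ig_cst|exact: igB].
  rewrite ExB//; last exact: ig_cst.
  by rewrite ExB// Ex_cst !ExZ// E -/(cond1 n) -/t; ring.
apply: Ex_le; first exact: ig_yv.
  by apply: igD; [apply: igB => //; exact: ig_cst|exact: igB].
move=> om; have w0 := weight_gt0 om; have c0 := con_gt0 m_gt0 n om.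
rewrite /yv; have {}wt := wt0 om.
set c := con _ _ in c0 *; set w := weight om in w0 wt *.
have wc : 0 < 1 + w * c by nra.
rewrite -subr_ge0.
have -> : t - t ^+ 2 * (w / (1 + w * t)) +
    ((1 + w * t) ^- 2 * c - t * (1 + w * t) ^- 2) - c / (1 + w * c) =
    w * (c - t) ^+ 2 / ((1 + w * t) ^+ 2 * (1 + w * c)).
  by field; rewrite !gt_eqF.
by nonneg.
Qed.

Lemma Ex_weight_ratio_gt0 (t : R) : 0 < t -> 0 < Ex (fun om => weight om / (1 + weight om * t)).
Proof.
move=> t0.
have wt om : 1 <= 1 + weight om * t by rewrite lerDl mulr_ge0// ltW// weight_gt0.
have wt0 om : 0 < 1 + weight om * t by apply: lt_le_trans (wt om).
have mw := measurable_weightT.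
apply: Ex_gt0; last by move=> om; rewrite divr_gt0// weight_gt0.
apply: ig_le ig_weight _ => [|om].
  apply: measurable_funM => //; apply: measurable_inv_gt0 => //.
  by apply: measurable_funD => //; exact: measurable_funM.
rewrite divr_ge0 ?(ltW (wt0 _)) ?(ltW (weight_gt0 _))//= ler_pdivrMr// ler_peMr// ltW//.
exact: weight_gt0.
Qed.

(** As the means decrease, this lets the constant computed at the initial mean serve at all later
    ones. *)
Lemma Ex_weight_ratio_le (s t : R) : 0 < s -> s <= t ->
  Ex (fun om => weight om / (1 + weight om * t)) <=
  Ex (fun om => weight om / (1 + weight om * s)).
Proof.
move=> s0 st.
have wt (r : R) (om : config R) : 0 < r -> 1 <= 1 + weight om * r.
  by move=> r0; rewrite lerDl mulr_ge0// ltW// weight_gt0.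
have wt0 (r : R) (om : config R) : 0 < r -> 0 < 1 + weight om * r.
  by move=> r0; exact: (lt_le_trans ltr01 (wt r om r0)).
have mw := measurable_weightT.
have iq (r : R) : 0 < r -> ig (fun om => weight om / (1 + weight om * r)).
  move=> r0; apply: ig_le ig_weight _ => [|om].
    apply: measurable_funM => //; apply: measurable_inv_gt0 => [|om]; last exact: wt0.
    by apply: measurable_funD => //; exact: measurable_funM.
  rewrite divr_ge0 ?(ltW (wt0 _ _ _)) ?(ltW (weight_gt0 _))//= ler_pdivrMr ?wt0// ler_peMr ?wt//.
  by rewrite ltW// weight_gt0.
have t0 := lt_le_trans s0 st.
apply: Ex_le; [exact: iq|exact: iq|] => om.
rewrite ler_pM2l ?weight_gt0// lef_pV2 ?posrE ?wt0// lerD2l ler_pM2l//.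
exact: weight_gt0.
Qed.

(* Under the law biased by [c], [c] and [1 / (1 + w c)] are negatively
   correlated; here this is the inequality
   [c (c - t) (1 / (1 + w c) - 1 / (1 + w t)) <= 0] with [t] the biased mean. *)
Lemma Ex_yv2_le n : Ex (fun om => yv n.+2 om ^+ 2) <=
  cond2 n.+1 / cond1 n.+1 * cond1 n.+2.
Proof.
set t := _ / _.
have x0 := cond1_gt0 n.+1.
have t0 : 0 < t.
  by rewrite divr_gt0//; apply: Ex_gt0; [exact: ig_con2|move=> om; rewrite exprn_gt0// con_gt0].
have wt om : 1 <= 1 + weight om * t by rewrite lerDl mulr_ge0// ltW// weight_gt0.
have wt0 om : 0 < 1 + weight om * t by apply: lt_le_trans (wt om).
have mw := measurable_weight1.
have mh : measurable_fun setT (fun om : configs R [set inr [::]] => (1 + weight om * t)^-1).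
  by apply: measurable_inv_gt0 => //; apply: measurable_funD => //; exact: measurable_funM.
have h0 om : 0 <= (1 + weight om * t)^-1 by rewrite invr_ge0 ltW.
have ih : ig (fun om => (1 + weight om * t)^-1).
  apply: ig_le (ig_cst mu 1) _ => [|om]; first exact: (measurable_configsS _ mh).
  by rewrite h0/= invf_le1.
have [i1 E1] := Ex_weightM mh (measurable_con m_gt0 n.+1) h0 (con_ge0 m_gt0 n.+1) ih (ig_con n.+1).
have [i2 E2] := Ex_weightM mh (measurable_con2 n.+1) h0 (con2_ge0 n.+1) ih (ig_con2 n).
have i3 := igZ t i1; have i4 := igZ t (ig_yv n.+2).
have -> : t * cond1 n.+2 = Ex (fun om => t * yv n.+2 om +
    ((1 + weight om * t)^-1 * con n.+1 om ^+ 2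
     - t * ((1 + weight om * t)^-1 * con n.+1 om))).
  rewrite ExD//; last exact: igB.
  rewrite ExB// !ExZ//; last exact: ig_yv.
  rewrite -cond1E E1 E2 -/(cond1 n.+1) -/(cond2 n.+1) /t; field.
  by rewrite gt_eqF.
apply: Ex_le; first exact: ig_yv2.
  by apply: igD => //; exact: igB.
move=> om; have w0 := weight_gt0 om; have c0 := con_gt0 m_gt0 n.+1 om.
rewrite -[yv _ _]/(con n.+1 om / (1 + weight om * con n.+1 om)).
have {}wt := wt0 om.
set c := con _ _ in c0 *; set w := weight om in w0 wt *.
have wc : 0 < 1 + w * c by nra.
rewrite -subr_ge0.
have -> : t * (c / (1 + w * c)) + ((1 + w * t)^-1 * c ^+ 2 - t * ((1 + w * t)^-1 * c))
    - (c / (1 + w * c)) ^+ 2 =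
    (w * c * (c - t) ^+ 2 * (1 + w * c) + w * c ^+ 3 * (1 + w * t))
    / ((1 + w * t) * (1 + w * c) ^+ 2).
  by field; rewrite !gt_eqF.
by nonneg.
Qed.

Lemma Ex_yv2_le2 n : Ex (fun om => yv n.+2 om ^+ 2) <= cond2 n.+1.
Proof.
apply: Ex_le; [exact: ig_yv2|exact: ig_con2|move=> om].
by rewrite lerXn2r ?nnegrE ?yv_ge0 ?con_ge0// yvS_le_con.
Qed.

Lemma Ex_yv3_le3 n : Ex (fun om => yv n.+3 om ^+ 3) <= cond3 n.+2.
Proof.
apply: Ex_le; [exact: ig_yv3|exact: ig_con3|move=> om].
by rewrite lerXn2r ?nnegrE ?yv_ge0 ?con_ge0// yvS_le_con.
Qed.

Lemma Ex_weight_con3 n : ig (fun om => weight om * con n.+2 om ^+ 3) /\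
  Ex (fun om => weight om * con n.+2 om ^+ 3) = Ex (@weight R) * cond3 n.+2.
Proof.
exact: (Ex_weightM measurable_weight1 (measurable_con3 n.+2)
  (fun om => ltW (weight_gt0 om)) (con3_ge0 n.+2) ig_weight (ig_con3 n)).
Qed.

(** (1 + w c)^-2 >= 1 - 2 w c, multiplied by c^2. *)
Lemma Ex_yv2_ge n :
  cond2 n.+2 - 2 * Ex (@weight R) * cond3 n.+2 <= Ex (fun om => yv n.+3 om ^+ 2).
Proof.
have [i E] := Ex_weight_con3 n; have i' := igZ 2 i.
rewrite -mulrA -E -ExZ// -ExB//; last exact: ig_con2.
apply: Ex_le; [by apply: igB => //; exact: ig_con2|exact: ig_yv2|].
move=> om; have w0 := weight_gt0 om; have c0 := con_gt0 m_gt0 n.+2 om.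
rewrite -[yv _ _]/(con n.+2 om / (1 + weight om * con n.+2 om)).
set c := con _ _ in c0 *; set w := weight om in w0 *.
have wc : 0 < 1 + w * c by nra.
rewrite -subr_ge0.
have -> : (c / (1 + w * c)) ^+ 2 - (c ^+ 2 - 2 * (w * c ^+ 3)) =
    (w ^+ 2 * c ^+ 4 * (3 + 2 * w * c)) / (1 + w * c) ^+ 2.
  by field; rewrite !gt_eqF.
by nonneg.
Qed.

(** C - Y = w c^2 / (1 + w c), whose square is at most w c^3; the cruder bound w^2 c^4 would call
    for a fourth moment. *)
Lemma Ex_sqr_con_yv n :
  ig (fun om => (con n.+2 om - yv n.+3 om) ^+ 2) /\
  Ex (fun om => (con n.+2 om - yv n.+3 om) ^+ 2) <= Ex (@weight R) * cond3 n.+2.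
Proof.
have [i E] := Ex_weight_con3 n.
have h om : 0 <= (con n.+2 om - yv n.+3 om) ^+ 2 <= weight om * con n.+2 om ^+ 3.
  rewrite sqr_ge0/=; have w0 := weight_gt0 om; have c0 := con_gt0 m_gt0 n.+2 om.
  rewrite -[yv _ _]/(con n.+2 om / (1 + weight om * con n.+2 om)).
  set c := con _ _ in c0 *; set w := weight om in w0 *.
  have wc : 0 < 1 + w * c by nra.
  rewrite -subr_ge0.
  have -> : w * c ^+ 3 - (c - c / (1 + w * c)) ^+ 2 =
      (w * c ^+ 3 * (1 + w * c + w ^+ 2 * c ^+ 2)) / (1 + w * c) ^+ 2.
    by field; rewrite !gt_eqF.
  by nonneg.
have iD : ig (fun om => (con n.+2 om - yv n.+3 om) ^+ 2).
  apply: ig_le i h; apply: measurable_funX; apply: measurable_funB.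
    exact: measurable_conT.
  exact: measurable_yv.
by split=> //; rewrite -E; apply: Ex_le => // om; have /andP[] := h om.
Qed.

(** The second-order expansion c / (1 + w c) <= c - w c^2 + w^2 c^3, where E[xi^2] appears. *)
Lemma cond1B_ge n :
  Ex (@weight R) * cond2 n.+2 - Ex (fun om => weight om ^+ 2) * cond3 n.+2
  <= cond1 n.+2 - cond1 n.+3.
Proof.
have [i E] := Ex_weightM (measurable_funX 2 measurable_weight1) (measurable_con3 n.+2)
  (fun om => sqr_ge0 (weight om)) (con3_ge0 n.+2) ig_weight2 (ig_con3 n).
have [i2 E2] := Ex_weightM measurable_weight1 (measurable_con2 n.+2)
  (fun om => ltW (weight_gt0 om)) (con2_ge0 n.+2) ig_weight (ig_con2 n.+1).
rewrite (cond1E n.+3) -E -E2 -!ExB//; [|exact: ig_con|exact: ig_yv].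
apply: Ex_le; [exact: igB|by apply: igB; [exact: ig_con|exact: ig_yv]|].
move=> om; have w0 := weight_gt0 om; have c0 := con_gt0 m_gt0 n.+2 om.
rewrite -[yv _ _]/(con n.+2 om / (1 + weight om * con n.+2 om)).
set c := con _ _ in c0 *; set w := weight om in w0 *.
have wc : 0 < 1 + w * c by nra.
rewrite -subr_ge0.
have -> : c - c / (1 + w * c) - (w * c ^+ 2 - w ^+ 2 * c ^+ 3) =
    (w ^+ 3 * c ^+ 4) / (1 + w * c).
  by field; rewrite !gt_eqF.
by nonneg.
Qed.

Definition ratio_const : R := m ^- 2 * fact2 * Ex (@weight R) / (1 - m^-1).

Lemma ratio_const_gt0 : 0 < ratio_const.
Proof.
rewrite divr_gt0 ?mulr_gt0 ?fact2_gt0 ?invr_gt0 ?exprn_gt0//.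
  by apply: Ex_gt0; [exact: ig_weight|exact: weight_gt0].
by rewrite subr_gt0 invf_lt1.
Qed.

(** Third moments are known to be finite only from index 2 on, so the abstract recursion is applied
    to sequences shifted by two. *)
Let x2 n := cond1 n.+2.
Let s2 n := cond2 n.+2.
Let u2 n := cond3 n.+2.
Let y2 n := Ex (fun om => yv n.+3 om ^+ 2).
Let k0 := Ex (fun om => weight om / (1 + weight om * cond1 0)).

Let a_gt0 : 0 < m ^- 2 * fact2.
Proof. by rewrite mulr_gt0 ?fact2_gt0// invr_gt0 exprn_gt0. Qed.
Let b_gt0 : 0 < Ex (@weight R).
Proof. by apply: Ex_gt0; [exact: ig_weight|exact: weight_gt0]. Qed.
Let b'_ge0 : 0 <= Ex (fun om => weight om ^+ 2).
Proof. by apply: Ex_ge0 => om; exact: sqr_ge0. Qed.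
Let k0_gt0 : 0 < k0. Proof. exact: Ex_weight_ratio_gt0 (cond1_gt0 0). Qed.
Let k2_ge0 : 0 <= 3 * m ^- 3 * fact2.
Proof. by rewrite !mulr_ge0// ?invr_ge0 ?exprn_ge0// ltW// fact2_gt0. Qed.
Let k3_ge0 : 0 <= m ^- 3 * fact3.
Proof. by rewrite mulr_ge0 ?fact3_ge0// invr_ge0 exprn_ge0// ltW. Qed.
Let s2_ge0 n : 0 <= s2 n. Proof. by apply: Ex_ge0 => om; exact: con2_ge0. Qed.
Let u2_ge0 n : 0 <= u2 n. Proof. by apply: Ex_ge0 => om; exact: con3_ge0. Qed.

Let kap n := Ex (fun om => weight om / (1 + weight om * cond1 n)).
Let kap_gt0 n : 0 < kap n. Proof. exact: Ex_weight_ratio_gt0 (cond1_gt0 n). Qed.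
Let kapS n : cond1 n.+1 <= cond1 n - kap n * cond1 n ^+ 2. Proof. exact: cond1S_le. Qed.

Lemma cond1_le0 n : cond1 n <= cond1 0.
Proof.
elim: n => // n; apply: le_trans; apply: (le_trans (kapS n)).
by rewrite gerBl; apply: mulr_ge0; [exact: ltW (kap_gt0 n)|exact: sqr_ge0].
Qed.

Let x2S_le n : x2 n.+1 <= x2 n - k0 * x2 n ^+ 2.
Proof.
have h : k0 <= kap n.+2.
  by apply: Ex_weight_ratio_le; [exact: cond1_gt0|exact: cond1_le0].
have h2 : k0 * x2 n ^+ 2 <= kap n.+2 * x2 n ^+ 2 := ler_wpM2r (sqr_ge0 (x2 n)) h.
exact: (le_trans (kapS n.+2) (lerB (lexx (x2 n)) h2)).
Qed.

Let s2S n : s2 n.+1 = m^-1 * y2 n + m ^- 2 * fact2 * x2 n.+1 ^+ 2.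
Proof. by have [_] := Ex_con_yv2 (ig_yv2 n.+2). Qed.

Let u2S n : u2 n.+1 <= m ^- 2 * u2 n + 3 * m ^- 3 * fact2 * (s2 n * x2 n.+1)
  + m ^- 3 * fact3 * x2 n.+1 ^+ 3.
Proof.
have [_ h] := Ex_con_yv3 (ig_yv2 n.+2) (ig_yv3 n.+1).
rewrite /u2 h lerD2r; apply: lerD.
  by rewrite ler_wpM2l ?invr_ge0 ?exprn_ge0 ?(ltW m_gt0)// Ex_yv3_le3.
rewrite -mulrA ler_wpM2l// ler_wpM2r ?(ltW (cond1_gt0 _))//.
exact: Ex_yv2_le2.
Qed.

Let x2_gt0 n : 0 < x2 n. Proof. exact: cond1_gt0. Qed.
Let x2_ge n : x2 n - Ex (@weight R) * s2 n <= x2 n.+1.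
Proof. exact: cond1S_ge. Qed.
Let y2_le n : y2 n <= s2 n / x2 n * x2 n.+1. Proof. exact: Ex_yv2_le. Qed.
Let y2_le_s n : y2 n <= s2 n. Proof. exact: Ex_yv2_le2. Qed.
Let y2_ge n : s2 n - 2 * Ex (@weight R) * u2 n <= y2 n. Proof. exact: Ex_yv2_ge. Qed.
Let x2B_ge n : Ex (@weight R) * s2 n - Ex (fun om => weight om ^+ 2) * u2 n
  <= x2 n - x2 n.+1.
Proof. exact: cond1B_ge. Qed.

Lemma cond1_cvg0 : cond1 @ \oo --> 0.
Proof.
by rewrite -cvg_shiftS -cvg_shiftS; exact: (rec_cvg0 k0_gt0 x2_gt0 x2S_le).
Qed.

Lemma cond1_ratio_cvg1 : (fun n => cond1 n.+3 / cond1 n.+2) @ \oo --> (1 : R).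
Proof.
exact: (rec_ratio_cvg1 m_gt1 k0_gt0 x2_gt0 s2_ge0 x2_ge x2S_le s2S y2_le).
Qed.

Lemma cond2_bounded :
  exists M, \forall n \near \oo, cond2 n.+2 / cond1 n.+2 ^+ 2 <= M.
Proof.
exact: (rec_q_bounded m_gt1 k0_gt0 x2_gt0 s2_ge0 x2_ge x2S_le s2S y2_le).
Qed.

Lemma cond3_bounded :
  exists M, \forall n \near \oo, cond3 n.+2 / cond1 n.+2 ^+ 3 <= M.
Proof.
exact: (rec_v_bounded m_gt1 k0_gt0 k2_ge0 x2_gt0 s2_ge0 u2_ge0 x2_ge x2S_le s2S
  y2_le u2S).
Qed.

Lemma cond1_invB_cvg :
  (fun n => (cond1 n.+3)^-1 - (cond1 n.+2)^-1) @ \oo --> ratio_const.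
Proof.
exact: (rec_invB_cvg m_gt1 k0_gt0 k2_ge0 x2_gt0 s2_ge0 u2_ge0 x2_ge x2S_le s2S
  y2_le y2_le_s y2_ge u2S x2B_ge).
Qed.

Lemma cond1_cvg : (fun n => n%:R * cond1 n.+2) @ \oo --> ratio_const^-1.
Proof.
exact: (rec_cvg m_gt1 a_gt0 b_gt0 k0_gt0 k2_ge0 x2_gt0 s2_ge0 u2_ge0 x2_ge x2S_le
  s2S y2_le y2_le_s y2_ge u2S x2B_ge).
Qed.

(** * Comparison with the branching martingale *)

Lemma ig_mul_of_sqr (F G : config R -> R) :
  measurable_fun setT (F : configs R setT -> R) ->
  measurable_fun setT (G : configs R setT -> R) ->
  ig (fun om => F om ^+ 2) -> ig (fun om => G om ^+ 2) -> ig (fun om => F om * G om).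
Proof.
move=> mF mG iF iG; apply: ig_dom (igD iF iG) _ => [|om].
  exact: measurable_funM.
rewrite normrM -(real_normK (num_real (F om))) -(real_normK (num_real (G om))).
have := sqr_ge0 (`|F om| - `|G om|); have := normr_ge0 (F om); have := normr_ge0 (G om).
nra.
Qed.

Lemma ig_of_sqr (F : config R -> R) :
  measurable_fun setT (F : configs R setT -> R) -> ig (fun om => F om ^+ 2) -> ig F.
Proof.
move=> mF iF; apply: ig_dom (igD (ig_cst mu 1) iF) _ => [|om]; first exact: mF.
rewrite -(real_normK (num_real (F om))).
have := sqr_ge0 (`|F om| - 1); have := normr_ge0 (F om); nra.
Qed.

(* One generation contracts centred differences by the factor [m^-1] in L^2;
   the cross terms vanish because [c * Y - V] has mean zero. *)
Lemma Ex_branch_diff2 (Y V : config R -> R) c :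
  measurable_fun setT (Y : configs R setT -> R) ->
  measurable_fun setT (V : configs R setT -> R) ->
  (forall om, 0 <= Y om) -> (forall om, 0 <= V om) ->
  ig (fun om => Y om ^+ 2) -> ig (fun om => V om ^+ 2) -> c * Ex Y = Ex V ->
  let A om := m^-1 * child_sum Y (offspring om) om in
  let B om := m^-1 * child_sum V (offspring om) om in
  [/\ ig (fun om => A om ^+ 2), ig (fun om => B om ^+ 2),
      ig (fun om => (c * A om - B om) ^+ 2) &
      Ex (fun om => (c * A om - B om) ^+ 2) =
      m^-1 * Ex (fun om => (c * Y om - V om) ^+ 2)].
Proof.
move=> mY mV Y0 V0 iY2 iV2 cYV A B.
have iY := ig_of_sqr mY iY2; have iV := ig_of_sqr mV iV2.
have iYV := ig_mul_of_sqr mY mV iY2 iV2.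
have [iYYS EYY] := Ex_branchM mu_indep mu_shift ig_offspring3 mY mY Y0 Y0 iY iY iY2.
have [iYVS EYV] := Ex_branchM mu_indep mu_shift ig_offspring3 mY mV Y0 V0 iY iV iYV.
have [iVVS EVV] := Ex_branchM mu_indep mu_shift ig_offspring3 mV mV V0 V0 iV iV iV2.
have iAA := igZ (m ^- 2 * c ^+ 2) iYYS.
have iAB := igZ (m ^- 2 * (2 * c)) iYVS.
have iBB := igZ (m ^- 2) iVVS.
have E1 : (fun om => (c * A om - B om) ^+ 2) = fun om =>
  (m ^- 2 * c ^+ 2 * (child_sum Y (offspring om) om * child_sum Y (offspring om) om)
   - m ^- 2 * (2 * c) * (child_sum Y (offspring om) om * child_sum V (offspring om) om))
  + m ^- 2 * (child_sum V (offspring om) om * child_sum V (offspring om) om).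
  by apply/funext => om; rewrite /A /B; field; rewrite gt_eqF.
have E2 : (fun om => (c * Y om - V om) ^+ 2) = fun om =>
  (c ^+ 2 * Y om ^+ 2 - 2 * c * (Y om * V om)) + V om ^+ 2.
  by apply/funext => om; ring.
split.
- rewrite (_ : (fun om => _) = fun om => m ^- 2 *
    (child_sum Y (offspring om) om * child_sum Y (offspring om) om)); first exact: igZ.
  by apply/funext => om; rewrite /A exprMn exprVn.
- rewrite (_ : (fun om => _) = fun om => m ^- 2 *
    (child_sum V (offspring om) om * child_sum V (offspring om) om)); first exact: igZ.
  by apply/funext => om; rewrite /B exprMn exprVn.
- by rewrite E1; apply: igD => //; exact: igB.
have iY2' := igZ (c ^+ 2) iY2; have iYV' := igZ (2 * c) iYV.
rewrite E1 E2 ExD//; last exact: igB.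
rewrite ExB// !ExZ// ExD//; last exact: igB.
rewrite ExB// !ExZ// EYY EYV EVV Ex_offspring -cYV.
rewrite (_ : Ex (fun om => Y om ^+ 2) = Ex (fun om => Y om * Y om)); last first.
  by apply: Ex_ext => om; rewrite expr2.
rewrite (_ : Ex (fun om => V om ^+ 2) = Ex (fun om => V om * V om)); last first.
  by apply: Ex_ext => om; rewrite expr2.
by field; rewrite gt_eqF.
Qed.

Lemma measurable_gwT n : measurable_fun setT (gw m n : configs R setT -> R).
Proof. exact: measurable_gw. Qed.

Lemma ig_gw n : ig (gw m n) /\ Ex (gw m n) = 1.
Proof.
elim: n => [|n [iW EW]]; first by split; [exact: ig_cst|rewrite Ex_cst].
have [iS ES] := Ex_branch mu_indep mu_shift ig_offspring3 (measurable_gwT n)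
  (gw_ge0 m_gt0 n) iW.
split; first exact: igZ.
by rewrite /= ExZ// ES EW Ex_offspring mulr1 mulVf// gt_eqF.
Qed.

Lemma ig_gw2 n : ig (fun om => gw m n om ^+ 2).
Proof.
elim: n => [|n IHn].
  by rewrite (_ : (fun om => _) = fun=> 1 ^+ 2); [exact: ig_cst|].
have [|||||||_ iB _ _] := @Ex_branch_diff2 (gw m n) (gw m n) 1 => //.
- exact: measurable_gwT.
- exact: measurable_gwT.
- exact: gw_ge0.
- exact: gw_ge0.
by rewrite mul1r.
Qed.

(** The increments are centred, so every generation contracts their mean square by [m^-1]. *)
Lemma Ex_gw_diff2 n : ig (fun om => (gw m n.+1 om - gw m n om) ^+ 2) /\
  Ex (fun om => (gw m n.+1 om - gw m n om) ^+ 2) =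
  m ^- n * Ex (fun om => (gw m 1 om - gw m 0 om) ^+ 2).
Proof.
have h k : ig (fun om => (gw m k.+2 om - gw m k.+1 om) ^+ 2) /\
  Ex (fun om => (gw m k.+2 om - gw m k.+1 om) ^+ 2) =
  m^-1 * Ex (fun om => (gw m k.+1 om - gw m k om) ^+ 2).
  have [|||||||_ _ iC EC] := @Ex_branch_diff2 (gw m k.+1) (gw m k) 1 => //.
  - exact: measurable_gwT.
  - exact: measurable_gwT.
  - exact: gw_ge0.
  - exact: gw_ge0.
  - exact: ig_gw2.
  - exact: ig_gw2.
  - by rewrite (ig_gw k.+1).2 (ig_gw k).2 mul1r.
  have e j : (fun om => (gw m j.+1 om - gw m j om) ^+ 2) =
      (fun om => (1 * gw m j.+1 om - gw m j om) ^+ 2).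
    by apply/funext => om; rewrite mul1r.
  by rewrite !e; split; [exact: iC|exact: EC].
case: n => [|n].
  split; last by rewrite expr0 invr1 mul1r.
  rewrite (_ : (fun om => _) = fun om =>
    (gw m 1 om ^+ 2 - 2 * (gw m 1 om * gw m 0 om)) + gw m 0 om ^+ 2).
    apply: igD; last exact: ig_gw2.
    apply: igB; first exact: ig_gw2.
    apply: igZ; apply: ig_mul_of_sqr; [exact: measurable_gwT..|exact: ig_gw2|exact: ig_gw2].
  by apply/funext => om; ring.
split; first by have [] := h n.
elim: n => [|n IHn]; first by rewrite (h 0).2 expr1.
by rewrite (h n.+1).2 IHn mulrA -invfM -exprS.
Qed.

Lemma gw_cvg :
  [/\ {ae mu, forall om, (gw m ^~ om) @ \oo --> limn (gw m ^~ om)},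
      ig (fun om => limn (gw m ^~ om)) &
      (fun n => Ex (fun om => `|gw m n om - limn (gw m ^~ om)|)) @ \oo --> (0 : R)].
Proof.
(* By the inequality between arithmetic and geometric means, [th] is at least the square root of
   [m^-1]; it is still less than one. *)
pose th := (1 + m^-1) / 2; pose K := Ex (fun om => (gw m 1 om - gw m 0 om) ^+ 2).
have mV1 : m^-1 < 1 by rewrite invf_lt1.
have mV0 := mV_gt0.
have th0 : 0 < th by rewrite /th; lra.
have th1 : th < 1 by rewrite /th; lra.
have thm : m^-1 <= th ^+ 2.
  by rewrite /th; have := sqr_ge0 (1 - m^-1); nra.
have K0 : 0 <= K by apply: Ex_ge0 => om; exact: sqr_ge0.
have iD n : ig (fun om => gw m n.+1 om - gw m n om).
  by apply: igB; [exact: (ig_gw n.+1).1|exact: (ig_gw n).1].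
apply: (@cvg_of_geometric_increments _ _ _ mu (gw m) ((1 + K) / 2) th).
- by rewrite ltW.
- by move=> n; exact: measurable_gwT.
- exact: (ig_gw 0).1.
- exact: iD.
move=> n; have [i2 E2] := Ex_gw_diff2 n.
have thn : 0 < th ^+ n by rewrite exprn_gt0.
have ib := igD (ig_cst mu (th ^+ n / 2)) (igZ ((th ^+ n)^-1 / 2) i2).
(* |z| <= t / 2 + z^2 / (2 t) with t = th^n: both terms then have order th^n, because [m ^- n] is at
   most its square. *)
apply: (@le_trans _ _ (Ex (fun om => th ^+ n / 2 +
    (th ^+ n)^-1 / 2 * (gw m n.+1 om - gw m n om) ^+ 2))).
  apply: Ex_le; [by apply: ig_norm|exact: ib|move=> om].
  set z := _ - _; rewrite -(real_normK (num_real z)) -subr_ge0.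
  have -> : th ^+ n / 2 + (th ^+ n)^-1 / 2 * `|z| ^+ 2 - `|z| =
      (th ^+ n - `|z|) ^+ 2 / (2 * th ^+ n).
    by field; rewrite gt_eqF.
  by rewrite divr_ge0 ?sqr_ge0// mulr_ge0// ltW.
rewrite ExD; [|exact: ig_cst|exact: igZ].
rewrite Ex_cst ExZ// E2 -/K.
have h : m ^- n <= (th ^+ n) ^+ 2.
  by rewrite -exprVn exprAC lerXn2r// ?nnegrE ?exprn_ge0 ?invr_ge0 ?(ltW th0) ?(ltW m_gt0).
have h2 : (th ^+ n)^-1 / 2 * (m ^- n * K) <= (th ^+ n)^-1 / 2 * ((th ^+ n) ^+ 2 * K).
  by rewrite ler_wpM2l ?ler_wpM2r// divr_ge0// invr_ge0 ltW.
apply: (le_trans (lerD (lexx _) h2)).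
by rewrite le_eqVlt; apply/orP; left; apply/eqP; field; rewrite gt_eqF.
Qed.

Let dist n := Ex (fun om => ((cond1 n.+2)^-1 * con n.+2 om - gw m n.+2 om) ^+ 2).

Lemma ig_con_gw n (c : R) : ig (fun om => (c * con n.+1 om - gw m n.+1 om) ^+ 2).
Proof.
rewrite (_ : (fun om => _) = fun om => (c ^+ 2 * con n.+1 om ^+ 2
    - 2 * c * (con n.+1 om * gw m n.+1 om)) + gw m n.+1 om ^+ 2).
  apply: igD; last exact: ig_gw2.
  apply: igB; first exact/igZ/ig_con2.
  apply: igZ; apply: ig_mul_of_sqr; [exact: measurable_conT|exact: measurable_gwT|
    exact: ig_con2|exact: ig_gw2].
by apply/funext => om; ring.
Qed.

(** Bounds the mean square of Y / x' - C / x: the first term pays for passing from C to Y, the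
    second for the change of normalisation. *)
Let err n : R := 2 * (Ex (@weight R) * cond3 n.+2 / cond1 n.+3 ^+ 2)
  + 2 * (cond2 n.+2 * ((cond1 n.+3)^-1 - (cond1 n.+2)^-1) ^+ 2).

Let errP n :
  ig (fun om => ((cond1 n.+3)^-1 * yv n.+3 om - (cond1 n.+2)^-1 * con n.+2 om) ^+ 2) /\
  Ex (fun om => ((cond1 n.+3)^-1 * yv n.+3 om - (cond1 n.+2)^-1 * con n.+2 om) ^+ 2)
  <= err n.
Proof.
have [i1 E1] := Ex_sqr_con_yv n; have i2 := ig_con2 n.+1.
set c' := (cond1 n.+3)^-1; set c := (cond1 n.+2)^-1.
have j1 := igZ (2 * c' ^+ 2) i1; have j2 := igZ (2 * (c' - c) ^+ 2) i2.
have h om : 0 <= (c' * yv n.+3 om - c * con n.+2 om) ^+ 2 <=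
    2 * c' ^+ 2 * (con n.+2 om - yv n.+3 om) ^+ 2 + 2 * (c' - c) ^+ 2 * con n.+2 om ^+ 2.
  rewrite sqr_ge0/= -subr_ge0.
  set X := (X in 0 <= X).
  have -> : X = (c' * (con n.+2 om - yv n.+3 om) + (c' - c) * con n.+2 om) ^+ 2.
    by rewrite /X; ring.
  exact: sqr_ge0.
have iE : ig (fun om => (c' * yv n.+3 om - c * con n.+2 om) ^+ 2).
  apply: ig_le (igD j1 j2) h; apply: measurable_funX; apply: measurable_funB;
    by apply: measurable_funM => //; [exact: measurable_yv||exact: measurable_conT].
split=> //.
apply: (@le_trans _ _ (Ex (fun om => 2 * c' ^+ 2 * (con n.+2 om - yv n.+3 om) ^+ 2
    + 2 * (c' - c) ^+ 2 * con n.+2 om ^+ 2))).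
  by apply: Ex_le => //; [exact: igD|move=> om; have /andP[] := h om].
rewrite ExD// !ExZ// /err -/c' -/c -/(cond2 n.+2) -exprVn -/c'.
have c'0 : 0 <= 2 * c' ^+ 2 by rewrite mulr_ge0 ?sqr_ge0.
have := ler_wpM2l c'0 E1; rewrite -/c'.
set e1 := Ex _; set e2 := Ex _; set e3 := cond3 _; set e4 := cond2 _; nra.
Qed.

Let dist_rec n : dist n.+1 <= (1 + m^-1) / 2 * dist n
  + m^-1 * (1 + 2 / (m - 1)) * err n.
Proof.
have mB0 : 0 < m - 1 by rewrite subr_gt0.
have [|||||||_ _ _ EC] := @Ex_branch_diff2 (yv n.+3) (gw m n.+2) (cond1 n.+3)^-1 => //.
- exact: measurable_yv.
- exact: measurable_gwT.
- exact: yv_ge0.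
- exact: gw_ge0.
- exact: ig_yv2.
- exact: ig_gw2.
- by rewrite -cond1E mulVf ?(ig_gw n.+2).2// gt_eqF// cond1_gt0.
have -> : dist n.+1 = m^-1 * Ex (fun om => ((cond1 n.+3)^-1 * yv n.+3 om - gw m n.+2 om) ^+ 2).
  by rewrite -EC; apply: Ex_ext => om; rewrite conE.
have [ie Ee] := errP n; have id := ig_con_gw n.+1 (cond1 n.+2)^-1.
(* The parameter of Young's inequality for which [m^-1 * (1 + e)] is the midpoint of [m^-1] and [1],
   still a contraction. *)
set e := (m - 1) / 2; have e0 : 0 < e by rewrite divr_gt0.
have j1 := igZ (1 + e) id; have j2 := igZ (1 + e^-1) ie.
have h om : 0 <= ((cond1 n.+3)^-1 * yv n.+3 om - gw m n.+2 om) ^+ 2 <=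
   (1 + e) * ((cond1 n.+2)^-1 * con n.+2 om - gw m n.+2 om) ^+ 2 +
   (1 + e^-1) * ((cond1 n.+3)^-1 * yv n.+3 om - (cond1 n.+2)^-1 * con n.+2 om) ^+ 2.
  rewrite sqr_ge0 andTb.
  set b := (cond1 n.+3)^-1 * _; set g := gw _ _ _; set a := (cond1 n.+2)^-1 * _.
  rewrite -subr_ge0.
  have -> : (1 + e) * (a - g) ^+ 2 + (1 + e^-1) * (b - a) ^+ 2 - (b - g) ^+ 2 =
    (e * (a - g) - (b - a)) ^+ 2 / e by field; rewrite gt_eqF.
  by rewrite divr_ge0 ?sqr_ge0// ltW.
have iY : ig (fun om => ((cond1 n.+3)^-1 * yv n.+3 om - gw m n.+2 om) ^+ 2).
  apply: ig_le (igD j1 j2) h; apply: measurable_funX; apply: measurable_funB.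
    by apply: measurable_funM => //; exact: measurable_yv.
  exact: measurable_gwT.
have := Ex_le iY (igD j1 j2) (fun om => (andP (h om)).2).
rewrite ExD// !ExZ// -/(dist n) => hh.
have -> : (1 + m^-1) / 2 * dist n + m^-1 * (1 + 2 / (m - 1)) * err n =
    m^-1 * ((1 + e) * dist n + (1 + e^-1) * err n).
  by rewrite /e; field; rewrite !gt_eqF.
rewrite ler_wpM2l ?(ltW mV_gt0)// (le_trans hh)// lerD2l ler_wpM2l//.
by rewrite addr_ge0// invr_ge0 ltW.
Qed.

(** Up to constants the two terms are v x (x / x')^2 and q x^2 (1 / x' - 1 / x)^2, in which every
    factor other than the powers of x is eventually bounded. *)
Let err_cvg0 : err @ \oo --> (0 : R).
Proof.
have xn0 n : cond1 n != 0 by rewrite gt_eqF// cond1_gt0.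
have x0 : (fun n => cond1 n.+2) @ \oo --> (0 : R).
  by have := cond1_cvg0; rewrite -cvg_shiftS -cvg_shiftS.
have rV : (fun n => (cond1 n.+3 / cond1 n.+2)^-1) @ \oo --> (1 : R).
  by apply: (cvg_congr (cvgV (oner_neq0 _) cond1_ratio_cvg1)) => //; rewrite invr1.
have v0 : (fun n => cond3 n.+2 / cond1 n.+2 ^+ 3 * cond1 n.+2) @ \oo --> (0 : R).
  have [M hM] := cond3_bounded; apply: (@cvg0_bounded _ _ _ M) x0.
  apply: filterS hM => n hn; rewrite ger0_norm// divr_ge0 ?exprn_ge0 ?(ltW (cond1_gt0 _))//.
  by apply: Ex_ge0 => om; exact: con3_ge0.
have q0 : (fun n => cond2 n.+2 / cond1 n.+2 ^+ 2 * (cond1 n.+2 * cond1 n.+2)) @ \oo --> (0 : R).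
  have [M hM] := cond2_bounded; apply: (@cvg0_bounded _ _ _ M).
    apply: filterS hM => n hn; rewrite ger0_norm// divr_ge0 ?exprn_ge0 ?(ltW (cond1_gt0 _))//.
    by apply: Ex_ge0 => om; exact: con2_ge0.
  by apply: (cvg_congr (cvgM x0 x0)) => //; rewrite mulr0.
have iB := cond1_invB_cvg.
apply: (cvg_congr (cvgD
  (cvgM (cvg_cst (2 * Ex (@weight R))) (cvgM v0 (cvgM rV rV)))
  (cvgM (cvg_cst (2 : R)) (cvgM q0 (cvgM iB iB))))) => [n|]; last first.
  by rewrite !(mul0r, mulr0) addr0.
rewrite -[LHS]/(2 * Ex (@weight R) * (cond3 n.+2 / cond1 n.+2 ^+ 3 * cond1 n.+2
   * ((cond1 n.+3 / cond1 n.+2)^-1 * (cond1 n.+3 / cond1 n.+2)^-1))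
  + 2 * (cond2 n.+2 / cond1 n.+2 ^+ 2 * (cond1 n.+2 * cond1 n.+2)
   * (((cond1 n.+3)^-1 - (cond1 n.+2)^-1) * ((cond1 n.+3)^-1 - (cond1 n.+2)^-1)))).
rewrite /err; congr (_ + _); first by field; rewrite !xn0.
by field; rewrite !xn0.
Qed.

Lemma con_gw_cvg0 : dist @ \oo --> (0 : R).
Proof.
have mV1 : m^-1 < 1 by rewrite invf_lt1.
apply: (@contraction_cvg0 _ ((1 + m^-1) / 2) _
  (fun n => m^-1 * (1 + 2 / (m - 1)) * err n)).
- by apply/andP; split; [have := mV_gt0; lra|lra].
- by move=> n; apply: Ex_ge0 => om; exact: sqr_ge0.
- by apply: nearW => n; exact: dist_rec.
- by apply: (cvg_congr (cvgM (cvg_cst (m^-1 * (1 + 2 / (m - 1)))) err_cvg0)) => //;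
    rewrite mulr0.
Qed.

(** * The martingale limit *)

Definition gw_lim (om : config R) : R := limn (gw m ^~ om).

Lemma gw_lim_ge0 om : 0 <= gw_lim om.
Proof.
have [cW|dW] := pselect (cvgn (gw m ^~ om)); last by rewrite /gw_lim dvgP.
by apply: limr_ge => //; apply: nearW => n; exact: gw_ge0.
Qed.

Lemma measurable_gw_lim : measurable_fun setT (gw_lim : configs R setT -> R).
Proof. by apply: measurable_limn => n; exact: measurable_gwT. Qed.

Lemma ig_gw_lim : ig gw_lim. Proof. by have [] := gw_cvg. Qed.

Lemma gw_lim_cvg : (fun n => Ex (fun om => `|gw m n om - gw_lim om|)) @ \oo --> (0 : R).
Proof. by have [] := gw_cvg. Qed.

Let cvg_to_gw_lim (F : nat -> config R -> R) (k : nat) :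
  (forall n, measurable_fun setT (F n : configs R setT -> R)) ->
  (forall n, ig (fun om => (F n om - gw m (n + k) om) ^+ 2)) ->
  (fun n => Ex (fun om => (F n om - gw m (n + k) om) ^+ 2)) @ \oo --> (0 : R) ->
  (forall n, ig (fun om => F n om - gw_lim om)) /\
  (fun n => Ex (fun om => `|F n om - gw_lim om|)) @ \oo --> (0 : R).
Proof.
move=> mF i2 E0.
have mD n : measurable_fun setT
    ((fun om => F n om - gw m (n + k) om) : configs R setT -> R).
  by apply: measurable_funB => //; exact: measurable_gwT.
have iD n : ig (fun om => F n om - gw m (n + k) om) by apply: ig_of_sqr.
have h1 := Ex_norm_cvg0_of_sqr mD iD i2 E0.
have h2 : (fun n => Ex (fun om => `|gw m (n + k) om - gw_lim om|)) @ \oo --> (0 : R).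
  by have := gw_lim_cvg; rewrite -(cvg_shiftn k).
have iW n : ig (fun om => gw m n om - gw_lim om).
  by apply: igB; [exact: (ig_gw n).1|exact: ig_gw_lim].
have iF n : ig (fun om => F n om - gw_lim om).
  rewrite (_ : (fun om => _) = fun om =>
    (F n om - gw m (n + k) om) + (gw m (n + k) om - gw_lim om)); first exact: igD.
  by apply/funext => om; rewrite addrA subrK.
split=> //; apply: (@cvg0_le _ _ (fun n => Ex (fun om => `|F n om - gw m (n + k) om|)
   + Ex (fun om => `|gw m (n + k) om - gw_lim om|))).
  apply: nearW => n; rewrite ger0_norm; last by apply: Ex_ge0.
  have i1 := ig_norm (iD n); have i3 := ig_norm (iW (n + k)).
  rewrite -ExD//; apply: Ex_le; [exact: ig_norm|exact: igD|move=> om].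
  exact: ler_distD.
by apply: (cvg_congr (cvgD h1 h2)) => //; rewrite addr0.
Qed.

Lemma con_gw_lim : (forall n, ig (fun om => (cond1 n.+2)^-1 * con n.+2 om - gw_lim om)) /\
  (fun n => Ex (fun om => `|(cond1 n.+2)^-1 * con n.+2 om - gw_lim om|)) @ \oo --> (0 : R).
Proof.
apply: (@cvg_to_gw_lim (fun n om => (cond1 n.+2)^-1 * con n.+2 om) 2).
- by move=> n; apply: measurable_funM => //; exact: measurable_conT.
- by move=> n; rewrite addn2; exact: ig_con_gw.
- by apply: (cvg_congr con_gw_cvg0) => // n; rewrite addn2.
Qed.

(** The one-generation identity read backwards: the distance for a child is [m] times the distance
    for its parent. *)
Let Ex_yv_gw n :
  ig (fun om => ((cond1 n.+3)^-1 * yv n.+3 om - gw m n.+2 om) ^+ 2) /\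
  Ex (fun om => ((cond1 n.+3)^-1 * yv n.+3 om - gw m n.+2 om) ^+ 2) = m * dist n.+1.
Proof.
have [|||||||_ _ _ EC] := @Ex_branch_diff2 (yv n.+3) (gw m n.+2) (cond1 n.+3)^-1 => //.
- exact: measurable_yv.
- exact: measurable_gwT.
- exact: yv_ge0.
- exact: gw_ge0.
- exact: ig_yv2.
- exact: ig_gw2.
- by rewrite -cond1E mulVf ?(ig_gw n.+2).2// gt_eqF// cond1_gt0.
split; last first.
  rewrite (_ : dist n.+1 = m^-1 *
    Ex (fun om => ((cond1 n.+3)^-1 * yv n.+3 om - gw m n.+2 om) ^+ 2)).
    by rewrite mulVKf// gt_eqF.
  by rewrite -EC; apply: Ex_ext => om; rewrite conE.
rewrite (_ : (fun om => _) = fun om => ((cond1 n.+3)^-1 ^+ 2 * yv n.+3 om ^+ 2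
    - 2 * (cond1 n.+3)^-1 * (yv n.+3 om * gw m n.+2 om)) + gw m n.+2 om ^+ 2).
  apply: igD; last exact: ig_gw2.
  apply: igB; first exact/igZ/ig_yv2.
  apply: igZ; apply: ig_mul_of_sqr; [exact: measurable_yv|exact: measurable_gwT|
    exact: ig_yv2|exact: ig_gw2].
by apply/funext => om; ring.
Qed.

Lemma yv_gw_lim : (forall n, ig (fun om => (cond1 n.+3)^-1 * yv n.+3 om - gw_lim om)) /\
  (fun n => Ex (fun om => `|(cond1 n.+3)^-1 * yv n.+3 om - gw_lim om|)) @ \oo --> (0 : R).
Proof.
apply: (@cvg_to_gw_lim (fun n om => (cond1 n.+3)^-1 * yv n.+3 om) 2).
- by move=> n; apply: measurable_funM => //; exact: measurable_yv.
- by move=> n; rewrite addn2; have [] := Ex_yv_gw n.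
- have h : (fun n => dist n.+1) @ \oo --> (0 : R).
    by have := con_gw_cvg0; rewrite -cvg_shiftS.
  apply: (cvg_congr (cvgM (cvg_cst m) h)) => [n|]; last by rewrite mulr0.
  by rewrite addn2 (Ex_yv_gw n).2.
Qed.

(** * Splitting by the number of children *)

Definition single (om : config R) : R := (offspring om == 1)%:R.
Definition several (om : config R) : R := (1 < offspring om)%:R.

Lemma singleD_several om : single om + several om = 1.
Proof.
rewrite /single /several; have := offspring_gt0 om.
by case: (offspring om) => [|[|k]]//= _; rewrite ?addr0 ?add0r.
Qed.

Lemma single01 om : 0 <= single om <= 1.
Proof. by rewrite /single; case: eqP => //= _; rewrite ?lexx ?ler01. Qed.

Lemma several01 om : 0 <= several om <= 1.
Proof. by rewrite /several; case: (1 < _)%N => //=; rewrite ?lexx ?ler01. Qed.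

Lemma measurable_single (J : set vertex_data) : J (inl [::]) ->
  measurable_fun setT (single : configs R J -> R).
Proof.
move=> J0; exact: (@measurableT_comp _ _ _ _ _ _ (fun k : nat => (k == 1)%:R : R)
  _ _ _ (measurable_offspring_root J0)).
Qed.

Lemma measurable_several (J : set vertex_data) : J (inl [::]) ->
  measurable_fun setT (several : configs R J -> R).
Proof.
move=> J0; exact: (@measurableT_comp _ _ _ _ _ _ (fun k : nat => (1 < k)%N%:R : R)
  _ _ _ (measurable_offspring_root J0)).
Qed.

Lemma ig_single : ig single.
Proof.
by apply: ig_le (ig_cst mu 1) _ => [|om]; [exact: measurable_single|exact: single01].
Qed.

Lemma ig_several : ig several.
Proof.
by apply: ig_le (ig_cst mu 1) _ => [|om]; [exact: measurable_several|exact: several01].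
Qed.

Definition p_single : R := Ex single.

Lemma p_single_ge0 : 0 <= p_single.
Proof. by apply: Ex_ge0 => om; have /andP[] := single01 om. Qed.

Lemma Ex_several : Ex several = 1 - p_single.
Proof.
rewrite /p_single -(Ex_cst mu 1) -ExB; [|exact: ig_cst|exact: ig_single].
by apply: Ex_ext => om; rewrite -(singleD_several om) addrC addKr.
Qed.

Let root_measurable_child (F : config R -> R) k :
  measurable_fun setT (F : configs R setT -> R) ->
  measurable_fun setT (F \o shift [:: k] : configs R below_root -> R).
Proof.
move=> mF; apply: (measurable_configsS (J := at_child k)); last exact: measurable_child.
by move=> i; rewrite /at_child /below_root /=; case: (label i).
Qed.

Lemma Ex_single_child (F : config R -> R) :
  measurable_fun setT (F : configs R setT -> R) -> (forall om, 0 <= F om) -> ig F ->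
  ig (fun om => single om * F (shift [:: 0] om)) /\
  Ex (fun om => single om * F (shift [:: 0] om)) = p_single * Ex F.
Proof.
move=> mF F0 iF; have [i <-] := ge0_Ex_shift mu_shift [:: 0] mF F0 iF.
have S0 om : 0 <= single om by case/andP: (single01 om).
exact: (ge0_Ex_prod mu_indep root_below_root (measurable_single erefl)
  (root_measurable_child 0 mF) S0 (fun om => F0 _) ig_single i).
Qed.

Lemma Ex_two_children (F G : config R -> R) :
  measurable_fun setT (F : configs R setT -> R) ->
  measurable_fun setT (G : configs R setT -> R) ->
  (forall om, 0 <= F om) -> (forall om, 0 <= G om) -> ig F -> ig G ->
  ig (fun om => F (shift [:: 0] om) * G (shift [:: 1] om)) /\
  Ex (fun om => F (shift [:: 0] om) * G (shift [:: 1] om)) = Ex F * Ex G.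
Proof.
move=> mF mG F0 G0 iF iG.
have [iF0 <-] := ge0_Ex_shift mu_shift [:: 0] mF F0 iF.
have [iG1 <-] := ge0_Ex_shift mu_shift [:: 1] mG G0 iG.
have JK : at_child 0 `&` at_child 1 = set0.
  rewrite -subset0 /at_child => i [] /=.
  by case: (label i) => // a u /eqP ->.
exact: (ge0_Ex_prod mu_indep JK (@measurable_child _ F 0 mF) (@measurable_child _ G 1 mG)
  (fun om => F0 _) (fun om => G0 _) iF0 iG1).
Qed.

Lemma Ex_several_children (F G : config R -> R) :
  measurable_fun setT (F : configs R setT -> R) ->
  measurable_fun setT (G : configs R setT -> R) ->
  (forall om, 0 <= F om) -> (forall om, 0 <= G om) -> ig F -> ig G ->
  ig (fun om => several om * (F (shift [:: 0] om) * G (shift [:: 1] om))) /\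
  Ex (fun om => several om * (F (shift [:: 0] om) * G (shift [:: 1] om))) =
    (1 - p_single) * (Ex F * Ex G).
Proof.
move=> mF mG F0 G0 iF iG.
have [iFG EFG] := Ex_two_children mF mG F0 G0 iF iG.
rewrite -EFG -Ex_several.
have S0 om : 0 <= several om by case/andP: (several01 om).
have mFG : measurable_fun setT
    ((fun om => F (shift [:: 0] om) * G (shift [:: 1] om)) : configs R below_root -> R).
  by apply: measurable_funM; exact: root_measurable_child.
exact: (ge0_Ex_prod mu_indep root_below_root (measurable_several erefl) mFG S0
  (fun om => mulr_ge0 (F0 _) (G0 _)) ig_several iFG).
Qed.

Lemma child_sum_single (F : config R -> R) om : offspring om = 1%N ->
  child_sum F (offspring om) om = F (shift [:: 0] om).
Proof. by move=> ->; rewrite /child_sum big_ord_recl big_ord0 addr0. Qed.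

Lemma child_sum_several (F : config R -> R) om : (forall om, 0 <= F om) ->
  (1 < offspring om)%N ->
  F (shift [:: 0] om) + F (shift [:: 1] om) <= child_sum F (offspring om) om.
Proof.
move=> F0; case: (offspring om) => [|[|k]]// _.
by rewrite /child_sum !big_ord_recl addrA lerDl sumr_ge0.
Qed.

Definition lap l := Ex (phi l \o gw_lim).
(** Increases to E[1 / W] as [k] decreases to [0], once W is known to be positive. *)
Definition tru k := Ex (psi k \o gw_lim).

Let mphi_lim l : measurable_fun setT (phi l \o gw_lim : configs R setT -> R).
Proof. exact: measurable_phi measurable_gw_lim. Qed.

Let ig_phi (F : config R -> R) l : measurable_fun setT (F : configs R setT -> R) ->
  (forall om, 0 <= F om) -> 0 <= l -> ig (phi l \o F).
Proof.
move=> mF F0 l0; apply: ig_le (ig_cst mu 1) _ => [|om].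
  exact: measurable_phi.
by rewrite phi_ge0/= phi_le1.
Qed.

Let ig_psi (F : config R -> R) k : measurable_fun setT (F : configs R setT -> R) ->
  0 < k -> ig (psi k \o F).
Proof.
move=> mF k_gt0; apply: ig_le (ig_cst mu k^-1) _ => [|om].
  exact: measurable_psi.
by rewrite psi_ge0//= psi_le.
Qed.

Lemma lap_ge0 l : 0 <= lap l. Proof. by apply: Ex_ge0 => om; exact: phi_ge0. Qed.

Lemma lap_anti l l' : 0 <= l -> l <= l' -> lap l' <= lap l.
Proof.
move=> l0 ll; apply: Ex_le.
- by apply: ig_phi; [exact: measurable_gw_lim|exact: gw_lim_ge0|exact: (le_trans l0 ll)].
- by apply: ig_phi; [exact: measurable_gw_lim|exact: gw_lim_ge0|].
- by move=> om; apply: phi_antil => //; exact: gw_lim_ge0.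
Qed.

Let ig_gwB n : ig (fun om => gw m n om - gw_lim om).
Proof. by apply: igB; [exact: (ig_gw n).1|exact: ig_gw_lim]. Qed.

Lemma phi_lim_cvg (Z : nat -> config R -> R) l : 0 <= l ->
  (forall n, measurable_fun setT (Z n : configs R setT -> R)) ->
  (forall n om, 0 <= Z n om) -> (forall n, ig (fun om => Z n om - gw_lim om)) ->
  (fun n => Ex (fun om => `|Z n om - gw_lim om|)) @ \oo --> (0 : R) ->
  (fun n => Ex (phi l \o Z n)) @ \oo --> lap l.
Proof.
move=> l0 mZ Z0 iZ hZ.
have H : (fun n => Ex (fun om => 1 * phi l (Z n om))) @ \oo -->
    Ex (fun om => 1 * phi l (gw_lim om)).
  apply: (@Ex_lipschitz_cvg _ _ _ mu (fun=> 1) Z gw_lim (phi l) l 1) => //.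
  - by move=> _; rewrite ler01 lexx.
  - by move=> n; exact: measurable_phi.
  - by move=> n om; exact: phi_norm_le1.
  - by move=> om; apply: phi_norm_le1 => //; exact: gw_lim_ge0.
  - by move=> a b; exact: phi_lip.
apply: (cvg_congr H) => [n|]; by apply: Ex_ext => om; rewrite mul1r.
Qed.

Lemma psi_lim_cvg (I : config R -> R) (Z : nat -> config R -> R) k : 0 < k ->
  measurable_fun setT (I : configs R setT -> R) -> (forall om, 0 <= I om <= 1) ->
  (forall n, measurable_fun setT (Z n : configs R setT -> R)) ->
  (forall n, ig (fun om => Z n om - gw_lim om)) ->
  (fun n => Ex (fun om => `|Z n om - gw_lim om|)) @ \oo --> (0 : R) ->
  (fun n => Ex (fun om => I om * psi k (Z n om))) @ \oo -->
  Ex (fun om => I om * psi k (gw_lim om)).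
Proof.
move=> k_gt0 mI I01 mZ iZ hZ.
apply: (@Ex_lipschitz_cvg _ _ _ mu I Z gw_lim (psi k) (k ^- 2) k^-1) => //.
- by move=> n; exact: measurable_psi.
- exact: measurable_psi measurable_gw_lim.
- by move=> n om; exact: psi_norm_le.
- by move=> om; exact: psi_norm_le.
- by move=> a b; exact: psi_lip.
Qed.

Lemma lap_gw_cvg l : 0 <= l -> (fun n => Ex (phi l \o gw m n)) @ \oo --> lap l.
Proof.
move=> l0; apply: phi_lim_cvg => //.
- by move=> n; exact: measurable_gwT.
- by move=> n om; exact: gw_ge0.
- exact: gw_lim_cvg.
Qed.

(** With at least two children only the first two are kept: [phi] decreases and is
    submultiplicative, and the two subtrees are independent. *)
Let lap_gwS l n : 0 <= l -> Ex (phi l \o gw m n.+1) <=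
  p_single * Ex (phi (l / m) \o gw m n) + (1 - p_single) * Ex (phi (l / m) \o gw m n) ^+ 2.
Proof.
move=> l0; have lm0 : 0 <= l / m by rewrite divr_ge0// ltW.
pose F := phi (l / m) \o gw m n.
have mF : measurable_fun setT (F : configs R setT -> R).
  by apply: measurable_phi; exact: measurable_gwT.
have F0 om : 0 <= F om by exact: phi_ge0.
have iF : ig F by apply: ig_phi => //; [exact: measurable_gwT|exact: gw_ge0].
have [i1 E1] := Ex_single_child mF F0 iF.
have [i2 E2] := Ex_several_children mF mF F0 F0 iF iF.
rewrite -/F expr2 -E1 -E2 -ExD//; apply: Ex_le.
- by apply: ig_phi => //; [exact: measurable_gwT|exact: gw_ge0].
- exact: igD.
move=> om; rewrite [leLHS]/= phi_mulr.
have /andP[h1 h2] := several01 om.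
rewrite /single /several; have [e1|e1] := eqVneq (offspring om) 1%N.
  by rewrite child_sum_single// e1 ltnn mul0r addr0 mul1r.
have o2 : (1 < offspring om)%N by rewrite ltn_neqAle eq_sym e1 offspring_gt0.
rewrite o2 mul0r add0r mul1r.
apply: le_trans (phi_add_le lm0 (gw_ge0 m_gt0 n _) (gw_ge0 m_gt0 n _)).
by apply: phi_anti => //; apply: child_sum_several => // om'; exact: gw_ge0.
Qed.

Lemma lap_le l : 0 <= l -> lap l <= p_single * lap (l / m) + (1 - p_single) * lap (l / m) ^+ 2.
Proof.
move=> l0; have lm0 : 0 <= l / m by rewrite divr_ge0// ltW.
have h1 := lap_gw_cvg l0; have h2 := lap_gw_cvg lm0.
have h1' : (fun n => Ex (phi l \o gw m n.+1)) @ \oo --> lap l.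
  by move: h1; rewrite -cvg_shiftS.
have h3 : (fun n => p_single * Ex (phi (l / m) \o gw m n)
    + (1 - p_single) * Ex (phi (l / m) \o gw m n) ^+ 2) @ \oo -->
    p_single * lap (l / m) + (1 - p_single) * lap (l / m) ^+ 2.
  apply: (cvg_congr (cvgD (cvgM (cvg_cst p_single) h2)
    (cvgM (cvg_cst (1 - p_single)) (cvgM h2 h2)))) => //.
by apply: (ler_cvg_to h1' h3); apply: nearW => n; exact: lap_gwS.
Qed.

(** W is not almost surely zero. This is a second moment argument: [gw] has mean one, and its second
    moment stays bounded because it is close in L^2 to the normalised conductance. *)
Lemma lap_lt1 : exists2 l, 0 < l & lap l < 1.
Proof.
have [M hM] := cond2_bounded; have d0 := con_gw_cvg0.
(* From b^2 <= 2 (a - b)^2 + 2 a^2, with [dist n] at most 1 and the normalised second moment of the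
   conductance at most |M|. *)
pose s := 2 * (1 + `|M|).
have s0 : 0 < s by rewrite mulr_gt0// ltr_pwDl.
have near_s : \forall n \near \oo, Ex (fun om => gw m n.+2 om ^+ 2) <= s.
  near=> n.
  have dn : dist n <= 1.
    have : `|dist n| <= 1 by near: n; exact: (cvgr0_norm_le _ d0 _ ltr01).
    by apply: le_trans; exact: ler_norm.
  have qn : cond2 n.+2 / cond1 n.+2 ^+ 2 <= `|M|.
    by rewrite (le_trans _ (ler_norm M))//; near: n.
  have i1 := igZ 2 (ig_con_gw n.+1 (cond1 n.+2)^-1).
  have i2 := igZ (2 * (cond1 n.+2)^-1 ^+ 2) (ig_con2 n.+1).
  have := Ex_le (ig_gw2 n.+2) (igD i1 i2) _.
  have h (a b : R) : b ^+ 2 <= 2 * (a - b) ^+ 2 + 2 * a ^+ 2.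
    by have := sqr_ge0 (2 * a - b); nra.
  move=> /(_ _)/le_trans; apply.
    by move=> om; rewrite -mulrA -exprMn; exact: h.
  rewrite ExD// !ExZ; [|exact: ig_con2|exact: ig_con_gw].
  have E2 : 2 * (cond1 n.+2)^-1 ^+ 2 * cond2 n.+2 = 2 * (cond2 n.+2 / cond1 n.+2 ^+ 2).
    by rewrite exprVn -mulrA [X in _ * X]mulrC.
  by rewrite -/(cond2 n.+2) E2 -/(dist n) /s; lra.
(* Small enough for the quadratic term l^2 s / 4 to be at most l / 4. *)
pose l := (s + 1)^-1; have l0 : 0 < l by rewrite invr_gt0; lra.
have ls : l * s <= 1 by rewrite /l mulrC ler_pdivrMr; lra.
exists l => //; apply: (@le_lt_trans _ _ (1 - l + l / 4)); last by lra.
have h2 : (fun n => Ex (phi l \o gw m n.+2)) @ \oo --> lap l.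
  by have := lap_gw_cvg (ltW l0); rewrite -cvg_shiftS -cvg_shiftS.
apply: (cvgr_to_le h2); apply: filterS near_s => n hs.
have i1 := igZ l (ig_gw n.+2).1; have i2 := igZ (l ^+ 2 / 4) (ig_gw2 n.+2).
have ic := ig_cst mu 1.
apply: (@le_trans _ _ (Ex (fun om => (1 - l * gw m n.+2 om) + l ^+ 2 / 4 * gw m n.+2 om ^+ 2))).
  apply: Ex_le.
  - by apply: ig_phi; [exact: measurable_gwT|exact: gw_ge0|exact: ltW].
  - by apply: igD => //; exact: igB.
  - move=> om; apply: (le_trans (phi_le_sqr _ _)).
    by rewrite exprMn mulrAC.
rewrite ExD//; last exact: igB.
have [iW EW] := ig_gw n.+2; have iW2 := ig_gw2 n.+2.
rewrite ExB// Ex_cst (ExZ l iW) (ExZ (l ^+ 2 / 4) iW2) EW mulr1 lerD2l.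
have h : l ^+ 2 / 4 * Ex (fun om => gw m n.+2 om ^+ 2) <= l ^+ 2 / 4 * s.
  by rewrite ler_wpM2l// divr_ge0// sqr_ge0.
have l1 := ler_wpM2l (ltW l0) ls; lra.
Unshelve. all: by end_near. Qed.

(* The survival argument: [lap l] tends to [P (W = 0)] as [l] grows, and the
   branching inequality makes it decay geometrically along [l * m ^ j]. *)
Lemma lap_cvg0 e : p_single < 1 -> 0 < e -> exists2 l, 0 < l & lap l <= e.
Proof.
move=> p1 e0; have [l l0 ll] := lap_lt1.
pose rho := p_single + (1 - p_single) * lap l.
have p0 := p_single_ge0; have L0 := lap_ge0 l.
have rho0 : 0 <= rho by rewrite addr_ge0// mulr_ge0// subr_ge0 ltW.
have rho1 : rho < 1 by rewrite /rho; nra.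
have lm j : 0 < l * m ^+ j by rewrite mulr_gt0// exprn_gt0.
have h j : lap (l * m ^+ j) <= rho ^+ j.
  elim: j => [|j IHj]; first by rewrite expr0 mulr1 ltW.
  apply: (le_trans (lap_le (ltW (lm j.+1)))).
  rewrite exprSr mulrA mulfK ?gt_eqF//.
  have L1 : lap (l * m ^+ j) <= lap l.
    apply: lap_anti; first exact: ltW.
    by rewrite ler_peMr ?(ltW l0)// exprn_ege1// ltW.
  have L2 := lap_ge0 (l * m ^+ j).
  have : lap (l * m ^+ j) * rho <= rho ^+ j * rho by rewrite ler_wpM2r.
  rewrite -exprSr /rho => h; apply: le_trans h.
  by rewrite -subr_ge0; set x := lap (_ * _) in L1 L2 *;
    rewrite (_ : _ - _ = (1 - p_single) * x * (lap l - x)); [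
      rewrite !mulr_ge0 ?subr_ge0// ltW|ring].
have hr : (fun j => 1 * rho ^+ j) @ \oo --> (0 : R).
  by apply: cvg_geometric; rewrite ger0_norm.
have [N _ HN] := cvgr0_norm_le _ hr _ e0.
exists (l * m ^+ N) => //; apply: (le_trans (h N)).
by have := HN N (leqnn N); rewrite mul1r; apply: le_trans; exact: ler_norm.
Qed.

(** * The expected resistance *)

Definition res n : R := Ex (fun om => (con n om)^-1).

(** All children but the first are discarded. *)
Lemma child_le_con n om : m^-1 * yv n (shift [:: 0] om) <= con n om.
Proof.
rewrite conE ler_pM2l//; have := offspring_gt0 om.
case: (offspring om) => [//|k] _; rewrite /child_sum big_ord_recl lerDl.
by apply: sumr_ge0 => i _; exact: yv_ge0.
Qed.

Lemma measurable_yvV n :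
  measurable_fun setT ((fun om => (yv n om)^-1) : configs R setT -> R).
Proof. by apply: measurable_inv_gt0; [exact: measurable_yv|move=> om; exact: yv_gt0]. Qed.

Lemma measurable_conV n :
  measurable_fun setT ((fun om => (con n om)^-1) : configs R setT -> R).
Proof. by apply: measurable_inv_gt0; [exact: measurable_conT|move=> om; exact: con_gt0]. Qed.

Lemma yvV_ge0 n om : 0 <= (yv n om)^-1.
Proof. by rewrite invr_ge0 yv_ge0. Qed.

Lemma conV_ge0 n om : 0 <= (con n om)^-1.
Proof. by rewrite invr_ge0 con_ge0. Qed.

Lemma conV_le n om : (con n om)^-1 <= m * (yv n (shift [:: 0] om))^-1.
Proof.
have y0 := yv_gt0 m_gt0 n (shift [:: 0] om); have c0 := con_gt0 m_gt0 n om.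
have -> : m * (yv n (shift [:: 0] om))^-1 = (m^-1 * yv n (shift [:: 0] om))^-1.
  by rewrite invfM invrK.
by rewrite lef_pV2 ?posrE ?mulr_gt0//; exact: child_le_con.
Qed.

(** Following the first child at every generation bounds the resistance by that of a single path, a
    finite combination of weights with finite mean. *)
Lemma ig_yvV n : ig (fun om => (yv n om)^-1).
Proof.
elim: n => [|n IHn].
  rewrite (_ : (fun om => _) = @weight R); first exact: ig_weight.
  by apply/funext => om; rewrite /yv invrK.
rewrite (_ : (fun om => _) = fun om => weight om + (con n om)^-1); last first.
  by apply/funext => om; rewrite invr_yvS.
apply: igD; first exact: ig_weight.
have [i _] := ge0_Ex_shift mu_shift [:: 0] (measurable_yvV n) (yvV_ge0 n) IHn.
apply: ig_le (igZ m i) _ => [|om]; first exact: measurable_conV.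
by rewrite conV_ge0; exact: conV_le.
Qed.

Lemma ig_conV n : ig (fun om => (con n om)^-1).
Proof.
have [i _] := ge0_Ex_shift mu_shift [:: 0] (measurable_yvV n) (yvV_ge0 n) (ig_yvV n).
apply: ig_le (igZ m i) _ => [|om]; first exact: measurable_conV.
by rewrite conV_ge0; exact: conV_le.
Qed.

Lemma Ex_yvV n : Ex (fun om => (yv n.+1 om)^-1) = Ex (@weight R) + res n.
Proof.
rewrite -ExD; [|exact: ig_weight|exact: ig_conV].
by apply: Ex_ext => om; rewrite invr_yvS.
Qed.

Lemma res_ge0 n : 0 <= res n. Proof. by apply: Ex_ge0 => om; exact: conV_ge0. Qed.

(* With at least two children, a large resistance forces the second child to
   have small conductance. *)
Lemma conV_split n om K : 0 < K -> (con n om)^-1 <=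
  (m * (single om * (yv n (shift [:: 0] om))^-1)
   + several om * psi (m * K)^-1 (con n om))
  + 2 * m * ((yv n (shift [:: 0] om))^-1 * phi (K / 2) (yv n (shift [:: 1] om))).
Proof.
move=> K0; have c0 := con_gt0 m_gt0 n om.
have y0 := yv_gt0 m_gt0 n (shift [:: 0] om); have y1 := yv_gt0 m_gt0 n (shift [:: 1] om).
have mK : 0 < (m * K)^-1 by rewrite invr_gt0 mulr_gt0.
have t3 : 0 <= 2 * m * ((yv n (shift [:: 0] om))^-1 * phi (K / 2) (yv n (shift [:: 1] om))).
  by rewrite !mulr_ge0 ?phi_ge0 ?invr_ge0 ?(ltW y0) ?(ltW m_gt0).
rewrite /single /several; have [e1|e1] := eqVneq (offspring om) 1%N.
  rewrite e1 ltnn mul0r addr0 mul1r ler_wpDr//.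
  by rewrite conE child_sum_single// invfM invrK.
have e2 : (1 < offspring om)%N by rewrite ltn_neqAle eq_sym e1 offspring_gt0.
rewrite e2 mul0r mulr0 add0r mul1r.
have [cK|cK] := leP (m * K)^-1 (con n om).
  by rewrite {1}/psi max_l// lerDl.
have ys : yv n (shift [:: 0] om) + yv n (shift [:: 1] om) <= m * con n om.
  rewrite conE mulVKf ?gt_eqF//; apply: child_sum_several => // om'; exact: yv_ge0.
have mc : m * con n om < K^-1.
  by move: cK; rewrite invfM -(ltr_pM2l m_gt0) mulrA mulfV ?gt_eqF// mul1r.
(* Once the truncation is active the two children together conduct less than [K^-1], so [phi] is at
   least one half; the factor [2] in the statement compensates. *)
have hphi : 1 / 2 <= phi (K / 2) (yv n (shift [:: 1] om)).
  have yK : yv n (shift [:: 1] om) < K^-1 by lra.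
  have : K * yv n (shift [:: 1] om) < 1.
    by rewrite -(mulfV (lt0r_neq0 K0)) ltr_pM2l.
  by rewrite /phi le_max => h; apply/orP; right; lra.
apply: (le_trans (conV_le n om)); apply: ler_wpDl; first exact: psi_ge0.
have my : 0 <= m * (yv n (shift [:: 0] om))^-1 by rewrite mulr_ge0 ?invr_ge0// ltW.
rewrite (_ : 2 * m * _ = m * (yv n (shift [:: 0] om))^-1 *
    (2 * phi (K / 2) (yv n (shift [:: 1] om)))); last by ring.
by rewrite ler_peMr//; lra.
Qed.

Lemma res_le n K : 0 < K -> res n.+1 <=
  p_single * m * (Ex (@weight R) + res n)
  + Ex (fun om => several om * psi (m * K)^-1 (con n.+1 om))
  + 2 * m * ((Ex (@weight R) + res n) * Ex (phi (K / 2) \o yv n.+1)).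
Proof.
move=> K0; have mK : 0 < (m * K)^-1 by rewrite invr_gt0 mulr_gt0.
have my := measurable_yvV n.+1; have i := ig_yvV n.+1.
have K2 : 0 <= K / 2 by rewrite divr_ge0// ltW.
have iphi : ig (phi (K / 2) \o yv n.+1).
  by apply: ig_phi => //; [exact: measurable_yv|exact: yv_ge0].
have [i1 E1] := Ex_single_child my (yvV_ge0 n.+1) i.
have [i2 E2] := Ex_two_children my (measurable_phi (K / 2) (measurable_yv m_gt0 n.+1))
  (yvV_ge0 n.+1) (fun om => phi_ge0 _ _) i iphi.
have i3 : ig (fun om => several om * psi (m * K)^-1 (con n.+1 om)).
  apply: ig_le (ig_psi (measurable_conT m_gt0 n.+1) mK) _ => [|om].
    apply: measurable_funM; first exact: measurable_several.
    exact: measurable_psi (measurable_conT _ _).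
  have /andP[s0 s1] := several01 om.
  by rewrite mulr_ge0 ?psi_ge0//= ler_piMl// psi_ge0.
have j1 := igZ m i1; have j2 := igZ (2 * m) i2.
rewrite -!Ex_yvV -E2 -(ExZ (2 * m) i2) (mulrC p_single) -mulrA -E1 -(ExZ m i1).
rewrite -ExD// -ExD//; last exact: igD.
apply: Ex_le; [exact: ig_conV|by apply: igD => //; exact: igD|].
by move=> om; exact: conV_split.
Qed.

(** On {nu = 1} one has W = W' / m, with W' the limit for the only child, and [psi] is homogeneous
    of degree -1. The identity is proved for [gw] and passed to the limit. *)
Lemma tru_split k : 0 < k ->
  Ex (fun om => several om * psi k (gw_lim om)) = tru k - p_single * m * tru (k * m).
Proof.
move=> k_gt0; have km : 0 < k * m by rewrite mulr_gt0.
have ms : measurable_fun setT (single : configs R setT -> R) by exact: measurable_single.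
have mS : measurable_fun setT (several : configs R setT -> R) by exact: measurable_several.
have h1 : (fun n => Ex (fun om => single om * psi k (gw m n.+1 om))) @ \oo -->
    Ex (fun om => single om * psi k (gw_lim om)).
  have := psi_lim_cvg k_gt0 ms single01 measurable_gwT ig_gwB gw_lim_cvg.
  by rewrite -cvg_shiftS.
have h2 : (fun n => Ex (fun om => 1 * psi (k * m) (gw m n om))) @ \oo -->
    Ex (fun om => 1 * psi (k * m) (gw_lim om)).
  apply: psi_lim_cvg => //; [by move=> om; rewrite ler01 lexx|exact: measurable_gwT|].
  exact: gw_lim_cvg.
have E n : Ex (fun om => single om * psi k (gw m n.+1 om)) =
    p_single * m * Ex (fun om => 1 * psi (k * m) (gw m n om)).
  have [i1 E1] := Ex_single_child
    (measurable_psi km (measurable_gwT n)) (fun om => psi_ge0 _ km)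
    (ig_psi (measurable_gwT n) km).
  rewrite (mulrC p_single) -mulrA.
  rewrite (_ : Ex (fun om => 1 * psi (k * m) (gw m n om)) = Ex (psi (k * m) \o gw m n)).
    rewrite -E1 -(ExZ m i1); apply: Ex_ext => om.
    rewrite /single; have [e1|e1] := eqVneq (offspring om) 1%N; last by rewrite !mul0r mulr0.
    rewrite [gw _ _ _]/= child_sum_single//= !mul1r.
    by rewrite -[in LHS](mulKf (lt0r_neq0 m_gt0) k) [m * k]mulrC psi_mulr ?invr_gt0// invrK.
  by apply: Ex_ext => om; rewrite mul1r.
have h3 : (fun n => p_single * m * Ex (fun om => 1 * psi (k * m) (gw m n om))) @ \oo -->
    p_single * m * tru (k * m).
  apply: (cvg_congr (cvgM (cvg_cst (p_single * m)) h2)) => //.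
  by congr (_ * _); apply: Ex_ext => om; rewrite mul1r.
have E1 : Ex (fun om => single om * psi k (gw_lim om)) = p_single * m * tru (k * m).
  apply: (@cvg_unique _ (@norm_hausdorff R R) _ _ _ _ h1).
  by apply: (cvg_congr h3) => // n; rewrite E.
have iI (I : config R -> R) : measurable_fun setT (I : configs R setT -> R) ->
    (forall om, 0 <= I om <= 1) -> ig (fun om => I om * psi k (gw_lim om)).
  move=> mI I01; apply: ig_le (ig_psi measurable_gw_lim k_gt0) _ => [|om].
    by apply: measurable_funM => //; exact: measurable_psi measurable_gw_lim.
  have /andP[s0 s1] := I01 om.
  by rewrite mulr_ge0 ?psi_ge0//= ler_piMl// psi_ge0.
rewrite -E1 /tru -ExB; [|exact: ig_psi measurable_gw_lim _|exact: iI ms single01].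
apply: Ex_ext => om /=.
have -> : several om = 1 - single om.
  by rewrite -(singleD_several om) addrAC subrr add0r.
by rewrite mulrBl mul1r.
Qed.

(** The normalised mean resistance E[x_n / C_n], which has to be shown to converge to E[1 / W]. *)
Let z n := cond1 n.+2 * res n.+2.

Let z_ge0 n : 0 <= z n. Proof. by rewrite mulr_ge0 ?res_ge0// ltW// cond1_gt0. Qed.

Let fK K n := Ex (phi (K / 2) \o (fun om => (cond1 n.+3)^-1 * yv n.+3 om)).
Let gK K n := Ex (fun om => several om * psi (m * K)^-1 ((cond1 n.+3)^-1 * con n.+3 om)).

Let x2S_le' n : x2 n.+1 <= x2 n. Proof. exact: rec_le k0_gt0 x2_gt0 x2S_le n. Qed.

(** [res_le] at level [K / cond1 n.+3]: the truncation level is scaled with the conductance so that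
    [fK] and [gK] have limits. *)
Lemma z_rec K n : 0 < K -> z n.+1 <=
  (p_single * m + 2 * m * fK K n) * (z n + cond1 n.+3 * Ex (@weight R)) + gK K n.
Proof.
move=> K0; set X := cond1 n.+3; have X0 : 0 < X := cond1_gt0 n.+3.
have h := res_le n.+2 (divr_gt0 K0 X0).
have eg : X * Ex (fun om => several om * psi (m * (K / X))^-1 (con n.+3 om)) = gK K n.
  rewrite /gK -/X -ExZ.
    apply: Ex_ext => om; rewrite mulrCA; congr (_ * _).
    have -> : (m * K)^-1 = X^-1 * (m * (K / X))^-1.
      by field; rewrite !gt_eqF.
    by rewrite psi_mulr ?invr_gt0// invrK.
  have mK : 0 < (m * (K / X))^-1 by rewrite invr_gt0 mulr_gt0// divr_gt0.
  apply: ig_le (ig_psi (measurable_conT m_gt0 n.+3) mK) _ => [|om].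
    apply: measurable_funM; first exact: measurable_several.
    exact: measurable_psi (measurable_conT _ _).
  have /andP[s0 s1] := several01 om.
  by rewrite mulr_ge0 ?psi_ge0//= ler_piMl// psi_ge0.
have ef : Ex (phi (K / X / 2) \o yv n.+3) = fK K n.
  apply: Ex_ext => om; rewrite /= [RHS]phi_mulr; congr (phi _ _).
  by rewrite mulrAC.
move: h; rewrite ef => /(ler_wpM2l (ltW X0)); rewrite -/(z n.+1).
set G := Ex (fun om => several om * _) in eg *.
set a := Ex (@weight R); set r := res n.+2; rewrite -eg.
have f0 : 0 <= fK K n by apply: Ex_ge0 => om; exact: phi_ge0.
have th0 : 0 <= p_single * m + 2 * m * fK K n.
  by rewrite addr_ge0 ?mulr_ge0// ?p_single_ge0 ?(ltW m_gt0).
have hz : X * (a + r) <= z n + X * a.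
  by rewrite mulrDr addrC lerD2r ler_wpM2r ?res_ge0//; exact: x2S_le'.
have := ler_wpM2l th0 hz; set f := fK K n => h1 h2.
rewrite (le_trans h2)//.
have -> : X * (p_single * m * (a + r) + G + 2 * m * ((a + r) * f)) =
  (p_single * m + 2 * m * f) * (X * (a + r)) + X * G by ring.
by rewrite lerD2r.
Qed.

Let fK_cvg K : 0 < K -> fK K @ \oo --> lap (K / 2).
Proof.
move=> K0; have [iZ hZ] := yv_gw_lim; apply: phi_lim_cvg => //.
- by rewrite divr_ge0// ltW.
- by move=> n; apply: measurable_funM => //; exact: measurable_yv.
- by move=> n om; rewrite mulr_ge0 ?yv_ge0// invr_ge0 ltW// cond1_gt0.
Qed.

Let gK_cvg K : 0 < K -> gK K @ \oo --> tru (m * K)^-1 - p_single * m * tru K^-1.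
Proof.
move=> K0; have mK : 0 < (m * K)^-1 by rewrite invr_gt0 mulr_gt0.
have mS : measurable_fun setT (several : configs R setT -> R) by exact: measurable_several.
have [iZ hZ] := con_gw_lim.
have := @psi_lim_cvg several (fun n om => (cond1 n.+2)^-1 * con n.+2 om) _ mK mS
  several01 _ iZ hZ.
rewrite tru_split// -cvg_shiftS; rewrite (_ : (m * K)^-1 * m = K^-1); last first.
  by rewrite invfM mulrAC mulVf ?mul1r// gt_eqF.
apply=> n; apply: measurable_funM => //; exact: measurable_conT.
Qed.

Let x3_cvg0 : (fun n => cond1 n.+3) @ \oo --> (0 : R).
Proof. by have := cond1_cvg0; rewrite -cvg_shiftS -cvg_shiftS -cvg_shiftS. Qed.

Let tru_anti k k' : 0 < k -> k <= k' -> tru k' <= tru k.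
Proof.
move=> kk kk'; have k'0 := lt_le_trans kk kk'.
apply: Ex_le; [exact: ig_psi measurable_gw_lim _|exact: ig_psi measurable_gw_lim _|].
by move=> om; exact: psi_anti.
Qed.

(** The lower half of the convergence: [psi] is below the inverse, and its mean along the normalised
    conductances tends to [tru k]. *)
Let tru_le_z k e : 0 < k -> 0 < e -> \forall n \near \oo, tru k - e <= z n.
Proof.
move=> k_gt0 e0; have [iZ hZ] := con_gw_lim.
have mZ n : measurable_fun setT
    ((fun om => (cond1 n.+2)^-1 * con n.+2 om) : configs R setT -> R).
  by apply: measurable_funM => //; exact: measurable_conT.
have I01 (om : config R) : 0 <= (1 : R) <= 1 by rewrite ler01 lexx.
have h := @psi_lim_cvg (fun=> 1) (fun n om => (cond1 n.+2)^-1 * con n.+2 om) _ k_gt0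
  (measurable_cst _) I01 mZ iZ hZ.
have {}h : (fun n => Ex (psi k \o (fun om => (cond1 n.+2)^-1 * con n.+2 om))) @ \oo --> tru k.
  by apply: (cvg_congr h) => [n|]; apply: Ex_ext => om; rewrite mul1r.
have lt : tru k - e < tru k by rewrite ltrBlDr ltrDl.
apply: filterS (cvgr_gt _ h _ lt) => n /ltW /le_trans; apply.
rewrite /z -ExZ; last exact: ig_conV.
apply: Ex_le; [exact: ig_psi|by apply: igZ; exact: ig_conV|move=> om /=].
have x0 := cond1_gt0 n.+2; have c0 := con_gt0 m_gt0 n.+2 om.
apply: (le_trans (psi_le_inv k_gt0 _)); first by rewrite mulr_gt0 ?invr_gt0.
by rewrite invfM invrK.
Qed.

Hypothesis p_single_lt : p_single * m < 1.

Let pm0 : 0 <= p_single * m. Proof. by rewrite mulr_ge0 ?p_single_ge0// ltW. Qed.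

Lemma p_single_lt1 : p_single < 1.
Proof.
apply: le_lt_trans p_single_lt; rewrite ler_peMr ?p_single_ge0//; exact: ltW.
Qed.

Let z_bounded : exists M, \forall n \near \oo, z n <= M.
Proof.
(* This makes [2 * m * lap l] at most (1 - p_1 m) / 2, so the coefficient of [z] has a limit of at
   most (1 + p_1 m) / 2, below the factor [th] chosen next. *)
have e0 : 0 < (1 - p_single * m) / (4 * m) by rewrite divr_gt0 ?subr_gt0// mulr_gt0.
have [l l0 hl] := lap_cvg0 p_single_lt1 e0.
pose K := 2 * l; have K0 : 0 < K by rewrite mulr_gt0.
have K2 : K / 2 = l by rewrite /K; field.
pose th := (3 + p_single * m) / 4.
have th01 : 0 <= th < 1 by apply/andP; split; rewrite /th; have := pm0; have := p_single_lt; lra.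
have hf := fK_cvg K0; rewrite K2 in hf.
have hth : \forall n \near \oo, p_single * m + 2 * m * fK K n <= th.
  have hc : (fun n => p_single * m + 2 * m * fK K n) @ \oo --> p_single * m + 2 * m * lap l.
    exact: (cvgD (cvg_cst _) (cvgM (cvg_cst _) hf)).
  have lt : p_single * m + 2 * m * lap l < th.
    have h2 : 2 * m * lap l <= 2 * m * ((1 - p_single * m) / (4 * m)).
      by rewrite ler_wpM2l// mulr_ge0// ltW.
    have e2 : 2 * m * ((1 - p_single * m) / (4 * m)) = (1 - p_single * m) / 2.
      by field; rewrite gt_eqF.
    by rewrite /th; have := p_single_lt; lra.
  by apply: filterS (cvgr_lt _ hc _ lt) => n /ltW.
have hx : \forall n \near \oo, cond1 n.+3 * Ex (@weight R) <= 1.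
  have hc : (fun n => cond1 n.+3 * Ex (@weight R)) @ \oo --> (0 : R).
    by apply: (cvg_congr (cvgM x3_cvg0 (cvg_cst (Ex (@weight R))))) => //; rewrite mul0r.
  by apply: filterS (cvgr_lt _ hc _ ltr01) => n /ltW.
have [G hG] : exists G, \forall n \near \oo, gK K n <= G.
  exists (tru (m * K)^-1 - p_single * m * tru K^-1 + 1).
  have lt : tru (m * K)^-1 - p_single * m * tru K^-1
      < tru (m * K)^-1 - p_single * m * tru K^-1 + 1 by rewrite ltrDl.
  by apply: filterS (cvgr_lt _ (gK_cvg K0) _ lt) => n /ltW.
apply: (@contraction_bounded _ th z (th + G)) => //.
near=> n.
have h1 : p_single * m + 2 * m * fK K n <= th by near: n.
have h2 : cond1 n.+3 * Ex (@weight R) <= 1 by near: n.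
have h3 : gK K n <= G by near: n.
have h4 : 0 <= cond1 n.+3 * Ex (@weight R).
  by rewrite mulr_ge0 ?(ltW (cond1_gt0 _))// ltW.
have := z_rec n K0; move=> /le_trans; apply.
rewrite addrA; apply: lerD => //.
rewrite -[X in _ <= _ + X]mulr1 -mulrDr.
have [th0 _] := andP th01.
apply: (@le_trans _ _ (th * (z n + cond1 n.+3 * Ex (@weight R)))).
  by rewrite ler_wpM2r// addr_ge0.
by rewrite ler_wpM2l// lerD2l.
Unshelve. all: by end_near. Qed.

Definition tru_lim : R := sup [set tru k | k in [set k | 0 < k]].

(** Every [tru k] is eventually below [z n + 1], and [z] is bounded: this is the finiteness of
    E[1 / W]. *)
Let has_sup_tru : has_sup [set tru k | k in [set k | 0 < k]].
Proof.
split; first by exists (tru 1), 1 => //=.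
have [M hM] := z_bounded; exists (M + 1) => _ [k /= k_gt0 <-].
have [N _ HN] := filterI (tru_le_z k_gt0 ltr01) hM.
by have [h1 h2] := HN N (leqnn N); lra.
Qed.

Lemma tru_le_lim k : 0 < k -> tru k <= tru_lim.
Proof.
by move=> k_gt0; apply: ub_le_sup; [exact: has_sup_tru.2|exists k].
Qed.

Lemma tru_ge_lim e : 0 < e -> exists2 k, 0 < k & forall k', 0 < k' -> k' <= k ->
  tru_lim - e <= tru k'.
Proof.
move=> e0; have [_ [k /= k_gt0 <-] hk] := sup_adherent e0 has_sup_tru.
exists k => // k' k'0 kk; exact: le_trans (ltW hk) (tru_anti k'0 kk).
Qed.

(** For the upper bound, [tru (m * K)^-1] and [tru K^-1] are both close to [tru_lim] for large [K],
    so the source term of the recursion is about (1 - p_1 m) times [tru_lim], and its fixed point is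
    [tru_lim]. The lower bound is [tru_le_z]. *)
Lemma z_cvg : z @ \oo --> tru_lim.
Proof.
have pm1 : 0 < 1 - p_single * m by rewrite subr_gt0.
apply/cvgrPdist_le => e e0.
have e4 : 0 < e / 4 * (1 - p_single * m) by rewrite mulr_gt0 ?divr_gt0.
have upper : \forall n \near \oo, z n <= tru_lim + e.
  have [M hM] := z_bounded.
  have eM : 0 < e / 8 * (1 - p_single * m) / (2 * m * (`|M| + 1)).
    have M1 : 0 < `|M| + 1 by rewrite ltr_wpDl.
    by apply: divr_gt0; [apply: mulr_gt0 => //; exact: divr_gt0|rewrite !mulr_gt0].
  have [l l0 hl] := lap_cvg0 p_single_lt1 eM.
  have [k k_gt0 hk] := tru_ge_lim e4.
  (* Large enough both for [lap (K / 2)] to be small and for the truncation at [K^-1] to be close to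
     the supremum. *)
  pose K := Num.max (2 * l) k^-1.
  have K0 : 0 < K by rewrite lt_max mulr_gt0.
  have Kl : l <= K / 2.
    by rewrite ler_pdivlMr// mulrC le_max lexx.
  have Kk : K^-1 <= k.
    by rewrite -[k]invrK lef_pV2 ?posrE ?invr_gt0// le_max lexx orbT.
  have hlap : lap (K / 2) <= e / 8 * (1 - p_single * m) / (2 * m * (`|M| + 1)).
    exact: le_trans (lap_anti (ltW l0) Kl) hl.
  have htru : tru_lim - e / 4 * (1 - p_single * m) <= tru K^-1.
    by apply: hk => //; rewrite invr_gt0.
  have htru2 : tru (m * K)^-1 <= tru_lim.
    by apply: tru_le_lim; rewrite invr_gt0 mulr_gt0.
  (* The term 2 m [fK] z is moved into the source by means of z <= |M|, which leaves p_1 m as the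
     exact contraction factor. *)
  pose E n := p_single * m * (cond1 n.+3 * Ex (@weight R))
    + 2 * m * fK K n * (`|M| + cond1 n.+3 * Ex (@weight R)) + gK K n.
  have hE : E @ \oo --> 2 * m * lap (K / 2) * `|M|
      + (tru (m * K)^-1 - p_single * m * tru K^-1).
    apply: (cvg_congr (cvgD (cvgD
      (cvgM (cvg_cst (p_single * m)) (cvgM x3_cvg0 (cvg_cst (Ex (@weight R)))))
      (cvgM (cvgM (cvg_cst (2 * m)) (fK_cvg K0))
        (cvgD (cvg_cst `|M|) (cvgM x3_cvg0 (cvg_cst (Ex (@weight R)))))))
      (gK_cvg K0))) => //.
    by rewrite !mul0r mulr0 add0r addr0.
  have lapM : 2 * m * lap (K / 2) * `|M| <= e / 8 * (1 - p_single * m).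
    have M1 : 0 < `|M| + 1 by rewrite ltr_wpDl.
    have h1 : 2 * m * lap (K / 2) * (`|M| + 1) <= e / 8 * (1 - p_single * m).
      have -> : 2 * m * lap (K / 2) * (`|M| + 1) = lap (K / 2) * (2 * m * (`|M| + 1)).
        by ring.
      by rewrite -ler_pdivlMr// !mulr_gt0.
    have h2 : 0 <= 2 * m * lap (K / 2) by rewrite !mulr_ge0 ?lap_ge0// ltW.
    lra.
  have hEt : 2 * m * lap (K / 2) * `|M| + (tru (m * K)^-1 - p_single * m * tru K^-1)
      < (tru_lim + e / 2) * (1 - p_single * m).
    have h3 := ler_wpM2l pm0 htru.
    have h4 : p_single * m * (e / 4 * (1 - p_single * m)) <= e / 4 * (1 - p_single * m).
      by rewrite ler_piMl ?(ltW e4)// ltW.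
    have h5 : 0 < e * (1 - p_single * m) by rewrite mulr_gt0.
    lra.
  have e2 : 0 < e / 2 by rewrite divr_gt0.
  have th01 : 0 <= p_single * m < 1 by rewrite pm0.
  have hE' : \forall n \near \oo, E n <= (tru_lim + e / 2) * (1 - p_single * m).
    by apply: filterS (cvgr_lt _ hE _ hEt) => n /ltW.
  have hz : \forall n \near \oo, z n.+1 <= p_single * m * z n + E n.
    apply: filterS hM => n zM; apply: (le_trans (z_rec n K0)).
    have f0 : 0 <= fK K n by apply: Ex_ge0 => om; exact: phi_ge0.
    have zM' : z n <= `|M| by rewrite (le_trans zM)// ler_norm.
    have h6 : 2 * m * fK K n * z n <= 2 * m * fK K n * `|M|.
      by rewrite ler_wpM2l// !mulr_ge0// ltW.
    rewrite /E; lra.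
  have := contraction_limsup th01 e2 hz hE'.
  by apply: filterS => n; lra.
have e2 : 0 < e / 2 by rewrite divr_gt0.
have [k k_gt0 hk] := tru_ge_lim e2; have {}hk := hk k k_gt0 (lexx _).
have lower := tru_le_z k_gt0 e2.
apply: filterS2 upper lower => n h1 h2.
by rewrite ler_distl; apply/andP; split; lra.
Qed.

(** [phi l] is one at zero, so P(W = 0) is at most [lap l], which can be made arbitrarily small. *)
Lemma ae_gw_lim_gt0 : {ae mu, forall om, 0 < gw_lim om}.
Proof.
pose A : set (configs R setT) := [set om | gw_lim om <= 0].
have mA : measurable A.
  rewrite -[A]setTI.
  have mb : measurable_fun setT ((fun om => gw_lim om <= 0) : configs R setT -> bool).
    by apply: measurable_fun_ler => //; exact: measurable_gw_lim.
  exact: (mb measurableT [set true]).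
have muA e : 0 < e -> (mu A <= e%:E)%E.
  move=> e0; have [l l0 hl] := lap_cvg0 p_single_lt1 e0.
  have iphi := ig_phi measurable_gw_lim gw_lim_ge0 (ltW l0).
  rewrite (le_trans _ (_ : (lap l)%:E <= _)%E) ?lee_fin// /lap -(EFin_Ex iphi).
  have <- : (\int[mu]_x (\1_A x)%:E = mu A)%E by rewrite integral_indic// setIT.
  apply: ge0_le_integral => //.
  - exact/measurable_EFinP.
  - by apply/measurable_EFinP; exact: measurable_phi measurable_gw_lim.
  - move=> om _; rewrite lee_fin indicE.
    have [/set_mem/= h|_] := boolP (om \in A); last exact: phi_ge0.
    have -> : gw_lim om = 0 by apply/eqP; rewrite eq_le h gw_lim_ge0.
    by rewrite /phi mulr0 subr0 le_max lexx orbT.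
exists A; split=> //.
  apply/eqP; rewrite eq_le measure_ge0 andbT; apply/lee_addgt0Pr => e e0.
  by rewrite add0e muA.
by move=> om /= h; rewrite /A /= leNgt; exact/negP.
Qed.

Lemma measurable_gw_limV :
  measurable_fun setT ((fun om => (gw_lim om)^-1) : configs R setT -> R).
Proof.
by apply: measurable_inv_ge0; [exact: measurable_gw_lim|exact: gw_lim_ge0].
Qed.

(** Monotone convergence along the truncation levels 1 / (n + 1). Positivity of W matters: at W = 0
    the inverse is [0] while the truncations diverge. *)
Lemma integral_gw_limV : (\int[mu]_om ((gw_lim om)^-1)%:E = tru_lim%:E)%E.
Proof.
have kn n : 0 < (n.+1%:R^-1 : R) by rewrite invr_gt0.
pose g n om : \bar R := (psi n.+1%:R^-1 (gw_lim om))%:E.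
have mg n : measurable_fun setT (g n : configs R setT -> \bar R).
  by apply/measurable_EFinP; exact: measurable_psi measurable_gw_lim.
have g0 n om : (0 <= g n om)%E by rewrite lee_fin psi_ge0.
have gnd om : nondecreasing_seq (g ^~ om).
  move=> a b ab; rewrite lee_fin; apply: psi_anti => //.
  by rewrite lef_pV2 ?posrE// ler_nat.
transitivity (\int[mu]_om limn (g ^~ om))%E.
  have m1 : measurable_fun setT
      ((fun om => ((gw_lim om)^-1)%:E) : configs R setT -> \bar R).
    by apply/measurable_EFinP; exact: measurable_gw_limV.
  have m2 : measurable_fun setT ((fun om => limn (g ^~ om)) : configs R setT -> \bar R).
    apply: (@emeasurable_fun_cvg _ (configs R setT) R setT g) => // om _.
    exact: ereal_nondecreasing_is_cvgn.
  apply: ge0_ae_eq_integral => //.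
  - by move=> om _; rewrite lee_fin invr_ge0 gw_lim_ge0.
  - move=> om _; apply: lime_ge; last by apply: nearW => n; exact: g0.
    exact: ereal_nondecreasing_is_cvgn.
  apply: (ae_imply ae_gw_lim_gt0) => om W0 _; apply/esym/cvg_lim => //.
  have [N _ HN] : \forall n \near \oo, n.+1%:R^-1 <= gw_lim om.
    apply: filterS (cvgr0_norm_le _ (@cvg_harmonic R) _ W0) => n /=.
    by rewrite /harmonic /= ger0_norm.
  apply: cvg_near_cst; exists N => // n /= Nn; rewrite /g /psi max_l//.
  exact: HN.
rewrite monotone_convergence//.
apply/cvg_lim => //.
have E n : (\int[mu]_om g n om)%E = (tru n.+1%:R^-1)%:E.
  by rewrite /g EFin_Ex//; exact: ig_psi measurable_gw_lim _.
under eq_fun do rewrite E.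
apply: cvg_EFin; first exact: nearW.
apply/cvgrPdist_le => e e0; have [k k_gt0 hk] := tru_ge_lim e0.
near=> n; have nk : n.+1%:R^-1 <= k.
  have : `|harmonic n| <= k by near: n; exact: (cvgr0_norm_le _ (@cvg_harmonic R) _ k_gt0).
  by rewrite /harmonic /= ger0_norm.
rewrite ger0_norm ?subr_ge0 ?tru_le_lim// lerBlDr -lerBlDl.
exact: hk.
Unshelve. all: by end_near. Qed.

(** [con n] is C_{n+1}, hence the [n.+1]. After a shift the quotient is the inverse of a multiple of
    [cond1], which tends to c_1, times [z]. *)
Lemma res_cvg : (fun n => n.+1%:R^-1 * res n) @ \oo --> ratio_const * tru_lim.
Proof.
have c0 := ratio_const_gt0.
have x0 n : cond1 n != 0 by rewrite gt_eqF// cond1_gt0.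
have h1 : (fun n => (n.+3%:R * cond1 n.+2)^-1) @ \oo --> ratio_const.
  have h : (fun n => n.+3%:R * cond1 n.+2) @ \oo --> ratio_const^-1.
    have h3 := cond1_cvg.
    have h4 : (fun n => 3 * cond1 n.+2) @ \oo --> (0 : R).
      have h5 : (fun n => cond1 n.+2) @ \oo --> (0 : R).
        by have := cond1_cvg0; rewrite -cvg_shiftS -cvg_shiftS.
      by apply: (cvg_congr (cvgM (cvg_cst (3 : R)) h5)) => //; rewrite mulr0.
    apply: (cvg_congr (cvgD h3 h4)) => [n|]; last by rewrite addr0.
    rewrite -[LHS]/(n%:R * cond1 n.+2 + 3 * cond1 n.+2) -mulrDl.
    by rewrite -(natrD _ n 3) addn3.
  have ci : ratio_const^-1 != 0 by rewrite invr_eq0 gt_eqF.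
  by apply: (cvg_congr (cvgV ci h)) => //; rewrite invrK.
rewrite -cvg_shiftS -cvg_shiftS.
apply: (cvg_congr (cvgM h1 z_cvg)) => // n.
rewrite -[LHS]/((n.+3%:R * cond1 n.+2)^-1 * (cond1 n.+2 * res n.+2)).
by rewrite invfM -mulrA mulKf.
Qed.
End moments.

(** * Dirichlet's principle on a tree *)

Section effective_conductance.
Context {R : realType}.
Variables (Nw : seq nat -> nat) (cw : seq nat -> R).
Hypothesis cw_gt0 : forall u, 0 < cw u.
Implicit Types (f : seq nat -> R) (x : seq nat).

(* Conductance from [x] to its descendants [k.+1] generations below, by the
   series and parallel laws. *)
Fixpoint series_parallel (k : nat) x : R :=
  match k with
  | 0 => \sum_(i < Nw x) cw (rcons x i)
  | k'.+1 => \sum_(i < Nw x) cw (rcons x i) * series_parallel k' (rcons x i)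
                              / (cw (rcons x i) + series_parallel k' (rcons x i))
  end.

Lemma series_parallel_ge0 k x : 0 <= series_parallel k x.
Proof.
elim: k x => [|k IHk] x /=; apply: sumr_ge0 => i _; first exact: ltW.
have c0 := ltW (cw_gt0 (rcons x i)).
by rewrite divr_ge0 ?mulr_ge0 ?addr_ge0.
Qed.

Lemma energyS f x k : energy Nw cw f x k.+1 = \sum_(i < Nw x)
  (cw (rcons x i) * (f x - f (rcons x i)) ^+ 2 + energy Nw cw f (rcons x i) k).
Proof. by []. Qed.

Lemma energy_ext f f' k x : (forall v, f (x ++ v) = f' (x ++ v)) ->
  energy Nw cw f x k = energy Nw cw f' x k.
Proof.
elim: k x => //= k IHk x ff; apply: eq_bigr => i _.
have := ff [::]; rewrite cats0 => ->; have := ff [:: val i]; rewrite cats1 => ->.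
by congr (_ + _); apply: IHk => v; rewrite cat_rcons.
Qed.

(** With potentials a at a vertex and b at a child, the minimum over b of c (a - b)^2 + g b^2 is c g
    / (c + g) a^2: the series law, obtained by completing the square. *)
Lemma energy_ge k x f :
  (forall v, in_tree (fun u => Nw (x ++ u)) v -> size v = k.+1 -> f (x ++ v) = 0) ->
  series_parallel k x * f x ^+ 2 <= energy Nw cw f x k.+1.
Proof.
elim: k x => [|k IHk] x f0.
  rewrite /= mulr_suml ler_sum// => i _; rewrite addr0.
  have -> : f (rcons x i) = 0; last by rewrite subr0.
  rewrite -cats1; apply: f0 => // -[|j]//= _.
  by rewrite cats0.
rewrite [energy _ _ _ _ _]/= [series_parallel _ _]/= mulr_suml ler_sum// => i _.
set y := rcons x i; set g := series_parallel k y; set c := cw y.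
have g0 : 0 <= g := series_parallel_ge0 k y; have c0 : 0 < c := cw_gt0 y.
have cg : 0 < c + g by rewrite ltr_wpDr.
apply: (@le_trans _ _ (c * (f x - f y) ^+ 2 + g * f y ^+ 2)).
  rewrite -subr_ge0.
  have -> : c * (f x - f y) ^+ 2 + g * f y ^+ 2 - c * g / (c + g) * f x ^+ 2 =
      ((c + g) * f y - c * f x) ^+ 2 / (c + g) by field; rewrite gt_eqF.
  by rewrite divr_ge0 ?sqr_ge0// ltW.
rewrite lerD2l; apply: IHk => v tv sv; rewrite /y cat_rcons; apply: f0.
  move=> [|j]; first by rewrite /= cats0.
  rewrite /= ltnS => jv; have := tv j jv.
  by rewrite /y cat_rcons.
by rewrite /= sv.
Qed.

(** The minimising potential: each edge acts as a voltage divider with ratio c / (c + g). The path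
    [u] is relative to [x], and the potential is grounded at depth [k.+1]. *)
Fixpoint voltage (k : nat) x (u : seq nat) {struct u} : R :=
  match u, k with
  | [::], _ => 1
  | _ :: _, 0 => 0
  | i :: u', k'.+1 => cw (rcons x i) / (cw (rcons x i) + series_parallel k' (rcons x i))
                      * voltage k' (rcons x i) u'
  end.

Lemma voltage_sink k x u : size u = k.+1 -> voltage k x u = 0.
Proof.
by elim: k x u => [|k IHk] x [|i u]//= [] su; rewrite IHk// mulr0.
Qed.

(** The factor [a] makes the induction close, since on a child's subtree the potential is a multiple
    of the voltage issued from that child. *)
Lemma energy_voltage k x a :
  energy Nw cw (fun y => a * voltage k x (drop (size x) y)) x k.+1 =
  series_parallel k x * a ^+ 2.
Proof.
elim: k x a => [|k IHk] x a.
  rewrite /= mulr_suml; apply: eq_bigr => i _.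
  by rewrite addr0 drop_size -cats1 drop_size_cat//= mulr0 subr0 mulr1.
rewrite energyS [series_parallel _ _]/= mulr_suml; apply: eq_bigr => i _.
set y := rcons x i; set g := series_parallel k y; set c := cw y.
have g0 : 0 <= g := series_parallel_ge0 k y; have c0 : 0 < c := cw_gt0 y.
have cg : 0 < c + g by rewrite ltr_wpDr.
have -> : energy Nw cw (fun y0 => a * voltage k.+1 x (drop (size x) y0)) y k.+1 =
    energy Nw cw (fun y0 => a * (c / (c + g)) * voltage k y (drop (size y) y0)) y k.+1.
  apply: energy_ext => v; rewrite [in RHS]drop_size_cat// /y cat_rcons drop_size_cat//=.
  by rewrite mulrA.
rewrite drop_size /y -cats1 drop_size_cat// cats1 -/y.
have -> : voltage k.+1 x [::] = 1 by [].
have -> : voltage k.+1 x [:: val i] = c / (c + g) by case: k @g g0 cg {IHk} => *; rewrite /= mulr1.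
by rewrite IHk -/g; field; rewrite gt_eqF.
Qed.

(** [energy_ge] is the lower bound and [voltage] attains it. Level 0 is left out because the two
    boundary conditions contradict each other at the root. *)
Lemma eff_conductanceE n : eff_conductance Nw cw n.+1 = series_parallel n [::].
Proof.
rewrite /eff_conductance; set S := [set E | _].
have inS : S (series_parallel n [::]).
  exists (fun y => 1 * voltage n [::] (drop (size ([::] : seq nat)) y)); split.
  - by rewrite /= mul1r; case: n {S}.
  - by move=> y _ sy; rewrite drop0 voltage_sink ?mulr0.
  - by rewrite energy_voltage expr1n mulr1.
have lbS : lbound S (series_parallel n [::]).
  move=> _ [f [f1 f0 ->]].
  have := @energy_ge n [::] f (fun v tv sv => f0 v tv sv).
  by rewrite f1 expr1n mulr1.
apply/eqP; rewrite eq_le; apply/andP; split.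
  by apply: ge_inf => //; exists (series_parallel n [::]).
by apply: lb_le_inf => //; exists (series_parallel n [::]).
Qed.

End effective_conductance.

(** * The recursions as conductance and size of a concrete tree *)

Section gw_tree.
Context {R : realType}.
Variable m : R.
Hypothesis m_gt0 : 0 < m.
Variable om : config R.
Hypothesis om1_gt0 : forall u, (0 < om.1 u)%N.
Hypothesis om2_gt0 : forall u, 0 < om.2 u.

Lemma shift_rcons x i : shift [:: i] (shift x om) = shift (rcons x i) om.
Proof. by congr (_, _); apply/funext => u; rewrite /= cat_rcons. Qed.

Lemma offspring_shift x : offspring (shift x om) = om.1 x.
Proof. by rewrite /offspring /= cats0; apply/maxn_idPr. Qed.

Lemma weight_shift x : weight (shift x om) = om.2 x.
Proof. by rewrite /weight /= cats0 om2_gt0. Qed.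

(** [con] measures depth from [x], whereas the edge conductances use depth from the root: this
    accounts for the factor. *)
Lemma series_parallel_con k x :
  series_parallel om.1 (edge_cond m om.2) k x = m ^- size x * con m k (shift x om).
Proof.
elim: k x => [|k IHk] x; rewrite conE /child_sum offspring_shift mulrA -invfM -exprSr
  mulr_sumr /=; apply: eq_bigr => i _; rewrite shift_rcons.
  by rewrite /edge_cond size_rcons /yv weight_shift invfM.
rewrite IHk /yv weight_shift /edge_cond size_rcons.
set c := con _ _ _; have c0 : 0 < c := con_gt0 m_gt0 k _.
have x0 := om2_gt0 (rcons x i); set xi := om.2 _ in x0 *.
have ms : 0 < m ^+ (size x).+1 by rewrite exprn_gt0.
set M := m ^+ _ in ms *.
field; rewrite !gt_eqF// ?addr_gt0 ?mulr_gt0//.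
Qed.

Lemma eff_conductance_con n : eff_conductance om.1 (edge_cond m om.2) n.+1 = con m n om.
Proof.
rewrite eff_conductanceE//; last first.
  by move=> u; rewrite /edge_cond invr_gt0 mulr_gt0// exprn_gt0.
rewrite series_parallel_con expr0 invr1 mul1r; congr con.
by case: om.
Qed.

Lemma gen_size_gw k x : m ^- k * (gen_size om.1 x k)%:R = gw m k (shift x om).
Proof.
elim: k x => [|k IHk] x /=; first by rewrite expr0 invr1 mul1r.
rewrite /child_sum offspring_shift natr_sum exprSr invfM mulrC mulrA mulrC mulr_suml.
congr (_ * _); apply: eq_bigr => i _.
by rewrite shift_rcons -IHk mulrC.
Qed.

End gw_tree.

(** * Transfer to the given probability space *)

Section law_of_tree.
Context {d : measure_display} {T : measurableType d} {R : realType}.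
Variables (P : probability T R) (N : seq nat -> T -> nat) (xi : seq nat -> T -> R).
Hypothesis mN : forall u k, measurable [set w | N u w = k].
Hypothesis mxi : forall u, measurable_fun setT (xi u).
Local Notation X := (gw_family N xi).

Definition environment (w : T) : config R := (fun u => N u w, fun u => xi u w).

Lemma coord_environment i w : coord i (environment w) = X i w.
Proof. by case: i. Qed.

Lemma preimage_offspring u (B : set nat) :
  N u @^-1` B = \bigcup_(k in B) [set w | N u w = k].
Proof.
by apply/seteqP; split=> [w Bw|w [k Bk /= ->]//]; exists (N u w).
Qed.

Lemma measurable_offspring_count u : measurable_fun setT (N u).
Proof.
by move=> _ B _; rewrite setTI preimage_offspring; exact: bigcup_measurable.
Qed.

Lemma preimage_gw_offspring u (B : set R) :
  X (inl u) @^-1` B = \bigcup_(k in [set k | B k%:R]) [set w | N u w = k].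
Proof. exact: (preimage_offspring u [set k | B k%:R]). Qed.

Lemma measurable_gw_family i : measurable_fun setT (X i).
Proof.
case: i => [u|u]; last exact: mxi.
move=> _ B _; rewrite setTI.
by rewrite preimage_gw_offspring; exact: bigcup_measurable.
Qed.

Lemma measurable_environment :
  measurable_fun setT (environment : T -> configs R setT).
Proof.
apply: measurable_configs => i _.
rewrite (_ : _ \o _ = X i); first exact: measurable_gw_family.
by apply/funext => w /=; rewrite coord_environment.
Qed.

Definition environment_mfun : {mfun T >-> configs R setT} :=
  HB.pack (environment : T -> configs R setT)
    (isMeasurableFun.Build _ _ _ _ _ measurable_environment).

Definition environment_law : probability (configs R setT) R :=
  distribution P environment_mfun.

Lemma ge0_integral_environment (f : config R -> \bar R) :
  measurable_fun setT (f : configs R setT -> \bar R) -> (forall om, 0 <= f om)%E ->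
  (\int[P]_w f (environment w) = \int[environment_law]_om f om)%E.
Proof.
by move=> mf f0; rewrite (@ge0_integral_distribution _ _ _ _ _ P environment_mfun f mf f0).
Qed.

Hypothesis indep : mutually_independent P X.
Hypothesis offspring_law : forall u v k, P [set w | N u w = k] = P [set w | N v w = k].
Hypothesis xi_law : forall u v B, measurable B -> P (xi u @^-1` B) = P (xi v @^-1` B).

Lemma cylinder_prob (s : seq vertex_data) (B : vertex_data -> set R) : uniq s ->
  (forall i, measurable (B i)) ->
  P [set w | forall i, i \in s -> B i (X i w)] = (\prod_(i <- s) P (X i @^-1` B i))%E.
Proof.
by move=> us mB; rewrite -indep// -bigcap_seq. Qed.

Lemma environment_law_cylinder (s : seq vertex_data) (B : vertex_data -> set R) :
  uniq s -> (forall i, measurable (B i)) ->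
  environment_law [set om | forall i, i \in s -> B i (coord i om)] =
  (\prod_(i <- s) P (X i @^-1` B i))%E.
Proof.
move=> us mB; rewrite -cylinder_prob//; congr (P _).
by apply/seteqP; split=> w /= h i; have := h i; rewrite coord_environment.
Qed.

(** Independence is assumed along lists without repetition, so cylinders are first brought to that
    form. *)
Lemma cylinder_uniq J (A : set (config R)) : cylinder (@coord R) J A ->
  exists (s : seq vertex_data) (B : vertex_data -> set R),
    [/\ uniq s, (forall i, i \in s -> J i), (forall i, measurable (B i)) &
        A = [set om | forall i, i \in s -> B i (coord i om)]].
Proof.
move=> [s [B [sJ mB ->]]]; exists (undup s), B; split=> //.
- exact: undup_uniq.
- by move=> i; rewrite mem_undup; exact: sJ.
- by apply/seteqP; split=> w /= h i; have := h i; rewrite mem_undup.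
Qed.

Lemma environment_law_indep (J K : set vertex_data) (A B : set (config R)) :
  J `&` K = set0 -> cylinder (@coord R) J A -> cylinder (@coord R) K B ->
  environment_law (A `&` B) = (environment_law A * environment_law B)%E.
Proof.
move=> JK /cylinder_uniq[s [C [us sJ mC ->]]] /cylinder_uniq[t [D [ut tK mD ->]]].
have st i : i \in t -> i \in s = false.
  move=> it; apply/negP => is_; have : (J `&` K) i by split; [exact: sJ|exact: tK].
  by rewrite JK.
pose E i := if i \in s then C i else D i.
have mE i : measurable (E i) by rewrite /E; case: ifP.
have -> : [set om | forall i, i \in s -> C i (coord i om)] `&`
    [set om | forall i, i \in t -> D i (coord i om)] =
    [set om | forall i, i \in s ++ t -> E i (coord i om)].
  apply/seteqP; split=> om /=.
    move=> [h1 h2] i; rewrite mem_cat /E; case: ifP => [is_ _|_ /=]; first exact: h1.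
    exact: h2.
  move=> h; split=> i hi; have := h i; rewrite mem_cat hi ?orbT /E.
    by rewrite hi; apply.
  by rewrite st//; apply.
rewrite !environment_law_cylinder//; last first.
  rewrite cat_uniq us ut andbT; apply/hasPn => i /st /= ->; by [].
rewrite big_cat/=; congr (_ * _)%E; rewrite !big_seq; apply: eq_bigr => i hi.
  by rewrite /E hi.
by rewrite /E st.
Qed.

Lemma gw_family_law x i B : measurable B -> P (X (move_label x i) @^-1` B) = P (X i @^-1` B).
Proof.
case: i => [u|u] mB; last exact: xi_law.
have E v : P (X (inl v) @^-1` B) =
    (\sum_(0 <= k <oo | k \in [set k | B k%:R]) P [set w | N v w = k])%E.
  rewrite preimage_gw_offspring measure_bigcup//.
  by apply/trivIsetP => i j _ _ /eqP ij; apply/seteqP; split=> w // [/= wi wj];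
    apply: ij; rewrite -wi.
rewrite [LHS]E [RHS]E; apply: eq_eseriesr => k _; exact: offspring_law.
Qed.

(** The preimage is a cylinder over the translated labels, with [back] stripping the prefix; the
    factors agree one by one by equality in law. *)
Lemma environment_law_shift x (A : set (config R)) :
  cylinder (@coord R) setT A -> environment_law (shift x @^-1` A) = environment_law A.
Proof.
move=> /cylinder_uniq[s [B [us _ mB ->]]].
pose back (i : vertex_data) : vertex_data :=
  match i with inl u => inl (drop (size x) u) | inr u => inr (drop (size x) u) end.
have backK : cancel (move_label x) back by move=> [u|u] /=; rewrite drop_size_cat.
have -> : shift x @^-1` [set om | forall i, i \in s -> B i (coord i om)] =
   [set om | forall i, i \in map (move_label x) s -> B (back i) (coord i om)].
  apply/seteqP; split=> om /= h i.
    by move=> /mapP[j js ->]; rewrite backK; have := h j js; rewrite coord_shift.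
  move=> hi; rewrite coord_shift; have := h (move_label x i) (map_f _ hi).
  by rewrite backK.
have ums : uniq (map (move_label x) s).
  by rewrite map_inj_uniq//; exact: move_label_inj.
rewrite (@environment_law_cylinder s)// (@environment_law_cylinder _ (B \o back))//;
  last by move=> i; exact: mB.
by rewrite big_map; apply: eq_bigr => i _; rewrite -[in RHS](gw_family_law x)// /comp backK.
Qed.

End law_of_tree.

(** * Moments of the given tree and conclusion *)

Section galton_watson.
Context {d : measure_display} {T : measurableType d} {R : realType}.
Variables (P : probability T R) (p : nat -> R) (m : R).
Variables (N : seq nat -> T -> nat) (xi : seq nat -> T -> R) (xi0 : T -> R).
Hypothesis p0 : p 0%N = 0.
Hypothesis mean_p : (fun n => \sum_(0 <= k < n) k%:R * p k) @ \oo --> m.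
Hypothesis m_gt1 : 1 < m.
Hypothesis mN : forall u k, measurable [set w | N u w = k].
Hypothesis N_law : forall u k, P [set w | N u w = k] = (p k)%:E.
Hypothesis mxi0 : measurable_fun setT xi0.
Hypothesis xi0_gt0 : forall w, 0 < xi0 w.
Hypothesis mxi : forall u, measurable_fun setT (xi u).
Hypothesis xi_law : forall u B, measurable B -> P (xi u @^-1` B) = P (xi0 @^-1` B).
Hypothesis xi_gt0 : forall u w, 0 < xi u w.
Hypothesis indep : mutually_independent P (gw_family N xi).
Hypothesis moments : (\int[P]_w ((xi0 w) ^+ 2 + (xi0 w)^-1 + ((N [::] w)%:R) ^+ 3)%:E < +oo)%E.

Let m_gt0 : 0 < m. Proof. exact: lt_trans m_gt1. Qed.

Let env := environment N xi.
Let mu := environment_law P mN mxi.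

Let mu_indep (J K : set vertex_data) (A B : set (config R)) :
  J `&` K = set0 -> cylinder (@coord R) J A -> cylinder (@coord R) K B ->
  mu (A `&` B) = (mu A * mu B)%E.
Proof. exact: environment_law_indep. Qed.

Let mu_shift x (A : set (config R)) :
  cylinder (@coord R) setT A -> mu (shift x @^-1` A) = mu A.
Proof.
apply: environment_law_shift => //; first by move=> u v k; rewrite !N_law.
by move=> u v B mB; rewrite !xi_law.
Qed.

Lemma integral_offspring_count (f : nat -> R) : (forall k, 0 <= f k) ->
  (\int[P]_w (f (N [::] w))%:E = \sum_(0 <= k <oo) (f k * p k)%:E)%E.
Proof.
move=> f0; have TE : setT = \bigcup_k [set w | N [::] w = k].
  by apply/seteqP; split=> w // _; exists (N [::] w).
have mf : measurable_fun setT (fun w => (f (N [::] w))%:E).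
  apply/measurable_EFinP; apply: (@measurableT_comp _ _ _ _ _ _ f) => //.
  exact: measurable_offspring_count.
rewrite TE ge0_integral_bigcup//=; last 3 first.
- by rewrite -TE.
- by move=> w _; rewrite lee_fin.
- apply/trivIsetP => i j _ _ /eqP ij; apply/seteqP; split=> w // [/= wi wj].
  by apply: ij; rewrite -wi.
apply: eq_eseriesr => k _.
rewrite (eq_integral (fun=> (f k)%:E)); last by move=> w /set_mem /= ->.
rewrite integral_cst// EFinM; congr (_ * _)%E; exact: N_law.
Qed.

(** Since p_0 = 0 the value at [0] carries no mass, which removes the floor in [offspring]. *)
Lemma integral_offspring_ext (f g : nat -> R) : (forall k, 0 <= f k) -> (forall k, 0 <= g k) ->
  (forall k, (0 < k)%N -> f k = g k) ->
  (\int[P]_w (f (N [::] w))%:E = \int[P]_w (g (N [::] w))%:E)%E.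
Proof.
move=> f0 g0 fg; rewrite !integral_offspring_count//.
by apply: eq_eseriesr => -[|k] _; [rewrite p0 !mulr0|rewrite fg].
Qed.

Lemma integral_law_offspring (f : nat -> R) : (forall k, 0 <= f k) ->
  (\int[mu]_om (f (offspring om))%:E = \int[P]_w (f (N [::] w))%:E)%E.
Proof.
move=> f0; rewrite -(ge0_integral_environment P mN mxi (f := fun om => (f (offspring om))%:E)).
- apply: (@integral_offspring_ext (f \o maxn 1) f) => // [k|k k0] /=; first exact: f0.
  by congr f; apply/maxn_idPr.
- apply/measurable_EFinP; apply: (@measurableT_comp _ _ _ _ _ _ f) => //.
  exact: measurable_offspring_root.
- by move=> om; rewrite lee_fin.
Qed.

Lemma measurable_law_offspring (f : nat -> R) :
  measurable_fun setT ((fun om => f (offspring om)) : configs R setT -> R).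
Proof.
apply: (@measurableT_comp _ _ _ _ _ _ f) => //; exact: measurable_offspring_root.
Qed.

Lemma Ex_law_offspring (f : nat -> R) : (forall k, 0 <= f k) ->
  Ex mu (fun om => f (offspring om)) = fine (\int[P]_w (f (N [::] w))%:E)%E.
Proof. by move=> f0; rewrite /Ex /Rintegral integral_law_offspring. Qed.

Lemma law_offspring_mean : Ex mu (fun om => (offspring om)%:R) = m.
Proof.
rewrite (@Ex_law_offspring (fun k => k%:R))// integral_offspring_count//.
rewrite (_ : limn _ = m%:E)//; apply/cvg_lim => //.
under eq_fun do rewrite sumEFin.
by apply: cvg_EFin => //; exact: nearW.
Qed.

Lemma integral_law_weight (h : R -> R) : measurable_fun setT h -> (forall x, 0 <= h x) ->
  (\int[mu]_om (h (weight om))%:E = \int[P]_w (h (xi0 w))%:E)%E.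
Proof.
move=> mh h0; rewrite -(ge0_integral_environment P mN mxi
  (f := fun om => (h (weight om))%:E)); last 2 first.
- by apply/measurable_EFinP; apply: measurableT_comp => //; exact: measurable_weight_root.
- by move=> om; rewrite lee_fin.
rewrite (eq_integral (fun w => (h (xi [::] w))%:E)); last first.
  by move=> w _; rewrite /weight /= xi_gt0.
pose f : {mfun T >-> R} := HB.pack (xi [::]) (isMeasurableFun.Build _ _ _ _ _ (mxi [::])).
pose g : {mfun T >-> R} := HB.pack xi0 (isMeasurableFun.Build _ _ _ _ _ mxi0).
have mEh : measurable_fun setT (EFin \o h) by exact/measurable_EFinP.
have Eh0 x : (0 <= (EFin \o h) x)%E by rewrite lee_fin.
rewrite -(@ge0_integral_distribution _ _ _ _ _ P f _ mEh Eh0).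
rewrite -(@ge0_integral_distribution _ _ _ _ _ P g _ mEh Eh0).
by apply: eq_measure_integral => A mA _; exact: xi_law.
Qed.

Let moment_lt (F : T -> R) : measurable_fun setT F ->
  (forall w, 0 <= F w <= (xi0 w) ^+ 2 + (xi0 w)^-1 + (N [::] w)%:R ^+ 3) ->
  (\int[P]_w (F w)%:E < +oo)%E.
Proof.
move=> mF F0; apply: le_lt_trans moments; apply: ge0_le_integral => //.
- by move=> w _; rewrite lee_fin; case/andP: (F0 w).
- exact/measurable_EFinP.
- apply/measurable_EFinP; apply: measurable_funD; last first.
    by apply: measurable_funX; exact: (measurable_gw_family mN mxi (inl [::])).
  by apply: measurable_funD; [exact: measurable_funX|exact: measurable_inv_gt0].
- by move=> w _; rewrite lee_fin; case/andP: (F0 w).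
Qed.

Let xi2 w : 0 <= xi0 w ^+ 2. Proof. exact: sqr_ge0. Qed.
Let xiV w : 0 <= (xi0 w)^-1. Proof. by rewrite invr_ge0 ltW. Qed.
Let N3 w : 0 <= (N [::] w)%:R ^+ 3 :> R. Proof. exact: exprn_ge0. Qed.

Lemma ig_law_offspring3 : ig mu (fun om => (offspring om)%:R ^+ 3).
Proof.
apply: ig_fin.
- exact: (measurable_law_offspring (fun k => k%:R ^+ 3)).
- by move=> om; exact: exprn_ge0.
rewrite (@integral_law_offspring (fun k => k%:R ^+ 3)); last by move=> k; exact: exprn_ge0.
apply: moment_lt.
  by apply: measurable_funX; exact: (measurable_gw_family mN mxi (inl [::])).
by move=> w; rewrite N3/= lerDr addr_ge0.
Qed.

Lemma ig_law_weight2 : ig mu (fun om => weight om ^+ 2).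
Proof.
apply: ig_fin.
- by apply: measurable_funX; exact: measurable_weight_root.
- by move=> om; exact: sqr_ge0.
rewrite (@integral_law_weight (fun x => x ^+ 2)); last 2 first.
- exact: measurable_funX.
- exact: sqr_ge0.
apply: moment_lt; first exact: measurable_funX.
by move=> w; rewrite xi2/= -addrA lerDl addr_ge0.
Qed.

Lemma ig_law_weightV : ig mu (fun om => (weight om)^-1).
Proof.
apply: ig_fin.
- apply: measurable_inv_gt0; [exact: measurable_weight_root|exact: weight_gt0].
- by move=> om; rewrite invr_ge0 ltW// weight_gt0.
(* [integral_law_weight] asks for nonnegativity on the whole line, hence the maximum with [0], which
   does not affect positive weights. *)
pose h (x : R) := (Num.max 0 x)^-1.
rewrite (eq_integral (fun om : configs R setT => (h (weight om))%:E)); last first.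
  by move=> om _; rewrite /h max_r// ltW// weight_gt0.
rewrite integral_law_weight; last 2 first.
- apply: measurable_inv_ge0; last by move=> x; rewrite le_max lexx.
  exact: measurable_maxr.
- by move=> x; rewrite invr_ge0 le_max lexx.
apply: moment_lt.
  rewrite /h (_ : (fun _ => _) = fun w => (xi0 w)^-1); first exact: measurable_inv_gt0.
  by apply/funext => w; rewrite max_r// ltW.
move=> w; rewrite /h max_r; last exact: ltW.
by rewrite xiV/= -addrA addrCA lerDl addr_ge0.
Qed.

Lemma law_weight_mean : Ex mu weight = fine (\int[P]_w (xi0 w)%:E)%E.
Proof.
rewrite /Ex /Rintegral; congr fine; pose h (x : R) := Num.max 0 x.
rewrite (eq_integral (fun om : configs R setT => (h (weight om))%:E)); last first.
  by move=> om _; rewrite /h max_r// ltW// weight_gt0.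
rewrite integral_law_weight; last 2 first.
- exact: measurable_maxr.
- by move=> x; rewrite le_max lexx.
by apply: eq_integral => w _; rewrite /h max_r// ltW.
Qed.

Lemma ratio_const_law : ratio_const mu m =
  m ^- 2 * fine (\int[P]_w ((N [::] w)%:R * ((N [::] w)%:R - 1))%:E)%E *
  fine (\int[P]_w (xi0 w)%:E)%E / (1 - m^-1).
Proof.
rewrite /ratio_const law_weight_mean /fact2 (@Ex_law_offspring (fun k => k%:R * (k%:R - 1)))//.
by move=> [|k]; rewrite ?mul0r// mulr_ge0// -natrB.
Qed.

Lemma p_single_law : p_single mu = p 1%N.
Proof.
rewrite /p_single (@Ex_law_offspring (fun k => (k == 1)%:R))//.
rewrite (@integral_offspring_count (fun k => (k == 1)%:R))//.
rewrite (@nneseries_split _ _ 0 2)//; last first.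
  by move=> k _; rewrite lee_fin mulr_ge0// -lee_fin -(N_law [::]).
rewrite eseries0 ?adde0; last by move=> [|[|k]]//= _ _; rewrite mul0r.
by rewrite add0n !big_nat_recl// big_geq// mul0r mul1r add0r adde0.
Qed.

(** One null set serves all vertices, since the labels are countable; [unpickle] enumerates them. *)
Lemma ae_offspring_gt0 : {ae P, forall w, forall u, (0 < N u w)%N}.
Proof.
have ae_u u : {ae P, forall w, (0 < N u w)%N}.
  exists [set w | N u w = 0]; split => //; first by rewrite N_law p0.
  by move=> w /= /negP; rewrite -leqNgt leqn0 => /eqP.
have : {ae P, forall w, forall n, (0 < N (odflt [::] (unpickle n)) w)%N}.
  by apply: ae_foralln.
by apply: filterS => w + u => /(_ (pickle u)); rewrite pickleK.
Qed.

Let mcw u : measurable_fun setT (fun w => edge_cond m (fun v => xi v w) u).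
Proof.
apply: measurable_inv_gt0; first exact: measurable_funM.
by move=> w; rewrite mulr_gt0// exprn_gt0.
Qed.

Let cw_gt0 w u : 0 < edge_cond m (fun v => xi v w) u.
Proof. by rewrite invr_gt0 mulr_gt0// exprn_gt0. Qed.

Lemma measurable_sum_children (F : nat -> T -> R) x :
  (forall i, measurable_fun setT (F i)) ->
  measurable_fun setT (fun w => \sum_(i < N x w) F i w).
Proof.
move=> mF; apply: (@measurable_fun_nat _ _ _ _ (N x) (fun k w => \sum_(i < k) F i w)).
  exact: measurable_offspring_count.
by move=> k; exact: measurable_sum.
Qed.

Lemma measurable_Cn k : measurable_fun setT (Cn m N xi k.+1).
Proof.
rewrite (_ : Cn m N xi k.+1 = fun w =>
  series_parallel (fun u => N u w) (edge_cond m (fun u => xi u w)) k [::]); last first.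
  by apply/funext => w; exact: eff_conductanceE.
elim: k [::] => [|k IHk] x /=.
  exact: (measurable_sum_children (F := fun i w => edge_cond m (fun u => xi u w) (rcons x i))).
apply: (measurable_sum_children (F := fun i w =>
  edge_cond m (fun u => xi u w) (rcons x i) *
  series_parallel (fun u => N u w) (edge_cond m (fun u => xi u w)) k (rcons x i) /
  (edge_cond m (fun u => xi u w) (rcons x i) +
   series_parallel (fun u => N u w) (edge_cond m (fun u => xi u w)) k (rcons x i)))) => i.
apply: measurable_funM; first exact: measurable_funM.
apply: measurable_inv_gt0; first exact: measurable_funD.
by move=> w; rewrite ltr_wpDr// series_parallel_ge0.
Qed.

Lemma Cn_ge0 k w : 0 <= Cn m N xi k.+1 w.
Proof. by rewrite /Cn eff_conductanceE// series_parallel_ge0. Qed.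

Lemma measurable_Wlim : measurable_fun setT (Wlim m N).
Proof.
apply: measurable_limn => k; apply: measurable_funM => //.
elim: k [::] => [|k IHk] x //=.
under eq_fun do rewrite natr_sum.
exact: (measurable_sum_children (F := fun i w => (gen_size (fun u => N u w) (rcons x i) k)%:R)).
Qed.

Lemma Wlim_ge0 w : 0 <= Wlim m N w.
Proof.
rewrite /Wlim; set u := fun n : nat => _.
have [cu|/dvgP -> //] := pselect (cvgn u).
by apply: limr_ge => //; apply: nearW => n; rewrite /u mulr_ge0// invr_ge0 exprn_ge0// ltW.
Qed.

(** Almost surely every label has a positive offspring number, and then the conductance of the tree
    is [con] of its environment, with the index lowered by one. *)
Lemma integral_Cn k : (\int[P]_w (Cn m N xi k.+1 w)%:E)%E = (cond1 mu m k)%:E.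
Proof.
rewrite -EFin_Ex; last exact: ig_con law_offspring_mean ig_law_offspring3 ig_law_weightV _.
rewrite -(ge0_integral_environment P mN mxi (f := fun om => (con m k om)%:E)); last 2 first.
- by apply/measurable_EFinP; exact: measurable_conT.
- by move=> om; rewrite lee_fin con_ge0.
apply: ge0_ae_eq_integral => //.
- by apply/measurable_EFinP; exact: measurable_Cn.
- apply/measurable_EFinP.
  exact: (measurableT_comp (measurable_conT m_gt0 k) (measurable_environment mN mxi)).
- by move=> w _; rewrite lee_fin Cn_ge0.
- by move=> w _; rewrite lee_fin con_ge0.
apply: (ae_imply ae_offspring_gt0) => w N0 _; congr EFin.
exact: (@eff_conductance_con _ m m_gt0 (env w) N0 (fun u => xi_gt0 u w) k).
Qed.

Lemma integral_Rn k : (\int[P]_w (Rn m N xi k.+1 w)%:E)%E = (res mu m k)%:E.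
Proof.
rewrite -EFin_Ex; last exact: ig_conV ig_law_weight2 _.
rewrite -(ge0_integral_environment P mN mxi (f := fun om => ((con m k om)^-1)%:E)); last 2 first.
- by apply/measurable_EFinP; exact: measurable_conV.
- by move=> om; rewrite lee_fin invr_ge0 con_ge0.
apply: ge0_ae_eq_integral => //.
- by apply/measurable_EFinP; apply: measurable_inv_ge0; [exact: measurable_Cn|exact: Cn_ge0].
- apply/measurable_EFinP.
  exact: (measurableT_comp (measurable_conV m_gt1 k) (measurable_environment mN mxi)).
- by move=> w _; rewrite lee_fin invr_ge0 Cn_ge0.
- by move=> w _; rewrite lee_fin invr_ge0 con_ge0.
apply: (ae_imply ae_offspring_gt0) => w N0 _; congr (EFin _^-1).
exact: (@eff_conductance_con _ m m_gt0 (env w) N0 (fun u => xi_gt0 u w) k).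
Qed.

Lemma integral_WlimV :
  (\int[P]_w ((Wlim m N w)^-1)%:E = \int[mu]_om ((gw_lim m om)^-1)%:E)%E.
Proof.
rewrite -(ge0_integral_environment P mN mxi (f := fun om => ((gw_lim m om)^-1)%:E)); last 2 first.
- by apply/measurable_EFinP; exact: measurable_gw_limV.
- by move=> om; rewrite lee_fin invr_ge0 gw_lim_ge0.
apply: ge0_ae_eq_integral => //.
- apply/measurable_EFinP; apply: measurable_inv_ge0; [exact: measurable_Wlim|exact: Wlim_ge0].
- apply/measurable_EFinP.
  exact: (measurableT_comp (measurable_gw_limV m_gt1) (measurable_environment mN mxi)).
- by move=> w _; rewrite lee_fin invr_ge0 Wlim_ge0.
- by move=> w _; rewrite lee_fin invr_ge0 gw_lim_ge0.
apply: (ae_imply ae_offspring_gt0) => w N0 _; congr (EFin (_^-1)); congr (limn _).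
by apply/funext => n; exact: (@gen_size_gw _ m (env w) N0 n [::]).
Qed.

Lemma Cn_cvg :
  (fun n : nat => (n%:R%:E * \int[P]_w (Cn m N xi n w)%:E)%E) @ \oo
    --> ((ratio_const mu m)^-1)%:E.
Proof.
have mean := law_offspring_mean; have i3 := ig_law_offspring3.
have w2 := ig_law_weight2; have wV := ig_law_weightV.
have c0 : cond1 mu m k.+2 @[k --> \oo] --> (0 : R).
  have := cond1_cvg0 mu_indep mu_shift m_gt1 mean i3 w2 wV.
  by rewrite -(cvg_shiftn 2); under eq_fun do rewrite addn2.
(* [cond1 k.+2] is the mean of C_{k+3}, so the prefactor is k + 3; its constant part contributes a
   vanishing term. *)
have c1 : k%:R * cond1 mu m k.+2 + 3 * cond1 mu m k.+2 @[k --> \oo] -->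
    (ratio_const mu m)^-1 + 3 * 0.
  apply: cvgD; first exact: cond1_cvg.
  by apply: cvgM => //; exact: cvg_cst.
rewrite -(cvg_shiftn 3) /=.
under eq_fun do rewrite addn3 integral_Cn -EFinM -addn3 natrD mulrDl.
apply: cvg_EFin; first exact: nearW.
by move: c1; rewrite mulr0 addr0.
Qed.

Lemma Rn_cvg : p 1%N * m < 1 ->
  (fun n : nat => ((n%:R)^-1%:E * \int[P]_w (Rn m N xi n w)%:E)%E) @ \oo
    --> ((ratio_const mu m)%:E * \int[P]_w ((Wlim m N w)^-1)%:E)%E.
Proof.
rewrite -p_single_law => p1m.
have mean := law_offspring_mean; have i3 := ig_law_offspring3.
have w2 := ig_law_weight2; have wV := ig_law_weightV.
rewrite integral_WlimV (integral_gw_limV mu_indep mu_shift)// -EFinM.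
rewrite -cvg_shiftS /=.
under eq_fun do rewrite integral_Rn -EFinM.
apply: cvg_EFin; first exact: nearW.
exact: res_cvg.
Qed.

End galton_watson.

Theorem theorem1p2 (d : measure_display) (T : measurableType d) (R : realType)
  (P : probability T R) (p : nat -> R) (m : R)
  (N : seq nat -> T -> nat) (xi : seq nat -> T -> R) (ξ : T -> R) :
  (* offspring distribution p: p_0 = 0, mean m > 1 (finite) *)
  p 0%N = 0 ->
  (fun n => \sum_(0 <= k < n) k%:R * p k) @ \oo --> m ->
  1 < m ->
  (* each N u is a random variable with law p *)
  (forall u k, measurable [set w | N u w = k]) ->
  (forall u k, P [set w | N u w = k] = (p k)%:E) ->
  (* xi is strictly positive; the xi u are copies of xi *)
  measurable_fun setT ξ ->
  (forall w, 0 < ξ w) ->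
  (forall u, measurable_fun setT (xi u)) ->
  (forall u B, measurable B -> P (xi u @^-1` B) = P (ξ @^-1` B)) ->
  (forall u w, 0 < xi u w) ->
  (* all offspring numbers and edge variables are mutually independent *)
  mutually_independent P (gw_family N xi) ->
  (* moment condition E[xi^2 + xi^{-1} + nu^3] < oo, nu = N [::] *)
  (\int[P]_w ((ξ w) ^+ 2 + (ξ w)^-1 + ((N [::] w)%:R) ^+ 3)%:E < +oo)%E ->
  let a1 := m ^- 2 * fine (\int[P]_w ((N [::] w)%:R * ((N [::] w)%:R - 1))%:E) in
  let b1 := fine (\int[P]_w (ξ w)%:E) in
  let c1 := a1 * b1 / (1 - m^-1) in
  ((fun n : nat => (n%:R%:E * \int[P]_w (Cn m N xi n w)%:E)%E) @ \oo
     --> (c1^-1)%:E)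
  /\
  (p 1%N * m < 1 ->
   (fun n : nat => ((n%:R)^-1%:E * \int[P]_w (Rn m N xi n w)%:E)%E) @ \oo
     --> (c1%:E * \int[P]_w ((Wlim m N w)^-1)%:E)%E).
Proof.
move=> p0 mean_p m_gt1 mN N_law mξ ξ_gt0 mxi xi_law xi_gt0 indep moments a1 b1 c1.
have c1E : ratio_const (environment_law P mN mxi) m = c1.
  exact: ratio_const_law p0 mN N_law mξ ξ_gt0 mxi xi_law xi_gt0.
rewrite -c1E; split; first exact (Cn_cvg p0 mean_p m_gt1 N_law mξ ξ_gt0 xi_law xi_gt0 indep moments).
exact (Rn_cvg p0 mean_p m_gt1 N_law mξ ξ_gt0 xi_law xi_gt0 indep moments).
Qed.
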